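(* For every Riemannian manifold $(M,g)$ with Riemannian distance $d$, every $z\in M$ and every linearly independent pair of tangent vectors $v,w\in T_zM$, the sectional curvature $\mathsf{Sec}_z(v,w)$ of the plane spanned by $v,w$ is given by $$\mathsf{Sec}_z(v,w)=3\lim_{t\to0}\frac{t^2|v-w|^2-d^2\big(\exp_z(tv),\exp_z(tw)\big)}{t^4\big(|v|^2|w|^2-\langle v,w\rangle^2\big)}=3\lim^{*}_{s,t\to0}\frac{|sv-tw|^2-d^2\big(\exp_z(sv),\exp_z(tw)\big)}{s^2t^2\big(|v|^2|w|^2-\langle v,w\rangle^2\big)}.$$
   Context: $\lim^{*}_{s,t\to0}F(s,t)=L$ means that $F(s_j,t_j)\to L$ for every sequence $(s_j,t_j)$ in $(0,\infty)^2$ with $s_j,t_j\to0$ and $\sup_j(s_j/t_j+t_j/s_j)<\infty$. Norms and inner products are those of $g_z$ on $T_zM$. *)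

(* Defs.v *)
From HB Require Import structures.
From mathcomp Require Import all_boot all_order all_algebra.
From mathcomp Require Import all_classical all_reals all_analysis.
Set Implicit Arguments.
Unset Strict Implicit.
Unset Printing Implicit Defensive.
Import Order.TTheory GRing.Theory Num.Theory.
Import numFieldNormedType.Exports.
Local Open Scope classical_set_scope.
Local Open Scope ring_scope.

Section SmoothMaps.
Context {R : realType} {n : nat}.

Definition basis_vec (a : 'I_n) : 'rV[R]_n := delta_mx 0 a.

Definition partial (a : 'I_n) (f : 'rV[R]_n -> R) : 'rV[R]_n -> R :=
  fun x => 'D_(basis_vec a) f x.

Definition iter_partial (s : seq 'I_n) (f : 'rV[R]_n -> R) : 'rV[R]_n -> R :=
  foldr partial f s.

(* C^oo on the open set U: all iterated partial derivatives exist and are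
   continuous on U. The values of f outside U are irrelevant. *)
Definition smooth_on (U : set 'rV[R]_n) (f : 'rV[R]_n -> R) : Prop :=
  forall (s : seq 'I_n) (x : 'rV[R]_n), U x ->
    {for x, continuous (iter_partial s f)} /\
    (forall a, derivable (iter_partial s f) x (basis_vec a)).

End SmoothMaps.

(* A smooth n-manifold without boundary, not assumed connected: a Hausdorff
   second countable space with a C^oo atlas. [chart i] is meaningful only on
   [chart_dom i], and [chart_inv i] only on the image of [chart_dom i]. *)
Record manifold (R : realType) (n : nat) := Manifold {
  carrier :> topologicalType;
  manifold_hausdorff : hausdorff_space carrier;
  manifold_second_countable : @second_countable carrier;
  chart_index : Type;
  chart_dom : chart_index -> set carrier;
  chart : chart_index -> carrier -> 'rV[R]_n;
  chart_inv : chart_index -> 'rV[R]_n -> carrier;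
  chart_dom_open : forall i, open (chart_dom i);
  chart_cover : forall p, exists i, chart_dom i p;
  chart_image_open : forall i, open (chart i @` chart_dom i);
  chart_continuous : forall i p, chart_dom i p ->
    {for p, continuous (chart i)};
  chart_inv_continuous : forall i p, chart_dom i p ->
    {for chart i p, continuous (chart_inv i)};
  chartK : forall i p, chart_dom i p -> chart_inv i (chart i p) = p;
  transition_smooth : forall i j (k : 'I_n),
    smooth_on (chart i @` (chart_dom i `&` chart_dom j))
      (fun x => chart j (chart_inv i x) 0 k) }.

Section Tangent.
Context {R : realType} {n : nat} (M : manifold R n).

(* A tangent vector at p is given by its components in all the charts around p,
   related by the differentials of the transition maps. Families are set to 0
   at the charts which are not around p, so that T_pM is a linear subspace of
   the space of all families of row vectors. *)
Definition tvec : Type := chart_index M -> 'rV[R]_n.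
HB.instance Definition _ := 
  GRing.Lmodule.copy tvec (chart_index M -> 'rV[R]_n).

Definition transition (i j : chart_index M) : 'rV[R]_n -> 'rV[R]_n :=
  fun x => chart j (chart_inv i x).

Definition tangent (p : M) : set tvec :=
  [set v | (forall i, ~ chart_dom i p -> v i = 0) /\
           (forall i j, chart_dom i p -> chart_dom j p ->
              v j = 'D_(v i) (transition i j) (chart i p))].

Definition lin_indep (v w : tvec) : Prop :=
  forall a b : R, a *: v + b *: w = 0 -> a = 0 /\ b = 0.

(* A tangent vector from components that are defined chart by chart. *)
Definition at_charts (p : M) (x : tvec) : tvec :=
  fun i => if `[< chart_dom i p >] then x i else 0.

(* The coordinate vector d/dx^a of the chart i at p. *)
Definition coord_vec (i : chart_index M) (a : 'I_n) (p : M) : tvec :=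
  at_charts p (fun j => 'D_(basis_vec a) (transition i j) (chart i p)).

(* The velocity of a curve differentiable at t. *)
Definition velocity (c : R -> M) (t : R) : tvec :=
  at_charts (c t) (fun i => derive1 (fun u => chart i (c u)) t).

End Tangent.

(* A C^oo field of inner products [metric p] on the tangent spaces;
   [metric p v w] is meaningful only for v and w tangent at p. *)
Record riemannian_metric (R : realType) (n : nat) (M : manifold R n) :=
  RiemannianMetric {
  metric :> M -> tvec M -> tvec M -> R;
  metric_linear : forall p u v w (a : R),
    tangent p u -> tangent p v -> tangent p w ->
    metric p (a *: u + v) w = a * metric p u w + metric p v w;
  metric_sym : forall p v w, tangent p v -> tangent p w ->
    metric p v w = metric p w v;
  metric_pos : forall p v, tangent p v -> v <> 0 -> 0 < metric p v v;
  metric_smooth : forall i (a b : 'I_n),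
    smooth_on (chart i @` chart_dom i)
      (fun x => metric (chart_inv i x) (coord_vec i a (chart_inv i x))
                                       (coord_vec i b (chart_inv i x))) }.

Section Riemannian.
Context {R : realType} {n : nat} {M : manifold R n}.
Variable g : riemannian_metric M.

Definition tnorm (p : M) (v : tvec M) : R := Num.sqrt (g p v v).

Definition C1_curve (a b : R) (c : R -> M) : Prop :=
  forall t, a < t < b ->
    {for t, continuous c} /\
    (forall i, chart_dom i (c t) ->
       derivable (fun u => chart i (c u)) t 1 /\
       {for t, continuous (derive1 (fun u => chart i (c u)))}).

Definition C1_segment (a b : R) (c : R -> M) : Prop :=
  exists (e : R) (c' : R -> M),
    [/\ 0 < e, C1_curve (a - e) (b + e) c' &
        forall t, a <= t <= b -> c t = c' t].

(* Piecewise C^1 curves [0, 1] -> M from p to q; the breakpoints are 0 :: s. *)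
Definition piecewise_C1 (p q : M) (c : R -> M) : Prop :=
  [/\ c 0 = p, c 1 = q &
      exists s : seq R, [/\ path <%R 0 s, last 0 s = 1 &
        forall k, (k < size s)%N ->
          C1_segment (nth 0 (0 :: s) k) (nth 0 s k) c]].

(* The velocity is irrelevant at the finitely many breakpoints. *)
Definition curve_length (c : R -> M) : \bar R :=
  (\int[lebesgue_measure]_(t in `[0%R, 1%R]) (tnorm (c t) (velocity c t))%:E)%E.

(* It is +oo exactly when p and q lie in different components of M. *)
Definition riemannian_dist (p q : M) : \bar R :=
  ereal_inf [set curve_length c | c in piecewise_C1 p q].

Definition gram (i : chart_index M) (x : 'rV[R]_n) : 'M[R]_n :=
  \matrix_(a, b) g (chart_inv i x) (coord_vec i a (chart_inv i x))
                                   (coord_vec i b (chart_inv i x)).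

(* [christoffel i k a b] is the Christoffel symbol Gamma^k_ab of the
   Levi-Civita connection in the chart i. *)
Definition christoffel (i : chart_index M) (k a b : 'I_n) (x : 'rV[R]_n) : R :=
  2^-1 * \sum_(l < n) invmx (gram i x) k l *
    (partial a (fun y => gram i y b l) x + partial b (fun y => gram i y a l) x
     - partial l (fun y => gram i y a b) x).

(* Twice differentiable curves on ]a, b[ with zero covariant acceleration. *)
Definition geodesic (a b : R) (c : R -> M) : Prop :=
  forall t, a < t < b ->
    {for t, continuous c} /\
    (forall i, chart_dom i (c t) ->
       let x := fun u => chart i (c u) in
       [/\ derivable x t 1, derivable (derive1 x) t 1 &
           forall k : 'I_n,
             derive1 (derive1 x) t 0 k +
             \sum_(l < n) \sum_(m < n) christoffel i k l m (x t) *
               derive1 x t 0 l * derive1 x t 0 m = 0]).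

(* exp_p v is c(1) for the geodesic c with initial velocity v, provided that it
   is defined on [0, 1]; M is not assumed complete, and the value is the junk
   value p when there is no such geodesic. *)
Definition exp_map (p : M) (v : tvec M) : M :=
  xget p [set q | exists (a b : R) (c : R -> M),
    [/\ a < 0, 1 < b, geodesic a b c, c 0 = p & velocity c 0 = v /\ c 1 = q]].

(* [riemann i d a b c] is the d-component of R(d/dx^a, d/dx^b) d/dx^c, where
   R(X, Y) Z = D_X D_Y Z - D_Y D_X Z - D_[X, Y] Z. *)
Definition riemann (i : chart_index M) (d a b c : 'I_n) (x : 'rV[R]_n) : R :=
  partial a (christoffel i d b c) x - partial b (christoffel i d a c) x +
  \sum_(m < n) (christoffel i m b c x * christoffel i d a m x
                - christoffel i m a c x * christoffel i d b m x).

Definition curvature (p : M) (u v w : tvec M) : tvec M :=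
  at_charts p (fun i => \row_(d < n) \sum_(a < n) \sum_(b < n) \sum_(c < n)
    riemann i d a b c (chart i p) * u i 0 a * v i 0 b * w i 0 c).

Definition sectional_curvature (p : M) (v w : tvec M) : R :=
  g p (curvature p v w w) v /
  (tnorm p v ^+ 2 * tnorm p w ^+ 2 - g p v w ^+ 2).

End Riemannian.

(* lim*_{s,t -> 0} F(s,t) = L *)
Definition lim_star {R : realType} (F : R -> R -> R) (L : R) : Prop :=
  forall s t : nat -> R,
    (forall j, 0 < s j) -> (forall j, 0 < t j) ->
    s j @[j --> \oo] --> (0 : R) -> t j @[j --> \oo] --> (0 : R) ->
    has_ubound (range (fun j => s j / t j + t j / s j)) ->
    F (s j) (t j) @[j --> \oo] --> L.

(* Main.v *)
(* Work in a chart around z with coordinates x0 at z. The geodesic equation gives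
   exp_z(v) the coordinates x0 + phi(v) + O(|v|^4), where phi is a cubic polynomial
   in the 1-jet of the Christoffel symbols. For |v|, |w| <= m the image under phi of
   the segment from v to w has squared speed |v - w|^2 - R(v,w,w,v)/3 + O(m^5), which
   bounds the distance from above. Conversely, let psi be the cubic expansion of
   normal coordinates and e the unit vector in the direction w - v. The function
   <e, psi(y)> - <e, y> R(y,e,e,y)/6 has a gradient of norm at most 1 + O(m^3), so that
   its increment bounds from below the length of every curve that stays at distance
   O(m) from z, and all the other curves are too long. Hence, uniformly,
     |v - w|^2 - d^2(exp_z v, exp_z w) = R(v,w,w,v)/3 + O(m^5),
   and both limits follow. Comparing this estimate in two charts also shows that
   R(v,w,w,v) does not depend on the chart, and by polarization that R(v,w)w is a
   tangent vector. *)
Require Import Defs.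
From HB Require Import structures.
From mathcomp Require Import all_boot all_order all_algebra.
From mathcomp Require Import all_classical all_reals all_analysis.
From mathcomp Require Import measurable_realfun ring lra.
Set Implicit Arguments.
Unset Strict Implicit.
Unset Printing Implicit Defensive.
Import Order.TTheory GRing.Theory Num.Theory.
Import numFieldNormedType.Exports.
Local Open Scope classical_set_scope.
Local Open Scope ring_scope.

(** * Calculus on row vectors *)

Section Calculus.
Context {R : realType}.

(** The orders are fixed by an error budget. Put a = |v - w|, which is O(m) and may be far smaller.
    An error O(m^5) in d^2 permits an error O(m^4) in the value of the calibration and O(m^3) in its
    gradient, as these enter the square as a m^4 and d^2 m^3. Since R(v,w,w,v) is O(m^2 a^2), the
    quotient R(v,w,w,v)/a^2 remains bounded when v and w come together. The cubic correction has
    this origin. In normal coordinates the metric is g_0 - R/3 to second order, so the covector of e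
    has squared norm 1 + R(y,e,e,y)/3. The function R(y,e,e,y) is constant along e, so <e,y>
    R(y,e,e,y)/6 has derivative R(y,e,e,y)/6 along e, and subtracting it removes the excess; its
    transverse derivatives are O(m^2) and change the squared norm by O(m^4) only. By the same
    constancy the corrected function grows by a - R(v,w,w,v)/(6a) + O(m^4) between the two
    endpoints, and the square of the main part is at least a^2 - R(v,w,w,v)/3. The map exp_z is
    known only through its defining property, so its expansion is proved for every geodesic with the
    given initial velocity. *)

Lemma rv_norm_le n (x : 'rV[R]_n) (C : R) : 0 <= C ->
  (forall a, `|x 0 a| <= C) -> `|x| <= C.
Proof.
move=> C0 xC; rewrite /Num.Def.normr/= mx_normrE.
by apply: bigmax_le => //= -[i a] _ /=; rewrite (ord1 i).
Qed.

Lemma rv_coord_le n (x : 'rV[R]_n) a : `|x 0 a| <= `|x|.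
Proof.
by rewrite [leRHS]/Num.Def.normr/= mx_normrE; exact: (le_bigmax _ _ (0, a)).
Qed.

Lemma norm_basis_vec n (a : 'I_n) : `|basis_vec a : 'rV[R]_n| <= 1.
Proof.
apply: rv_norm_le => // b; rewrite mxE /=.
by case: eqP => _ /=; rewrite ?normr1 ?normr0.
Qed.

Lemma row_sum_basis n (x : 'rV[R]_n) : x = \sum_a x 0 a *: basis_vec a.
Proof. exact: row_sum_delta. Qed.

Lemma is_derive_line (V W : normedModType R) (f : V -> W) x h t d :
  is_derive (x + t *: h) h f d -> is_derive t 1 (fun s : R => f (x + s *: h)) d.
Proof.
move=> [fd <-].
have E : (fun e : R => e^-1 *: (f (x + (e *: (1:R) + t) *: h) - f (x + t *: h))) =
         (fun e : R => e^-1 *: (f (e *: h + (x + t *: h)) - f (x + t *: h))).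
  by apply/funext => e; rewrite scalerDl /GRing.scale /= mulr1 addrCA.
by split; rewrite /derivable /derive /= E.
Qed.

Lemma is_derive_mulc (c t : R) : is_derive t 1 (fun s => s * c) c.
Proof.
rewrite (_ : (fun s => s * c) = c \*: (@id R)); last first.
  by apply/funext => s; rewrite mulrC.
by apply: is_derive_eq; rewrite /GRing.scale /= mulr1.
Qed.

Lemma mvt_bound (f df : R -> R) (a b C : R) : a <= b ->
  (forall t : R, a <= t <= b -> is_derive t 1 f (df t)) ->
  (forall t, a <= t <= b -> `|df t| <= C) -> `|f b - f a| <= C * (b - a).
Proof.
move=> ab fd dC.
have [||c cab ->] := @MVT_segment R f df a b ab.
- by move=> t; rewrite in_itv/= => /andP[? ?]; apply: fd; rewrite !ltW.
- apply: derivable_within_continuous => t; rewrite in_itv/= => tab.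
  by have [] := fd t tab.
rewrite normrM (ger0_norm (_ : 0 <= b - a)) ?subr_ge0//.
by rewrite ler_wpM2r ?subr_ge0// dC//; move: cab; rewrite in_itv.
Qed.

Lemma mvt0_bound (f df : R -> R) (h C : R) :
  (forall t : R, `|t| <= `|h| -> is_derive t 1 f (df t)) ->
  (forall t, `|t| <= `|h| -> `|df t| <= C) -> `|f h - f 0| <= C * `|h|.
Proof.
move=> fd dC; have [h0|h0] := leP 0 h.
  have : `|f h - f 0| <= C * (h - 0).
    apply: (@mvt_bound f df 0 h C) => // t /andP[t0 th].
      by apply: fd; rewrite !ger0_norm// (le_trans t0).
    by apply: dC; rewrite !ger0_norm// (le_trans t0).
  by rewrite subr0 (ger0_norm h0).
have : `|f 0 - f h| <= C * (0 - h).
  apply: (@mvt_bound f df h 0 C) => [|t /andP[th t0]|t /andP[th t0]].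
  - by rewrite ltW.
  - by apply: fd; rewrite !ler0_norm ?(ltW h0)// lerN2.
  - by apply: dC; rewrite !ler0_norm ?(ltW h0)// lerN2.
by rewrite distrC sub0r (ltr0_norm h0).
Qed.

Lemma is_diff_intro (V W : normedModType R) (f : V -> W) x (L : {linear V -> W}) :
  continuous L ->
  (forall e, 0 < e -> exists2 d, 0 < d &
     forall h, `|h| < d -> `|f (x + h) - f x - L h| <= e * `|h|) ->
  is_diff x f L.
Proof.
move=> cL H.
have E : f \o shift x = cst (f x) + L +o_ 0 id.
  apply/eqaddoP => _/posnumP[e]; have [d d0 Hd] := H _ (gt0 e).
  near=> h; rewrite [X in `|X| <= _](_ : _ = f (x + h) - f x - L h); last first.
    by rewrite !fctE /= [h + x]addrC opprD addrA.
  apply: Hd; near: h.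
  by apply/nbhs_normP; exists d => //= y /=; rewrite sub0r normrN.
have dE := diff_unique cL E.
by apply: DiffDef => //; apply/diff_locallyP; rewrite dE.
Unshelve. all: by end_near. Qed.

Section gradient.
Variables (n : nat) (d : 'I_n -> R).
Definition grad_map (h : 'rV[R]_n) : R := \sum_a h 0 a * d a.
Fact grad_map_linear : linear grad_map.
Proof.
move=> c u v; rewrite /grad_map /GRing.scale/= mulr_sumr -big_split/=.
by apply: eq_bigr => a _; rewrite !mxE mulrDl mulrA.
Qed.
HB.instance Definition _ := GRing.isLinear.Build R 'rV[R]_n R _ grad_map grad_map_linear.
End gradient.

Lemma for_continuous_sum (T : topologicalType) (W : normedModType R) (I : Type)
    (r : seq I) (P : pred I) (F : I -> T -> W) (x : T) :
  (forall i, {for x, continuous (F i)}) ->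
  {for x, continuous (fun y => \sum_(i <- r | P i) F i y)}.
Proof.
move=> FC; elim: r => [|i r IH].
  rewrite (_ : (fun y => _) = cst 0); last by apply/funext => y; rewrite big_nil.
  exact: cvg_cst.
rewrite (_ : (fun y => _) = (fun y => if P i then F i y + \sum_(j <- r | P j) F j y
   else \sum_(j <- r | P j) F j y)); last by apply/funext => y; rewrite big_cons.
by case: (P i) => //; apply: continuousD => //; exact: FC.
Qed.

Lemma is_derive_sumf (V W : normedModType R) (I : Type) (r : seq I) (P : pred I)
    (F : I -> V -> W) (dF : I -> W) (x v : V) :
  (forall i, is_derive x v (F i) (dF i)) ->
  is_derive x v (fun y => \sum_(i <- r | P i) F i y) (\sum_(i <- r | P i) dF i).
Proof.
move=> FD; elim: r => [|i r IH].
  by under eq_fun do rewrite big_nil; rewrite big_nil; exact: is_derive_cst.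
under eq_fun do rewrite big_cons; rewrite big_cons.
by case: (P i) => //; apply: is_deriveD.
Qed.

Lemma cvg_rv (T : Type) (F : set_system T) (FF : Filter F) n (f : T -> 'rV[R]_n)
    (l : 'rV[R]_n) :
  (forall a, f x 0 a @[x --> F] --> l 0 a) -> f x @[x --> F] --> l.
Proof.
move=> H; apply/cvgrPdist_le => /= e e0.
have : \forall x \near F, forall a, `|l 0 a - f x 0 a| <= e.
  by apply: filter_forall => a; move/cvgrPdist_le : (H a); apply.
apply: filterS => x Hx; apply: rv_norm_le (ltW e0) _ => a.
by rewrite !mxE; exact: Hx.
Qed.

Lemma continuous_rv (T : topologicalType) n (f : T -> 'rV[R]_n) x :
  (forall a, {for x, continuous (fun y => f y 0 a)}) -> {for x, continuous f}.
Proof. by move=> H; apply: cvg_rv. Qed.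

Lemma continuous_coord (T : topologicalType) n (f : T -> 'rV[R]_n) x a :
  {for x, continuous f} -> {for x, continuous (fun y => f y 0 a)}.
Proof.
move=> H; apply: (@continuous_comp _ _ _ f (fun M : 'rV[R]_n => M 0 a) x H).
exact: coord_continuous.
Qed.

Lemma is_derive_rv (V : normedModType R) n (f : V -> 'rV[R]_n) x v (df : 'rV[R]_n) :
  (forall a, is_derive x v (fun y => f y 0 a) (df 0 a)) <-> is_derive x v f df.
Proof.
split=> [H|H a].
  have fd : derivable f x v by apply/derivable_mxP => i a; rewrite (ord1 i); have [] := H a.
  split=> //; rewrite derive_mx//; apply/rowP => a; rewrite !mxE.
  by have [_ <-] := H a.
have [fd fE] := H; split; first by move/derivable_mxP : fd; apply.
by rewrite -fE derive_mx// mxE.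
Qed.

Lemma grad_map_continuous n (d : 'I_n -> R) : continuous (grad_map d).
Proof.
move=> x; apply: for_continuous_sum => a.
apply: (@continuousM _ _ (fun y : 'rV[R]_n => y 0 a) (fun=> d a)).
  exact: coord_continuous.
exact: cst_continuous.
Qed.

Lemma C1_is_diff n (U : set 'rV[R]_n) (f : 'rV[R]_n -> R) x : open U -> U x ->
  (forall y, U y -> forall a, derivable f y (basis_vec a)) ->
  (forall a, {for x, continuous (partial a f)}) ->
  is_diff x f (grad_map (fun a => partial a f x)).
Proof.
move=> Uo Ux fd fc; apply: is_diff_intro; first exact: grad_map_continuous.
(* Each of the n coordinate steps may use a share e / (n + 1) of the error; the successor keeps the
   quotient positive for n = 0. *)
move=> e e0; pose e' := e / n.+1%:R.
have e'0 : 0 < e' by rewrite divr_gt0.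
have nF : \forall y \near x, forall a, `|partial a f x - partial a f y| <= e'.
  have FF : Filter (nbhs x) := nbhs_filter x.
  apply: (@filter_forall _ _ (fun a y => `|partial a f x - partial a f y| <= e') (nbhs x) FF) => a; have /cvgrPdist_le := fc a; apply=> //.
have : \forall y \near x, U y /\ forall a, `|partial a f x - partial a f y| <= e'.
  by apply: filterI => //; apply: open_nbhs_nbhs.
move=> /nbhs_normP[d /= d0 Hd]; exists d => // h hd.
(* The broken line from x to x + h that changes one coordinate at a time: the increment of f
   telescopes along it, and the mean value theorem applies to each edge. *)
pose tr k : 'rV[R]_n := \row_a (if (a < k)%N then h 0 a else 0).
have tr0 : tr 0%N = 0 by apply/rowP => a; rewrite !mxE.
have trn : tr n = h by apply/rowP => a; rewrite !mxE ltn_ord.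
have trS (k : 'I_n) : tr k.+1 = tr k + h 0 k *: basis_vec k.
  apply/rowP => a; rewrite !mxE /= ltnS leq_eqVlt.
  have [->|ak] := eqVneq a k; first by rewrite eqxx ltnn /= mulr1 add0r.
  by rewrite (negbTE (_ : (a != k :> nat))) //= mulr0 addr0.
have -> : f (x + h) - f x - grad_map (fun a => partial a f x) h =
    \sum_(k < n) (f (x + tr k.+1) - f (x + tr k) - h 0 k * partial k f x).
  rewrite sumrB; congr (_ - _).
  by rewrite -(big_mkord xpredT (fun k => f (x + tr k.+1) - f (x + tr k)))
    telescope_sumr// trn tr0 addr0.
apply: (@le_trans _ _ (\sum_(k < n) e' * `|h|)); last first.
  rewrite sumr_const card_ord -mulr_natr mulrAC ler_wpM2r// -mulrA.
  by rewrite ger_pMr// mulrC ler_pdivrMr// mul1r ler_nat.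
apply: le_trans (ler_norm_sum _ _ _) _; apply: ler_sum => k _.
pose phi t := f (x + tr k + t *: basis_vec k) - t * partial k f x.
have -> : f (x + tr k.+1) - f (x + tr k) - h 0 k * partial k f x = phi (h 0 k) - phi 0.
  by rewrite /phi trS addrA scale0r addr0 mul0r subr0 [LHS]addrAC.
have inb t : `|t| <= `|h 0 k| -> `|tr k + t *: basis_vec k| <= `|h|.
  move=> th; apply: rv_norm_le => // a; rewrite !mxE /=.
  have [->|ak] := eqVneq a k.
    by rewrite ltnn /= mulr1 add0r (le_trans th)// rv_coord_le.
  by rewrite mulr0 addr0; case: ifP => _; rewrite ?normr0// rv_coord_le.
have inU t : `|t| <= `|h 0 k| -> `|x - (x + tr k + t *: basis_vec k)| < d.
  by move=> th; rewrite -addrA opprD addrA subrr sub0r normrN (le_lt_trans (inb _ th)).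
have : `|phi (h 0 k) - phi 0| <= e' * `|h 0 k|.
  apply: (@mvt0_bound _ (fun t => partial k f (x + tr k + t *: basis_vec k) - partial k f x)).
    move=> t th; apply: is_deriveB; last first.
      exact: is_derive_mulc.
    apply: is_derive_line; apply: DeriveDef => //.
    by apply: fd; exact: (Hd _ (inU _ th)).1.
  by move=> t th; rewrite distrC; apply: (Hd _ (inU _ th)).2.
by move/le_trans; apply; rewrite ler_wpM2l ?(ltW e'0)// rv_coord_le.
Qed.

(** Finite orders, because closure under products, quotients and determinants goes by induction on
    k: the partial derivatives of a function of class k + 1 are of class k. *)
Fixpoint Ck n (k : nat) (U : set 'rV[R]_n) (f : 'rV[R]_n -> R) : Prop :=
  (forall x, U x -> {for x, continuous f}) /\
  if k is k'.+1 then
    (forall x a, U x -> derivable f x (basis_vec a)) /\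
    (forall a, Ck k' U (partial a f))
  else True.

Lemma smooth_onW n (U : set 'rV[R]_n) f a : smooth_on U f -> smooth_on U (partial a f).
Proof.
move=> fs s x Ux; have := fs (rcons s a) x Ux.
by rewrite /iter_partial foldr_rcons.
Qed.

Lemma smooth_on_Ck n (U : set 'rV[R]_n) f k : smooth_on U f -> Ck k U f.
Proof.
elim: k f => [|k IH] f fs /=; (split; first by move=> x Ux; have [] := fs [::] x Ux) => //.
split; first by move=> x a Ux; have [_] := fs [::] x Ux; apply.
by move=> a; apply: IH; exact: smooth_onW.
Qed.

Lemma Ck_continuous n (U : set 'rV[R]_n) f k x : Ck k U f -> U x -> {for x, continuous f}.
Proof. by case: k => [|k] [fc _]; exact: fc. Qed.

Lemma Ck_partial n (U : set 'rV[R]_n) f k a : Ck k.+1 U f -> Ck k U (partial a f).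
Proof. by move=> [_ [_ fp]]; exact: fp. Qed.

Lemma CkW n (U : set 'rV[R]_n) f k : Ck k.+1 U f -> Ck k U f.
Proof.
elim: k f => [|k IH] f; first by move=> [fc _]; split.
move=> [fc [fd fp]]; split => //; split => // a; exact: IH (fp a).
Qed.

Lemma Ck_is_diff n (U : set 'rV[R]_n) f k x : open U -> Ck k.+1 U f -> U x ->
  is_diff x f (grad_map (fun a => partial a f x)).
Proof.
move=> Uo [fc [fd fp]] Ux; apply: (@C1_is_diff _ U) => //.
  by move=> y Uy a; exact: fd.
by move=> a; exact: Ck_continuous (fp a) Ux.
Qed.

Lemma eq_partial n (U : set 'rV[R]_n) f g x a : open U -> (forall y, U y -> f y = g y) ->
  U x -> partial a f x = partial a g x.
Proof.
move=> Uo fg Ux; apply: near_eq_derive.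
by apply: filterS (open_nbhs_nbhs (conj Uo Ux)).
Qed.

Lemma near_eq_continuous (T S : topologicalType) (f g : T -> S) x :
  {near x, f =1 g} -> {for x, continuous f} -> {for x, continuous g}.
Proof.
move=> fg fc; rewrite /prop_for /continuous_at -(nbhs_singleton fg).
exact: cvg_trans (near_eq_cvg fg) fc.
Qed.

Lemma eq_Ck n (U : set 'rV[R]_n) f g k : open U -> (forall y, U y -> f y = g y) ->
  Ck k U f -> Ck k U g.
Proof.
move=> Uo; elim: k f g => [|k IH] f g fg.
  move=> [fc _]; split => // x Ux; have nfg : {near x, f =1 g}.
    by apply: filterS (open_nbhs_nbhs (conj Uo Ux)).
  exact: near_eq_continuous (fc _ Ux).
move=> [fc [fd fp]]; split; last split.
- move=> x Ux; have nfg : {near x, f =1 g}.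
    by apply: filterS (open_nbhs_nbhs (conj Uo Ux)).
  exact: near_eq_continuous (fc _ Ux).
- move=> x a Ux; apply: near_eq_derivable (fd _ a Ux).
  by apply: filterS (open_nbhs_nbhs (conj Uo Ux)).
- move=> a; apply: IH (fp a) => x Ux; exact: eq_partial Ux.
Qed.
End Calculus.

(** * Functions of class C^k *)

Section CkTheory.
Context {R : realType} {n : nat}.
Implicit Types (U : set 'rV[R]_n) (f g : 'rV[R]_n -> R).

Lemma Ck_cst U k (c : R) : open U -> Ck k U (fun=> c).
Proof.
move=> Uo; elim: k c => [|k IH] c; first by split => // x _; exact: cst_continuous.
split; first by move=> x _; exact: cst_continuous.
split; first by move=> x a _; exact: derivable_cst.
move=> a; apply: eq_Ck (IH 0) => // x _.
by rewrite /partial (derive_cst c).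
Qed.

Lemma CkD U k f g : open U -> Ck k U f -> Ck k U g -> Ck k U (fun x => f x + g x).
Proof.
move=> Uo; elim: k f g => [|k IH] f g fk gk.
  by split=> // x Ux; apply: continuousD; [case: fk => + _|case: gk => + _]; apply.
have [fc [fd fp]] := fk; have [gc [gd gp]] := gk; split; last split.
- by move=> x Ux; apply: continuousD; [exact: fc|exact: gc].
- by move=> x a Ux; apply: derivableD; [exact: fd|exact: gd].
- move=> a; apply: eq_Ck (IH _ _ (fp a) (gp a)) => // x Ux.
  by rewrite /partial -deriveD//; [exact: fd|exact: gd].
Qed.

Lemma CkM U k f g : open U -> Ck k U f -> Ck k U g -> Ck k U (fun x => f x * g x).
Proof.
move=> Uo; elim: k f g => [|k IH] f g fk gk.
  by split=> // x Ux; apply: continuousM; [case: fk => + _|case: gk => + _]; apply.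
have [fc [fd fp]] := fk; have [gc [gd gp]] := gk; split; last split.
- by move=> x Ux; apply: continuousM; [exact: fc|exact: gc].
- by move=> x a Ux; apply: derivableM; [exact: fd|exact: gd].
- move=> a.
  apply: eq_Ck (CkD Uo (IH _ _ (CkW fk) (gp a)) (IH _ _ (CkW gk) (fp a))) => // x Ux.
  by rewrite /partial [RHS]deriveM//; [exact: fd|exact: gd].
Qed.

Lemma CkZ U k c f : open U -> Ck k U f -> Ck k U (fun x => c * f x).
Proof. by move=> Uo fk; apply: CkM => //; exact: Ck_cst. Qed.

Lemma CkB U k f g : open U -> Ck k U f -> Ck k U g -> Ck k U (fun x => f x - g x).
Proof.
move=> Uo fk gk; apply: eq_Ck (CkD Uo fk (CkZ (-1) Uo gk)) => // x _.
by rewrite mulN1r.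
Qed.

Lemma Ck_inv U k f : open U -> (forall x, U x -> f x != 0) -> Ck k U f ->
  Ck k U (fun x => (f x)^-1).
Proof.
move=> Uo f0; elim: k => [|k IH] fk.
  by split=> // x Ux; apply: continuousV; [exact: f0|case: fk => + _; apply].
have [fc [fd fp]] := fk; split; last split.
- by move=> x Ux; apply: continuousV; [exact: f0|exact: fc].
- by move=> x a Ux; apply: derivableV; [exact: f0|exact: fd].
- move=> a; have IH' := IH (CkW fk).
  apply: eq_Ck (CkZ (-1) Uo (CkM Uo (CkM Uo IH' IH') (fp a))) => // x Ux.
  rewrite /partial [RHS]deriveV; [|exact: f0|exact: fd].
  by rewrite /GRing.scale /= mulN1r mulNr -exprVn expr2.
Qed.

Lemma Ck_sum (I : Type) (r : seq I) (P : pred I) (F : I -> 'rV[R]_n -> R) U k :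
  open U -> (forall i, Ck k U (F i)) -> Ck k U (fun x => \sum_(i <- r | P i) F i x).
Proof.
move=> Uo Fk; elim: r => [|i r IH].
  by apply: eq_Ck (Ck_cst k 0 Uo) => // x _; rewrite big_nil.
case Pi: (P i); last by apply: eq_Ck IH => // x _; rewrite big_cons Pi.
by apply: eq_Ck (CkD Uo (Fk i) IH) => // x _; rewrite big_cons Pi.
Qed.

Lemma Ck_prod (I : Type) (r : seq I) (P : pred I) (F : I -> 'rV[R]_n -> R) U k :
  open U -> (forall i, Ck k U (F i)) -> Ck k U (fun x => \prod_(i <- r | P i) F i x).
Proof.
move=> Uo Fk; elim: r => [|i r IH].
  by apply: eq_Ck (Ck_cst k 1 Uo) => // x _; rewrite big_nil.
case Pi: (P i); last by apply: eq_Ck IH => // x _; rewrite big_cons Pi.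
by apply: eq_Ck (CkM Uo (Fk i) IH) => // x _; rewrite big_cons Pi.
Qed.

Lemma Ck_det p (A : 'rV[R]_n -> 'M[R]_p) U k : open U ->
  (forall i j, Ck k U (fun x => A x i j)) -> Ck k U (fun x => \det (A x)).
Proof.
move=> Uo Ak; apply: Ck_sum => // s; apply: CkZ => //.
by apply: Ck_prod => // i; exact: Ak.
Qed.

(** Cramer's rule: each entry is a cofactor, a polynomial in the entries of A, divided by the
    determinant. *)
Lemma Ck_invmx p (A : 'rV[R]_n -> 'M[R]_p) U k : open U ->
  (forall x, U x -> A x \in unitmx) ->
  (forall i j, Ck k U (fun x => A x i j)) ->
  forall i j, Ck k U (fun x => invmx (A x) i j).
Proof.
move=> Uo Au Ak i j.
have dk : Ck k U (fun x => (\det (A x))^-1).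
  apply: Ck_inv => //; last exact: Ck_det.
  by move=> x /Au; rewrite unitmxE unitfE.
have ck : Ck k U (fun x => cofactor (A x) j i).
  rewrite /cofactor; apply: CkZ => //; apply: Ck_det => // a b.
  by apply: eq_Ck (Ak (lift j a) (lift i b)) => // x _; rewrite !mxE.
apply: eq_Ck (CkM Uo dk ck) => // x Ux.
by rewrite /invmx Au// !mxE.
Qed.

Lemma is_derive_lineP (V W : normedModType R) (f : V -> W) x v d :
  is_derive (0 : R) 1 (fun s : R => f (x + s *: v)) d -> is_derive x v f d.
Proof.
have E : (fun e : R => e^-1 *: (f (x + (e *: (1:R) + 0) *: v) - f (x + (0 : R) *: v))) =
         (fun e : R => e^-1 *: (f (e *: v + x) - f x)).
  apply/funext => e; rewrite scale0r !addr0.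
  have -> : e *: (1 : R) = e by rewrite /GRing.scale /= mulr1.
  by rewrite [x + _]addrC.
by move=> [fd <-]; split; move: fd; rewrite /derivable /derive /= E.
Qed.

Lemma is_derive_lineP0 (V W : normedModType R) (f : V -> W) x v d :
  is_derive x v f d -> is_derive (0 : R) 1 (fun s : R => f (x + s *: v)) d.
Proof. by move=> fd; apply: is_derive_line; rewrite scale0r addr0. Qed.

Lemma is_derive_comp (V V' W : normedModType R) (c : V -> V') (f : V' -> W) x v dc
    (L : V' -> W) :
  is_derive x v c dc -> is_diff (c x) f L -> is_derive x v (fun y => f (c y)) (L dc).
Proof.
move=> /is_derive_lineP0 cd fd; apply: is_derive_lineP.
set g := fun s : R => c (x + s *: v).
have g0 : g 0 = c x by rewrite /g scale0r addr0.
have gdiff : differentiable g (0 : R) by apply/derivable1_diffP; case: cd.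
have [fdiff fE] := fd.
have fgd : differentiable (f \o g) (0 : R).
  by apply: differentiable_comp => //; rewrite g0.
have fg0 : differentiable f (g 0) by rewrite g0.
split; first exact/derivable1_diffP.
rewrite -[LHS]/('D_1 (f \o g) 0) (deriveE _ fgd) (diff_comp gdiff fg0) /= g0 -fE.
by rewrite -(deriveE _ gdiff); case: cd => _ <-.
Qed.

Lemma is_diff_derive (V W : normedModType R) (f : V -> W) x v (L : V -> W) :
  is_diff x f L -> is_derive x v f (L v).
Proof.
move=> [fd <-]; split; first exact: diff_derivable.
by rewrite deriveE.
Qed.

(** The differential as an explicit sum over the partial derivatives, linear in y by its form;
    [Ck_derive] identifies it with the directional derivative on functions of class C^1. *)
Definition dir f (x y : 'rV[R]_n) : R := \sum_a y 0 a * partial a f x.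

Lemma dirD f x : {morph dir f x : y z / y + z}.
Proof.
by move=> y z; rewrite /dir -big_split; apply: eq_bigr => a _; rewrite !mxE mulrDl.
Qed.

Lemma dirZ f x c y : dir f x (c *: y) = c * dir f x y.
Proof.
by rewrite /dir mulr_sumr; apply: eq_bigr => a _; rewrite !mxE mulrA.
Qed.

Lemma dir_basis f x a : dir f x (basis_vec a) = partial a f x.
Proof.
rewrite /dir (bigD1 a)//= big1 ?addr0; first by rewrite mxE !eqxx mul1r.
by move=> b /negbTE ba; rewrite mxE ba andbF mul0r.
Qed.

Lemma dir_le f x y C : (forall a, `|partial a f x| <= C) -> `|dir f x y| <= n%:R * C * `|y|.
Proof.
move=> fC; apply: le_trans (ler_norm_sum _ _ _) _.
apply: (@le_trans _ _ (\sum_(a < n) C * `|y|)).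
  apply: ler_sum => a _; rewrite normrM mulrC.
  by apply: ler_pM => //; exact: rv_coord_le.
by rewrite sumr_const card_ord -[leLHS]mulr_natl mulrA.
Qed.

Lemma Ck_derive U f k x v : open U -> Ck k.+1 U f -> U x -> is_derive x v f (dir f x v).
Proof. by move=> Uo fk Ux; apply: is_diff_derive; exact: Ck_is_diff Uo fk Ux. Qed.

Lemma Ck_derive_line U f k x v t : open U -> Ck k.+1 U f -> U (x + t *: v) ->
  is_derive t 1 (fun s : R => f (x + s *: v)) (dir f (x + t *: v) v).
Proof. by move=> Uo fk Ux; apply: is_derive_line; exact: (Ck_derive _ Uo fk Ux). Qed.

Lemma fin_unif (T : Type) (F : set_system T) (FF : Filter F) (I : finType)
    (h : I -> T -> R) (G : T -> R) : (forall y, 0 <= G y) ->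
  (forall i, exists2 C, 0 <= C & \forall y \near F, h i y <= C * G y) ->
  exists2 C, 0 <= C & \forall y \near F, forall i, h i y <= C * G y.
Proof.
move=> G0 H; pose c i := sval (cid2 (H i)).
have c0 i : 0 <= c i by rewrite /c; case: cid2.
have cP i : \forall y \near F, h i y <= c i * G y by rewrite /c; case: cid2.
exists (\sum_i c i); first exact: sumr_ge0.
apply: filterS (filter_forall FF cP) => y Hy i; apply: le_trans (Hy i) _.
rewrite ler_wpM2r// (bigD1 i)//= lerDl; exact: sumr_ge0.
Qed.

Lemma fin_unif0 (I : finType) (h : I -> 'rV[R]_n -> R) (G : 'rV[R]_n -> R) :
  (forall y, 0 <= G y) ->
  (forall i, exists2 C, 0 <= C & \forall y \near (0 : 'rV[R]_n), h i y <= C * G y) ->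
  exists2 C, 0 <= C & \forall y \near (0 : 'rV[R]_n), forall i, h i y <= C * G y.
Proof.
have FF : Filter (nbhs (0 : 'rV[R]_n)) := nbhs_filter _.
exact: (@fin_unif _ (nbhs (0 : 'rV[R]_n)) FF I h G).
Qed.

Lemma near0_ball (P : set 'rV[R]_n) : (\forall y \near (0 : 'rV[R]_n), P y) ->
  exists2 r, 0 < r & forall y, `|y| < r -> P y.
Proof.
move=> /nbhs_normP[r /= r0 H]; exists r => // y yr; apply: H => /=.
by rewrite sub0r normrN.
Qed.

Lemma ball_near0 (r : R) (P : set 'rV[R]_n) : 0 < r -> (forall y, `|y| < r -> P y) ->
  \forall y \near (0 : 'rV[R]_n), P y.
Proof.
move=> r0 H; apply/nbhs_normP; exists r => // y /=.
by rewrite sub0r normrN; exact: H.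
Qed.

Lemma open_near0 U x0 : open U -> U x0 -> \forall y \near (0 : 'rV[R]_n), U (x0 + y).
Proof.
move=> Uo Ux; have : nbhs x0 U by exact: open_nbhs_nbhs.
move=> /nbhs_normP[r /= r0 H]; apply: (ball_near0 r0) => y yr; apply: H => /=.
by rewrite opprD addrA subrr sub0r normrN.
Qed.

Lemma Ck0_bounded U x0 f : open U -> U x0 -> Ck 0 U f ->
  exists2 C, 0 <= C & \forall y \near (0 : 'rV[R]_n), `|f (x0 + y)| <= C.
Proof.
move=> Uo Ux [fc _]; exists (`|f x0| + 1) => //.
have /cvgrPdist_le /(_ 1 ltr01) /nbhs_normP[r /= r0 H] := fc _ Ux.
apply: (ball_near0 r0) => y yr; have := H (x0 + y).
rewrite /= opprD addrA subrr sub0r normrN => /(_ yr); rewrite distrC => fb.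
by rewrite -[f (x0 + y)](subrK (f x0)) addrC (le_trans (ler_normD _ _))// lerD2l.
Qed.

Lemma Ck1_lip U x0 f : open U -> U x0 -> Ck 1 U f ->
  exists r C, [/\ 0 < r, 0 <= C & forall y y', `|y| < r -> `|y'| < r ->
     `|f (x0 + y) - f (x0 + y')| <= C * `|y - y'|].
Proof.
move=> Uo Ux fk.
have [C C0 HC] : exists2 C, 0 <= C & \forall y \near (0 : 'rV[R]_n),
    forall a, `|partial a f (x0 + y)| <= C * 1.
  apply: (@fin_unif0 _ (fun a y => `|partial a f (x0 + y)|) (fun=> 1)) => // a.
  have [C C0 HC] := Ck0_bounded Uo Ux (Ck_partial a fk).
  by exists C => //; rewrite mulr1.
have [r r0 Hr] := near0_ball (filterI (open_near0 Uo Ux) HC).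
exists r, (n%:R * C); split => //; first by rewrite mulr_ge0.
move=> y y' yr yr'; set h := y - y'.
have seg (s : R) : 0 <= s <= 1 -> `|y' + s *: h| < r.
  move=> /andP[s0 s1]; rewrite /h scalerBr addrCA -{1}[y']scale1r -scalerBl.
  apply: le_lt_trans (ler_normD _ _) _; rewrite !normrZ (ger0_norm s0).
  rewrite ger0_norm ?subr_ge0//.
  have [->|sn0] := eqVneq s 0; first by rewrite mul0r add0r subr0 mul1r.
  rewrite [ltRHS](_ : r = s * r + (1 - s) * r); last by rewrite -mulrDl addrC subrK mul1r.
  apply: ltr_leD; first by rewrite ltr_pM2l// lt0r sn0.
  by rewrite ler_wpM2l ?subr_ge0// ltW.
have := @mvt_bound R (fun s => f (x0 + y' + s *: h))
  (fun s => dir f (x0 + y' + s *: h) h) 0 1 (n%:R * C * `|h|) ler01.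
rewrite scale1r scale0r addr0 subr0 mulr1 /h -(addrA x0 y' (y - y')) (addrCA y' y) subrr addr0.
apply=> [t t01|t t01].
  apply: Ck_derive_line Uo fk _; rewrite -addrA; exact: (Hr _ (seg _ t01)).1.
by apply: dir_le => a; rewrite -addrA -[C]mulr1; exact: (Hr _ (seg _ t01)).2.
Qed.

Lemma Ck2_taylor U x0 f : open U -> U x0 -> Ck 2 U f ->
  exists2 C, 0 <= C & \forall y \near (0 : 'rV[R]_n),
    `|f (x0 + y) - f x0 - dir f x0 y| <= C * `|y| ^+ 2.
Proof.
move=> Uo Ux fk.
have [C C0 HC] : exists2 C, 0 <= C & \forall y \near (0 : 'rV[R]_n),
    forall a, `|partial a f (x0 + y) - partial a f x0| <= C * `|y|.
  apply: (@fin_unif0 _ (fun a y => `|partial a f (x0 + y) - partial a f x0|)) => // a.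
  have [r [C [r0 C0 HC]]] := Ck1_lip Uo Ux (Ck_partial a fk).
  exists C => //; apply: (ball_near0 r0) => y yr.
  by have := HC y 0 yr; rewrite normr0 addr0 subr0; apply.
have [r r0 Hr] := near0_ball (filterI (open_near0 Uo Ux) HC).
exists (n%:R * C); first by rewrite mulr_ge0.
apply: (ball_near0 r0) => y yr.
have seg (s : R) : 0 <= s <= 1 -> `|s *: y| <= `|y|.
  by move=> /andP[s0 s1]; rewrite normrZ ger0_norm// ler_piMl.
have := @mvt_bound R (fun s => f (x0 + s *: y) - s * dir f x0 y)
  (fun s => dir f (x0 + s *: y) y - dir f x0 y) 0 1 (n%:R * C * `|y| ^+ 2) ler01.
rewrite scale1r scale0r addr0 mul0r mul1r !subr0 mulr1 addrAC; apply=> [t t01|t t01].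
  apply: is_deriveB; last exact: is_derive_mulc.
  apply: Ck_derive_line Uo fk _; exact: (Hr _ (le_lt_trans (seg _ t01) yr)).1.
rewrite /dir -sumrB; apply: le_trans (ler_norm_sum _ _ _) _.
apply: (@le_trans _ _ (\sum_(a < n) C * `|y| ^+ 2)); last first.
  by rewrite sumr_const card_ord -[leLHS]mulr_natl mulrA.
apply: ler_sum => a _; rewrite -mulrBr normrM mulrC expr2 mulrA.
apply: ler_pM => //; last exact: rv_coord_le.
apply: le_trans ((Hr _ (le_lt_trans (seg _ t01) yr)).2 a) _.
by rewrite ler_wpM2l// seg.
Qed.

Definition dir2 f (x y z : 'rV[R]_n) : R := \sum_a y 0 a * dir (partial a f) x z.

Lemma Ck3_taylor U x0 f : open U -> U x0 -> Ck 3 U f ->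
  exists2 C, 0 <= C & \forall y \near (0 : 'rV[R]_n),
    `|f (x0 + y) - f x0 - dir f x0 y - 2^-1 * dir2 f x0 y y| <= C * `|y| ^+ 3.
Proof.
move=> Uo Ux fk.
have [C C0 HC] : exists2 C, 0 <= C & \forall y \near (0 : 'rV[R]_n),
    forall a, `|partial a f (x0 + y) - partial a f x0 - dir (partial a f) x0 y| <= C * `|y| ^+ 2.
  apply: (@fin_unif0 _ (fun a y => `|partial a f (x0 + y) - partial a f x0 - dir (partial a f) x0 y|)
    (fun y => `|y| ^+ 2)) => [y|a]; first by rewrite exprn_ge0.
  exact: (Ck2_taylor Uo Ux (Ck_partial a fk)).
have [r r0 Hr] := near0_ball (filterI (open_near0 Uo Ux) HC).
exists (n%:R * C); first by rewrite mulr_ge0.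
apply: (ball_near0 r0) => y yr.
have seg (s : R) : 0 <= s <= 1 -> `|s *: y| <= `|y|.
  by move=> /andP[s0 s1]; rewrite normrZ ger0_norm// ler_piMl.
have := @mvt_bound R (fun s => f (x0 + s *: y) - s * dir f x0 y - s ^+ 2 * (2^-1 * dir2 f x0 y y))
  (fun s => dir f (x0 + s *: y) y - dir f x0 y - s * dir2 f x0 y y) 0 1 (n%:R * C * `|y| ^+ 3) ler01.
rewrite scale1r scale0r addr0 mul0r expr0n /= expr1n !mul0r !mul1r !subr0 mulr1.
rewrite (_ : f (x0 + y) - dir f x0 y - 2^-1 * dir2 f x0 y y - f x0 =
  f (x0 + y) - f x0 - dir f x0 y - 2^-1 * dir2 f x0 y y); last by ring.
apply=> [t t01|t t01].
  apply: is_deriveB; last first.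
    rewrite (_ : (fun s => _) = (2^-1 * dir2 f x0 y y) \*: (@GRing.exp R ^~ 2%N)); last first.
      by apply/funext => s; rewrite mulrC.
    by apply: is_derive_eq; rewrite /GRing.scale /= mulr1; field.
  apply: is_deriveB; last exact: is_derive_mulc.
  apply: Ck_derive_line Uo fk _; exact: (Hr _ (le_lt_trans (seg _ t01) yr)).1.
rewrite {1 2}/dir /dir2 mulr_sumr -!sumrB; apply: le_trans (ler_norm_sum _ _ _) _.
apply: (@le_trans _ _ (\sum_(a < n) C * `|y| ^+ 3)); last first.
  by rewrite sumr_const card_ord -[leLHS]mulr_natl mulrA.
apply: ler_sum => a _; rewrite mulrCA -!mulrBr -dirZ normrM mulrC exprSr mulrA.
apply: ler_pM => //; last exact: rv_coord_le.
apply: le_trans ((Hr _ (le_lt_trans (seg _ t01) yr)).2 a) _.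
by rewrite ler_wpM2l// lerXn2r ?nnegrE// seg.
Qed.

(** The second difference over a square of side t is the increment in direction a of the increment
    in direction b. Its derivative in direction a is a difference of two values of [partial a f],
    expanded at points within 2t and t of x; hence the constant 5 = 2^2 + 1. *)
Lemma mixed_difference U x f (a b : 'I_n) : open U -> U x -> Ck 3 U f ->
  exists r C, [/\ 0 < r, 0 <= C & forall t, 0 < t < r ->
    `|f (x + t *: basis_vec a + t *: basis_vec b) - f (x + t *: basis_vec a)
      - f (x + t *: basis_vec b) + f x - t ^+ 2 * partial b (partial a f) x| <= C * t ^+ 3].
Proof.
move=> Uo Ux fk.
have [C C0 HC] := Ck2_taylor Uo Ux (Ck_partial a fk).
have [r r0 Hr] := near0_ball (filterI (open_near0 Uo Ux) HC).
exists (r / 2), (5%:R * C); split; rewrite ?divr_gt0// ?mulr_ge0// => t /andP[t0 tr].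
set A := basis_vec a; set B := basis_vec b; set g := partial a f.
have A1 : `|A| <= 1 by exact: norm_basis_vec.
have B1 : `|B| <= 1 by exact: norm_basis_vec.
have Bs s : 0 <= s <= t -> `|s *: A| <= t.
  by move=> /andP[s0 st]; rewrite normrZ ger0_norm// (le_trans _ st)// ler_piMr.
have tB : `|t *: B| <= t by rewrite normrZ ger0_norm ?ler_piMr// ltW.
have Cs s : 0 <= s <= t -> `|t *: B + s *: A| <= 2 * t.
  move=> st; apply: le_trans (ler_normD _ _) _.
  by rewrite mulrDl mul1r lerD// Bs.
have t2 : 2 * t < r by rewrite mulrC -ltr_pdivlMr.
have t1 : t < r by rewrite (lt_trans tr)// ltr_pdivrMr// mulrDr mulr1 ltrDl.
have := @mvt_bound R (fun s => f (x + t *: B + s *: A) - f (x + s *: A) - s * (t * partial b g x))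
  (fun s => dir f (x + t *: B + s *: A) A - dir f (x + s *: A) A - t * partial b g x)
  0 t (5%:R * C * t ^+ 2) (ltW t0).
rewrite scale0r !addr0 mul0r !subr0 => H.
rewrite [X in `|X| <= _](_ : _ = f (x + t *: B + t *: A) - f (x + t *: A) -
   t * (t * partial b g x) - (f (x + t *: B) - f x)); last first.
  by rewrite (addrAC x) expr2; ring.
rewrite exprSr [leRHS]mulrA; apply: H => [s st|s st].
  apply: is_deriveB; last exact: is_derive_mulc.
  apply: is_deriveB; apply: Ck_derive_line Uo fk _.
    by rewrite -addrA; exact: (Hr _ (le_lt_trans (Cs _ st) t2)).1.
  exact: (Hr _ (le_lt_trans (Bs _ st) t1)).1.
rewrite !dir_basis -/g -(addrA x).
have H1 := (Hr _ (le_lt_trans (Cs _ st) t2)).2.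
have H2 := (Hr _ (le_lt_trans (Bs _ st) t1)).2.
rewrite [X in `|X| <= _](_ : _ = (g (x + (t *: B + s *: A)) - g x - dir g x (t *: B + s *: A))
  - (g (x + s *: A) - g x - dir g x (s *: A))); last first.
  have E (p q k u w : R) : p - q - t * w = p - k - (t * w + s * u) - (q - k - s * u) by ring.
  by rewrite dirD !dirZ -(dir_basis g x b); exact: E.
apply: le_trans (ler_normB _ _) _.
rewrite (_ : 5%:R * C * t ^+ 2 = C * (2 * t) ^+ 2 + C * t ^+ 2); last by ring.
apply: lerD.
  apply: le_trans H1 _; rewrite ler_wpM2l// lerXn2r ?nnegrE ?mulr_ge0 ?(ltW t0)//; exact: Cs.
by apply: le_trans H2 _; rewrite ler_wpM2l// lerXn2r ?nnegrE ?(ltW t0)//; exact: Bs.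
Qed.

(** The second difference is symmetric in a and b, so that t^2 times the gap of the two mixed
    derivatives is O(t^3). *)
Lemma Schwarz_sym U x f (a b : 'I_n) : open U -> U x -> Ck 3 U f ->
  partial a (partial b f) x = partial b (partial a f) x.
Proof.
move=> Uo Ux fk.
have [r1 [C1 [r10 C10 H1]]] := mixed_difference a b Uo Ux fk.
have [r2 [C2 [r20 C20 H2]]] := mixed_difference b a Uo Ux fk.
set X := partial b (partial a f) x; set Y := partial a (partial b f) x.
apply/eqP; rewrite eq_sym -subr_eq0 -normr_eq0 eq_le normr_ge0 andbT leNgt.
apply/negP => XY0; pose D := `|X - Y|.
have C120 : 0 < C1 + C2 + 1 by rewrite ltr_wpDl// addr_ge0.
pose t := Num.min (Num.min r1 r2) (D / (C1 + C2 + 1)) / 2.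
have m0 : 0 < Num.min (Num.min r1 r2) (D / (C1 + C2 + 1)).
  by rewrite !lt_min r10 r20 divr_gt0.
have t0 : 0 < t by rewrite divr_gt0.
have : t < Num.min (Num.min r1 r2) (D / (C1 + C2 + 1)).
  by rewrite /t ltr_pdivrMr// mulrDr mulr1 ltrDl.
rewrite !lt_min => /andP[/andP[tr1 tr2] tD].
have := H1 t; rewrite t0 tr1 => /(_ isT) K1.
have := H2 t; rewrite t0 tr2 => /(_ isT) K2.
have : `|t ^+ 2 * (X - Y)| <= (C1 + C2) * t ^+ 3.
  rewrite [X in `|X| <= _](_ : _ =
    (f (x + t *: basis_vec b + t *: basis_vec a) - f (x + t *: basis_vec b)
      - f (x + t *: basis_vec a) + f x - t ^+ 2 * Y) -
    (f (x + t *: basis_vec a + t *: basis_vec b) - f (x + t *: basis_vec a)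
      - f (x + t *: basis_vec b) + f x - t ^+ 2 * X)); last first.
    by rewrite (addrAC x (t *: basis_vec b)); ring.
  by apply: le_trans (ler_normB _ _) _; rewrite addrC mulrDl lerD.
rewrite normrM (ger0_norm (exprn_ge0 2 (ltW t0))) -/D (exprSr t 2) [leRHS]mulrCA.
rewrite ler_pM2l ?exprn_gt0// => DC.
move: tD; rewrite ltr_pdivlMr// mulrDr mulr1 mulrC => /lt_le_trans/(_ DC).
by rewrite ltNge lerDl (ltW t0).
Qed.
End CkTheory.

(** * Picard iteration *)

Section Picard.
Context {R : realType}.
Local Notation mu := (@lebesgue_measure R).

Lemma antiderivative (g : R -> R) (T : R) : continuous g ->
  exists2 G : R -> R, G 0 = 0 & forall t : R, `|t| < T -> is_derive t 1 G (g t).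
Proof.
(* Starting the integral at -T puts 0 in the interior of the interval, so that the fundamental
   theorem of calculus applies on both sides of it; subtracting [F 0] normalizes afterwards. *)
move=> gc; pose F (x : R) := (\int[mu]_(t in [set` `[- T, x]]) g t)%R.
exists (fun t => F t - F 0); first by rewrite subrr.
move=> t; rewrite ltr_norml => /andP[tT1 tT2].
have gi : mu.-integrable `[- T, T] (EFin \o g).
  apply: continuous_compact_integrable; first exact: segment_compact.
  exact: continuous_subspaceT.
have [Fd FE] := continuous_FTC1_closed tT2 gi tT1 (gc t).
rewrite -[g t]subr0; apply: is_deriveB.
by split; [exact: Fd|rewrite -derive1E; exact: FE].
Qed.

Lemma le_geometric0 (x C : R) : (forall k, x <= C / 2 ^+ k) -> x <= 0.
Proof.
move=> H; rewrite leNgt; apply/negP => x0.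
have C0 : 0 < C by have := H 0%N; rewrite expr0 divr1; exact: lt_le_trans.
pose N := Num.bound (C / x).
have NC : C / x < N%:R by apply: archi_boundP; rewrite divr_ge0 ?ltW.
have N2 : N%:R < 2 ^+ N :> R by rewrite -natrX ltr_nat ltn_expl.
have := H N; rewrite ler_pdivlMr ?exprn_gt0// leNgt => /negP; apply.
rewrite mulrC -ltr_pdivrMr//; exact: lt_trans NC N2.
Qed.

(** Nested intervals: since 2D/2^k = D/2^k + 2D/2^(k+1), the interval around x_(k+1) lies in the one
    around x_k. The limit is the supremum of the left endpoints. *)
Lemma geometric_limit (x : nat -> R) (D : R) :
  (forall k, `|x k.+1 - x k| <= D / 2 ^+ k) ->
  exists l, forall k, `|l - x k| <= 2 * D / 2 ^+ k.
Proof.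
move=> xD; pose b k := x k - 2 * D / 2 ^+ k; pose a k := x k + 2 * D / 2 ^+ k.
have D0 : 0 <= D by have := xD 0%N; rewrite expr0 divr1; exact: le_trans.
have step k : 2 * D / 2 ^+ k = D / 2 ^+ k + 2 * D / 2 ^+ k.+1.
  by rewrite exprS; field; rewrite expf_neq0.
have bS k : b k <= b k.+1.
  rewrite /b step; have := xD k; rewrite ler_norml => /andP[+ _]; lra.
have aS k : a k.+1 <= a k.
  rewrite /a (step k); have := xD k; rewrite ler_norml => /andP[_ +]; lra.
have bm i j : (i <= j)%N -> b i <= b j.
  by elim: j => [|j IH]; [rewrite leqn0 => /eqP->|rewrite leq_eqVlt => /predU1P[->//|/IH/le_trans]; apply].
have am i j : (i <= j)%N -> a j <= a i.
  elim: j => [|j IH]; first by rewrite leqn0 => /eqP->.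
  by rewrite leq_eqVlt => /predU1P[->//|/IH]; exact: le_trans.
have bLa i j : b i <= a j.
  apply: (le_trans (bm _ _ (leq_maxl i j))); apply: (le_trans _ (am _ _ (leq_maxr i j))).
  rewrite /a /b; have : 0 <= 2 * D / 2 ^+ maxn i j by rewrite divr_ge0 ?mulr_ge0 ?exprn_ge0.
  lra.
have sb : has_sup (range b).
  by split; [exists (b 0%N); exists 0%N|exists (a 0%N) => _ [k _ <-]].
exists (sup (range b)) => k.
have h1 : b k <= sup (range b) by apply: ub_le_sup; [case: sb|exists k].
have h2 : sup (range b) <= a k by apply: ge_sup; [case: sb|move=> _ [j _ <-]].
by rewrite ler_norml; move: h1 h2; rewrite /a /b; lra.
Qed.

Section PicardODE.
Variables (m : nat) (F : 'rV[R]_m -> 'rV[R]_m) (K T : R) (u0 : 'rV[R]_m).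
Hypotheses (T0 : 0 < T) (K0 : 0 <= K) (KT : K * T <= 2^-1).
Hypothesis FL : forall u v, `|F u - F v| <= K * `|u - v|.

(** Clipping the time makes every iterate a continuous function on the whole line, frozen outside
    [-T, T], so that estimates on this interval hold everywhere. *)
Let clip (t : R) := Num.max (- T) (Num.min T t).

Let clipT t : `|clip t| <= T.
Proof.
rewrite ler_norml /clip le_max lexx /= ge_max ge_min lexx /= andbT.
by move: T0; lra.
Qed.

Let clip_id t : `|t| <= T -> clip t = t.
Proof. by rewrite ler_norml /clip => /andP[h1 h2]; rewrite min_r// max_r. Qed.

Let clip_cont : continuous clip.
Proof.
move=> t; rewrite /clip; apply: (@continuous_max _ _ (fun=> - T) (fun t => Num.min T t)).
  exact: cst_continuous.
by apply: (@continuous_min _ _ (fun=> T) id); [exact: cst_continuous|].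
Qed.

Let F_cont (u : R -> 'rV[R]_m) : continuous u -> continuous (fun t => F (u t)).
Proof.
move=> uc t; apply/cvgrPdist_le => e e0.
have K1 : 0 < K + 1 by rewrite ltr_wpDl.
have /cvgrPdist_le /(_ (e / (K + 1))) H := uc t.
have {H} := H (divr_gt0 e0 K1); apply: filterS => s Hs.
apply: le_trans (FL _ _) _; move: Hs; rewrite ler_pdivlMr// mulrC => /(le_trans _); apply.
by rewrite ler_wpM2r// lerDl.
Qed.

(** The operator sending u to u0 plus the integral of F(u) from 0 to t. It is stated for every u,
    with continuity as a premise of the properties, so that [choice] yields a total map. The
    antiderivative is taken up to 2T, which makes G differentiable on the closed interval [-T, T],
    as the mean value bounds require. *)
Let picard_step (u : R -> 'rV[R]_m) : exists w : R -> 'rV[R]_m, continuous u ->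
  [/\ continuous w, w 0 = u0, (forall t, w t = w (clip t)) &
      forall t : R, `|t| < T -> is_derive t 1 w (F (u t))] /\
  exists2 G : R -> 'rV[R]_m, (forall t, w t = u0 + G (clip t)) & G 0 = 0 /\
    forall t : R, `|t| <= T -> is_derive t 1 G (F (u t)).
Proof.
have [uc|nuc] := pselect (continuous u); last by exists (fun=> 0).
have H a : exists2 G : R -> R, G 0 = 0 &
    forall t : R, `|t| < 2 * T -> is_derive t 1 G (F (u t) 0 a).
  apply: antiderivative => t; apply: continuous_coord; exact: F_cont.
pose G t : 'rV[R]_m := \row_a sval (cid2 (H a)) t.
have G0 : G 0 = 0 by apply/rowP => a; rewrite !mxE; case: cid2.
have Gd (t : R) : `|t| <= T -> is_derive t 1 G (F (u t)).
  move=> tT; apply/is_derive_rv => a; rewrite (_ : (fun y => _) = sval (cid2 (H a))).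
    by case: cid2 => g /= _; apply; rewrite (le_lt_trans tT)// mulrDl mul1r ltrDl.
  by apply/funext => s; rewrite mxE.
exists (fun t => u0 + G (clip t)) => _; split; last by exists G.
split.
- move=> t; apply: (@continuousD _ _ _ (fun=> u0) (fun t => G (clip t))); first exact: cst_continuous.
  apply: (@continuous_comp _ _ _ clip G); first exact: clip_cont.
  by apply: differentiable_continuous; apply/derivable1_diffP; case: (Gd (clip t) (clipT t)).
- by rewrite clip_id ?normr0 ?ltW// G0 addr0.
- by move=> t; rewrite [clip (clip t)]clip_id.
- move=> t tT; apply: (@near_eq_is_derive _ _ _ (fun t => u0 + G t)).
    have : nbhs t (ball t (T - `|t|)) by apply: nbhsx_ballx; rewrite subr_gt0.
    apply: filterS => s; rewrite /ball /= => ts; rewrite clip_id//.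
    have : `|s| <= `|t| + `|t - s|.
      by rewrite -{1}(subKr t s) (le_trans (ler_normB _ _)).
    lra.
  rewrite -[F (u t)]add0r; apply: is_deriveD; apply: Gd; exact: ltW.
Qed.

Theorem picard : exists u : R -> 'rV[R]_m, u 0 = u0 /\
  forall t : R, `|t| < T -> is_derive t 1 u (F (u t)).
Proof.
have [Phi PhiP] := choice picard_step.
pose u k := iter k Phi (fun=> u0).
have uc k : continuous (u k).
  elim: k => [|k IH]; first exact: cst_continuous.
  by have [[]] := PhiP _ IH.
(* The contraction factor 1/2 is the bound on K T. *)
have contr v v' e : continuous v -> continuous v' ->
    (forall t, `|v t - v' t| <= e) -> forall t, `|Phi v t - Phi v' t| <= e / 2.
  move=> vc v'c vv t; have e0 : 0 <= e by exact: le_trans (vv 0).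
  have [_ [G GE [G0 Gd]]] := PhiP _ vc; have [_ [G' GE' [G0' Gd']]] := PhiP _ v'c.
  rewrite GE GE' opprD addrACA subrr add0r; apply: rv_norm_le => [|a]; first by rewrite divr_ge0.
  rewrite !mxE; set s := clip t.
  have : `|(G s 0 a - G' s 0 a) - (G 0 0 a - G' 0 0 a)| <= K * e * `|s|.
    apply: (@mvt0_bound _ (fun s => G s 0 a - G' s 0 a) (fun s => F (v s) 0 a - F (v' s) 0 a)) => x xs.
      have xT : `|x| <= T by rewrite (le_trans xs)// clipT.
      by apply: is_deriveB; [apply: (is_derive_rv _ _ _ _).2 (Gd _ xT) a|
        apply: (is_derive_rv _ _ _ _).2 (Gd' _ xT) a].
    have := rv_coord_le (F (v x) - F (v' x)) a; rewrite !mxE => /le_trans; apply.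
    by apply: le_trans (FL _ _) _; rewrite ler_wpM2l.
  rewrite G0 G0' !mxE !subr0 => /le_trans; apply.
  rewrite mulrAC mulrC ler_wpM2l//; apply: le_trans KT.
  by rewrite ler_wpM2l// clipT.
pose D := `|F u0| * T.
have u1 t : `|u 1%N t - u 0%N t| <= D.
  have [_ [G GE [G0 Gd]]] := PhiP _ (uc 0%N).
  rewrite /= GE addrAC subrr add0r; apply: rv_norm_le => [|a]; first by rewrite mulr_ge0// ltW.
  set s := clip t; have : `|G s 0 a - G 0 0 a| <= `|F u0| * `|s|.
    apply: (@mvt0_bound _ (fun s => G s 0 a) (fun s => F u0 0 a)) => x xs.
      have xT : `|x| <= T by rewrite (le_trans xs)// clipT.
      exact: (is_derive_rv _ _ _ _).2 (Gd _ xT) a.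
    exact: rv_coord_le.
  by rewrite G0 !mxE subr0 => /le_trans; apply; rewrite ler_wpM2l// clipT.
have uS k t : `|u k.+1 t - u k t| <= D / 2 ^+ k.
  elim: k t => [|k IH] t; first by rewrite expr0 divr1.
  rewrite exprSr invfM mulrA; exact: (contr (u k.+1) (u k) _ (uc _) (uc _) IH).
have lim t : exists l : 'rV[R]_m, forall k, `|l - u k t| <= 2 * D / 2 ^+ k.
  have H a : exists l, forall k, `|l - u k t 0 a| <= 2 * D / 2 ^+ k.
    apply: geometric_limit => k; apply: le_trans (uS k t).
    by have := rv_coord_le (u k.+1 t - u k t) a; rewrite !mxE.
  exists (\row_a sval (cid (H a))) => k; apply: rv_norm_le => [|a].
    by rewrite divr_ge0 ?exprn_ge0// mulr_ge0// /D mulr_ge0// ltW.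
  by rewrite !mxE; case: cid.
have [v vP] := choice lim.
have vc : continuous v.
  move=> t; apply/cvgrPdist_le => e e0.
  have [k Hk] : exists k, 2 * D / 2 ^+ k < e / 3.
    apply: contrapT => H; have : e / 3 <= 0.
      apply: (@le_geometric0 _ (2 * D)) => k; rewrite leNgt; apply/negP => Hk.
      by apply: H; exists k.
    by rewrite leNgt divr_gt0.
  have /cvgrPdist_le /(_ (e / 3)) := uc k t; rewrite divr_gt0// => /(_ isT).
  apply: filterS => s Hs.
  have -> : v t - v s = (v t - u k t) + (u k t - u k s) - (v s - u k s).
    by rewrite opprB !subrKA.
  apply: le_trans (ler_normB _ _) _; apply: le_trans (lerD (ler_normD _ _) (lexx _)) _.
  have := vP t k; have := vP s k; lra.
(* Both sides are within a multiple of 2^-k of the iterate k + 1, for every k. *)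
have E : v = Phi v.
  apply/funext => t; apply/eqP; rewrite -subr_eq0 -normr_eq0 eq_le normr_ge0 andbT.
  apply: (@le_geometric0 _ (2 * D)) => k.
  have h1 := vP t k.+1.
  have h2 : `|Phi v t - u k.+1 t| <= (2 * D / 2 ^+ k) / 2.
    exact: (contr v (u k) _ vc (uc k) (vP ^~ k)).
  rewrite -(subrKA (u k.+1 t)) (le_trans (ler_normD _ _))//.
  rewrite (distrC (u k.+1 t)) (splitr (2 * D / 2 ^+ k)) lerD//.
  by rewrite (le_trans h1)// exprSr invfM mulrA.
exists v; have [[_ w0 _ wd] _] := PhiP _ vc.
by split; [rewrite E|move=> t tT; rewrite {1}E; exact: wd].
Qed.
End PicardODE.
End Picard.

(** * Two-jets of metrics *)

Section BigO.
Context {R : realType} {P : Type} (D : set P) (m : P -> R).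
Hypothesis m01 : forall p, D p -> 0 <= m p <= 1.

(* The estimate h = O(m^k), uniformly in the parameters satisfying D. *)
Definition bo (W : normedModType R) (k : nat) (h : P -> W) : Prop :=
  exists2 C, 0 <= C & forall p, D p -> `|h p| <= C * m p ^+ k.

Lemma boW (W : normedModType R) k l (h : P -> W) : bo l h -> (k <= l)%N -> bo k h.
Proof.
move=> [C C0 H] kl; exists C => // p Dp; apply: le_trans (H _ Dp) _.
by rewrite ler_wpM2l//; have /andP[? ?] := m01 Dp; rewrite ler_wiXn2l.
Qed.

Lemma bo_eq (W : normedModType R) k (h h' : P -> W) :
  (forall p, D p -> h p = h' p) -> bo k h -> bo k h'.
Proof. by move=> E [C C0 H]; exists C => // p Dp; rewrite -E//; exact: H. Qed.

Lemma boD (W : normedModType R) k (h h' : P -> W) :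
  bo k h -> bo k h' -> bo k (fun p => h p + h' p).
Proof.
move=> [C C0 H] [C' C'0 H']; exists (C + C'); first exact: addr_ge0.
by move=> p Dp; rewrite mulrDl (le_trans (ler_normD _ _))// lerD ?H ?H'.
Qed.

Lemma boN (W : normedModType R) k (h : P -> W) : bo k h -> bo k (fun p => - h p).
Proof. by move=> [C C0 H]; exists C => // p Dp; rewrite normrN H. Qed.

Lemma boB (W : normedModType R) k (h h' : P -> W) :
  bo k h -> bo k h' -> bo k (fun p => h p - h' p).
Proof. by move=> hk h'k; apply: boD hk (boN h'k). Qed.

Lemma boZ (W : normedModType R) k k' (a : P -> R) (h : P -> W) :
  bo k a -> bo k' h -> bo (k + k') (fun p => a p *: h p).
Proof.
move=> [C C0 H] [C' C'0 H']; exists (C * C'); first exact: mulr_ge0.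
by move=> p Dp; rewrite normrZ exprD mulrACA ler_pM// ?H ?H'.
Qed.

Lemma boM k k' (a h : P -> R) : bo k a -> bo k' h -> bo (k + k') (fun p => a p * h p).
Proof. exact: boZ. Qed.

Lemma boC (W : normedModType R) (c : W) : bo 0 (fun=> c).
Proof. by exists `|c| => // p _; rewrite expr0 mulr1. Qed.

Lemma bo_le1 (W : normedModType R) (h : P -> W) : (forall p, D p -> `|h p| <= 1) -> bo 0 h.
Proof. by move=> H; exists 1 => // p Dp; rewrite expr0 mulr1 H. Qed.

Lemma bo_scale (W : normedModType R) k (c : R) (h : P -> W) :
  bo k h -> bo k (fun p => c *: h p).
Proof. by move=> hk; apply: (boZ (boC c) hk). Qed.

Lemma bo_mul k (c : R) (h : P -> R) : bo k h -> bo k (fun p => c * h p).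
Proof. by move=> hk; apply: (boM (boC c) hk). Qed.

Lemma bo_bil (V V' W : normedModType R) (f : V -> V' -> W) (K : R) k k' a b :
  (forall u w, `|f u w| <= K * `|u| * `|w|) -> bo k a -> bo k' b ->
  bo (k + k') (fun p => f (a p) (b p)).
Proof.
move=> fK [C C0 H] [C' C'0 H']; exists (`|K| * C * C'); first by rewrite !mulr_ge0.
move=> p Dp; apply: le_trans (fK _ _) _.
apply: (@le_trans _ _ (`|K| * `|a p| * `|b p|)); first by rewrite !ler_wpM2r// ler_norm.
by rewrite exprD -!mulrA ler_wpM2l// [leRHS](_ : _ = (C * m p ^+ k) * (C' * m p ^+ k'));
  [rewrite ler_pM// ?H ?H'|ring].
Qed.

Lemma bo_tri (V V' V2 W : normedModType R) (f : V -> V' -> V2 -> W) (K : R) k k' k2 a b c :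
  (forall u w z, `|f u w z| <= K * `|u| * `|w| * `|z|) -> bo k a -> bo k' b -> bo k2 c ->
  bo (k + k' + k2) (fun p => f (a p) (b p) (c p)).
Proof.
move=> fK [C C0 H] [C' C'0 H'] [C2 C20 H2]; exists (`|K| * C * C' * C2); first by rewrite !mulr_ge0.
move=> p Dp; apply: le_trans (fK _ _ _) _.
apply: (@le_trans _ _ (`|K| * `|a p| * `|b p| * `|c p|)); first by rewrite !ler_wpM2r// ler_norm.
rewrite !exprD -!mulrA ler_wpM2l//
  [leRHS](_ : _ = (C * m p ^+ k) * ((C' * m p ^+ k') * (C2 * m p ^+ k2))); last by ring.
by rewrite !ler_pM// ?H ?H' ?H2// mulr_ge0.
Qed.

Lemma bo_quad (V V' V2 V3 W : normedModType R) (f : V -> V' -> V2 -> V3 -> W) (K : R)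
    k k' k2 k3 a b c d :
  (forall u w z t, `|f u w z t| <= K * `|u| * `|w| * `|z| * `|t|) ->
  bo k a -> bo k' b -> bo k2 c -> bo k3 d ->
  bo (k + k' + k2 + k3) (fun p => f (a p) (b p) (c p) (d p)).
Proof.
move=> fK [C C0 H] [C' C'0 H'] [C2 C20 H2] [C3 C30 H3].
exists (`|K| * C * C' * C2 * C3); first by rewrite !mulr_ge0.
move=> p Dp; apply: le_trans (fK _ _ _ _) _.
apply: (@le_trans _ _ (`|K| * `|a p| * `|b p| * `|c p| * `|d p|)).
  by rewrite !ler_wpM2r// ler_norm.
rewrite !exprD -!mulrA ler_wpM2l//
  [leRHS](_ : _ = (C * m p ^+ k) * ((C' * m p ^+ k') * ((C2 * m p ^+ k2) * (C3 * m p ^+ k3))));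
  last by ring.
by rewrite !ler_pM// ?H ?H' ?H2 ?H3// ?mulr_ge0.
Qed.
End BigO.

(* The 2-jet of a metric at a point, with the 1-jet of its Christoffel symbols:
   [jg], [jB], [jH] are the metric and its first and second differentials,
   [jGa], [jG] are the Christoffel symbols and their differential. *)
Record jet (R : realType) (n : nat) := Jet {
  jg : 'rV[R]_n -> 'rV[R]_n -> R;
  jB : 'rV[R]_n -> 'rV[R]_n -> 'rV[R]_n -> R;
  jH : 'rV[R]_n -> 'rV[R]_n -> 'rV[R]_n -> 'rV[R]_n -> R;
  jGa : 'rV[R]_n -> 'rV[R]_n -> 'rV[R]_n;
  jG : 'rV[R]_n -> 'rV[R]_n -> 'rV[R]_n -> 'rV[R]_n;
  jgC : forall u w, jg u w = jg w u;
  jgD : forall u u' w, jg (u + u') w = jg u w + jg u' w;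
  jgZ : forall a u w, jg (a *: u) w = a * jg u w;
  jBC : forall y u w, jB y u w = jB y w u;
  jBD1 : forall y y' u w, jB (y + y') u w = jB y u w + jB y' u w;
  jBZ1 : forall a y u w, jB (a *: y) u w = a * jB y u w;
  jBD : forall y u u' w, jB y (u + u') w = jB y u w + jB y u' w;
  jBZ : forall a y u w, jB y (a *: u) w = a * jB y u w;
  jHC : forall y z u w, jH y z u w = jH y z w u;
  jHC1 : forall y z u w, jH y z u w = jH z y u w;
  jHD1 : forall y y' z u w, jH (y + y') z u w = jH y z u w + jH y' z u w;
  jHZ1 : forall a y z u w, jH (a *: y) z u w = a * jH y z u w;
  jHD : forall y z u u' w, jH y z (u + u') w = jH y z u w + jH y z u' w;
  jHZ : forall a y z u w, jH y z (a *: u) w = a * jH y z u w;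
  jGaC : forall u w, jGa u w = jGa w u;
  jGaD : forall u u' w, jGa (u + u') w = jGa u w + jGa u' w;
  jGaZ : forall a u w, jGa (a *: u) w = a *: jGa u w;
  jGC : forall y u w, jG y u w = jG y w u;
  jGD1 : forall y y' u w, jG (y + y') u w = jG y u w + jG y' u w;
  jGZ1 : forall a y u w, jG (a *: y) u w = a *: jG y u w;
  jGD : forall y u u' w, jG y (u + u') w = jG y u w + jG y u' w;
  jGZ : forall a y u w, jG y (a *: u) w = a *: jG y u w;
  jK : R;
  jg_le : forall u w, `|jg u w| <= jK * `|u| * `|w|;
  jB_le : forall y u w, `|jB y u w| <= jK * `|y| * `|u| * `|w|;
  jH_le : forall y z u w, `|jH y z u w| <= jK * `|y| * `|z| * `|u| * `|w|;
  jGa_le : forall u w, `|jGa u w| <= jK * `|u| * `|w|;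
  jG_le : forall y u w, `|jG y u w| <= jK * `|y| * `|u| * `|w|;
  jc : R;
  jc_gt0 : 0 < jc;
  jg_ge : forall u, jc * `|u| ^+ 2 <= jg u u;
  jGa_lower : forall u w l, jg (jGa u w) l = 2^-1 * (jB u w l + jB w u l - jB l u w);
  jG_lower : forall y u w l, jg (jG y u w) l + jB y (jGa u w) l =
    2^-1 * (jH y u w l + jH y w u l - jH y l u w) }.

(** * Curvature of a two-jet and the expansion of the metric *)

Section JetAlgebra.
Context {R : realType} {n : nat} (J : jet R n).
Local Notation V := 'rV[R]_n.
Local Notation g0 := (jg J).
Local Notation B := (jB J).
Local Notation H := (jH J).
Local Notation Ga := (jGa J).
Local Notation G := (jG J).

Lemma jgDr u w w' : g0 u (w + w') = g0 u w + g0 u w'.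
Proof. by rewrite ![g0 u _]jgC jgD. Qed.
Lemma jgZr a u w : g0 u (a *: w) = a * g0 u w.
Proof. by rewrite ![g0 u _]jgC jgZ. Qed.
Lemma jgN u w : g0 (- u) w = - g0 u w.
Proof. by rewrite -scaleN1r jgZ mulN1r. Qed.
Lemma jgNr u w : g0 u (- w) = - g0 u w.
Proof. by rewrite ![g0 u _]jgC jgN. Qed.
Lemma jBDr y u w w' : B y u (w + w') = B y u w + B y u w'.
Proof. by rewrite ![B y u _]jBC jBD. Qed.
Lemma jBZr a y u w : B y u (a *: w) = a * B y u w.
Proof. by rewrite ![B y u _]jBC jBZ. Qed.
Lemma jBNr y u w : B y u (- w) = - B y u w.
Proof. by rewrite -scaleN1r jBZr mulN1r. Qed.
Lemma jHDr y z u w w' : H y z u (w + w') = H y z u w + H y z u w'.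
Proof. by rewrite ![H y z u _]jHC jHD. Qed.
Lemma jHD2 y z z' u w : H y (z + z') u w = H y z u w + H y z' u w.
Proof. by rewrite jHC1 jHD1 ![H _ y _ _]jHC1. Qed.
Lemma jGaDr u w w' : Ga u (w + w') = Ga u w + Ga u w'.
Proof. by rewrite ![Ga u _]jGaC jGaD. Qed.
Lemma jGaZr a u w : Ga u (a *: w) = a *: Ga u w.
Proof. by rewrite ![Ga u _]jGaC jGaZ. Qed.
Lemma jGDr y u w w' : G y u (w + w') = G y u w + G y u w'.
Proof. by rewrite ![G y u _]jGC jGD. Qed.
Lemma jGZr a y u w : G y u (a *: w) = a *: G y u w.
Proof. by rewrite ![G y u _]jGC jGZ. Qed.

(** Compatibility of the connection with the metric: in the sum of the two lowered Christoffel
    symbols the terms with opposite signs cancel. *)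
Lemma jet_compat a x d : B a x d = g0 (Ga a x) d + g0 x (Ga a d).
Proof. by rewrite [g0 x _]jgC !jGa_lower (jBC J a d x); field. Qed.

Definition jR (a b c : V) : V := G a b c - G b a c + Ga a (Ga b c) - Ga b (Ga a c).

(** Lowering the index trades derivatives of Christoffel symbols for second derivatives of the
    metric. In this form the symmetries of the curvature follow from those of [H], [Ga] and [g0]. *)
Lemma jR_lower a b c d : g0 (jR a b c) d =
  2^-1 * (H a c b d - H a d b c - H b c a d + H b d a c)
  - g0 (Ga a d) (Ga b c) + g0 (Ga b d) (Ga a c).
Proof.
rewrite /jR !(jgD, jgN).
have h1 := jG_lower J a b c d; have h2 := jG_lower J b a c d.
have h3 := jet_compat a (Ga b c) d; have h4 := jet_compat b (Ga a c) d.
have h5 := jHC1 J a b c d.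
rewrite [g0 (Ga a d) _]jgC [g0 (Ga b d) _]jgC.
lra.
Qed.

(* [jQ y u] is the curvature R(y, u, u, y) and [jF y] its polarization in u. *)
Definition jQ (y u : V) : R := g0 (jR y u u) y.
Definition jF (y u w : V) : R := g0 (jR u y y) w.

Lemma jF_sym y u w : jF y u w = jF y w u.
Proof.
rewrite /jF !jR_lower.
have e1 : H u y y w = H y u w y by rewrite jHC1 jHC.
have e2 : H y w u y = H w y y u by rewrite jHC1 jHC.
have e3 : H u w y y = H w u y y by rewrite jHC1.
have e4 : H y y u w = H y y w u by rewrite jHC.
have e5 : g0 (Ga y w) (Ga u y) = g0 (Ga y u) (Ga w y).
  by rewrite jgC (jGaC J u y) (jGaC J w y).
rewrite (jGaC J w u); lra.
Qed.

(** This is the pair symmetry R(u,y,y,u) = R(y,u,u,y), since [jF] exchanges the roles of y and u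
    with respect to [jQ]. *)
Lemma jF_diag y u : jF y u u = jQ y u.
Proof.
rewrite /jF /jQ !jR_lower.
have e1 : H u y y u = H y u u y by rewrite jHC1 jHC.
have e2 : g0 (Ga u u) (Ga y y) = g0 (Ga y y) (Ga u u) by rewrite jgC.
have e3 : g0 (Ga y u) (Ga u y) = g0 (Ga u y) (Ga y u) by rewrite jgC.
lra.
Qed.

Lemma jRDr a b c c' : jR a b (c + c') = jR a b c + jR a b c'.
Proof. by rewrite /jR !jGDr !jGaDr; apply/rowP => i; rewrite !mxE; ring. Qed.
Lemma jRDl a a' b c : jR (a + a') b c = jR a b c + jR a' b c.
Proof. by rewrite /jR jGD1 !(jGD J, jGaD J, jGaDr); apply/rowP => i; rewrite !mxE; ring. Qed.
Lemma jRZl s a b c : jR (s *: a) b c = s *: jR a b c.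
Proof. by rewrite /jR jGZ1 !(jGZ J, jGaZ J, jGaZr); apply/rowP => i; rewrite !mxE; ring. Qed.
Lemma jRC a b c : jR a b c = - jR b a c.
Proof. by rewrite /jR; apply/rowP => i; rewrite !mxE; ring. Qed.
Lemma jRZr s a b c : jR a b (s *: c) = s *: jR a b c.
Proof. by rewrite /jR !jGZr !jGaZr; apply/rowP => i; rewrite !mxE; ring. Qed.
Lemma jRDm a b b' c : jR a (b + b') c = jR a b c + jR a b' c.
Proof. by rewrite jRC jRDl opprD -!jRC. Qed.
Lemma jRZm s a b c : jR a (s *: b) c = s *: jR a b c.
Proof. by rewrite jRC jRZl -scalerN -jRC. Qed.
Lemma jR_diag a c : jR a a c = 0.
Proof. by rewrite /jR; apply/rowP => i; rewrite !mxE; ring. Qed.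
Lemma jR_alt a b c : g0 (jR a b c) c = 0.
Proof.
rewrite jR_lower (jHC1 J b c a c) [g0 (Ga b c) _]jgC (jHC1 J c b); ring.
Qed.

Lemma jF_D y u u' w : jF y (u + u') w = jF y u w + jF y u' w.
Proof. by rewrite /jF jRDl jgD. Qed.
Lemma jF_Z a y u w : jF y (a *: u) w = a * jF y u w.
Proof. by rewrite /jF jRZl jgZ. Qed.
Lemma jF_Dr y u w w' : jF y u (w + w') = jF y u w + jF y u w'.
Proof. by rewrite /jF jgDr. Qed.
Lemma jF_Zr a y u w : jF y u (a *: w) = a * jF y u w.
Proof. by rewrite /jF jgZr. Qed.
Lemma jF_self y u : jF y y u = 0.
Proof. by rewrite /jF jR_diag -(scale0r (0 : V)) jgZ mul0r. Qed.

(** R(e,e) = 0 and the skew symmetry of R(y,e) remove every term in s. Hence [jQ] is constant along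
    the segment joining two vectors, and the correction term of the calibration has a simple
    derivative along e. *)
Lemma jQ_shift y e s : jQ (y + s *: e) e = jQ y e.
Proof.
rewrite /jQ jRDl jRZl jR_diag scaler0 addr0 jgDr jgZr.
by rewrite jR_alt mulr0 addr0.
Qed.

Lemma jQ_sym y u : jQ y u = jQ u y.
Proof. by rewrite -jF_diag /jF /jQ. Qed.

Lemma jQZ s y u : jQ (s *: y) u = s ^+ 2 * jQ y u.
Proof. by rewrite /jQ jRZl jgZ jgZr; ring. Qed.

Lemma jQZr s y u : jQ y (s *: u) = s ^+ 2 * jQ y u.
Proof. by rewrite jQ_sym jQZ jQ_sym. Qed.

Lemma jR_le : exists K, forall a b c, `|jR a b c| <= K * `|a| * `|b| * `|c|.
Proof.
have K0 (u w : V) : 0 <= `|jK J| * `|u| * `|w| by rewrite !mulr_ge0.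
have Gb y u w : `|G y u w| <= `|jK J| * `|y| * `|u| * `|w|.
  by apply: le_trans (jG_le _ _ _ _) _; rewrite !ler_wpM2r// ler_norm.
have Gab u w : `|Ga u w| <= `|jK J| * `|u| * `|w|.
  by apply: le_trans (jGa_le _ _ _) _; rewrite !ler_wpM2r// ler_norm.
have GG a b c : `|Ga a (Ga b c)| <= `|jK J| ^+ 2 * `|a| * `|b| * `|c|.
  apply: le_trans (Gab _ _) _.
  apply: (@le_trans _ _ (`|jK J| * `|a| * (`|jK J| * `|b| * `|c|))).
    by rewrite ler_wpM2l// mulr_ge0.
  by rewrite le_eqVlt; apply/orP; left; apply/eqP; ring.
exists (2 * `|jK J| + 2 * `|jK J| ^+ 2) => a b c; rewrite /jR.
apply: le_trans (ler_normB _ _) _; apply: le_trans (lerD (ler_normD _ _) (lexx _)) _.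
apply: le_trans (lerD (lerD (ler_normB _ _) (lexx _)) (lexx _)) _.
have := Gb a b c; have := Gb b a c; have := GG a b c; have := GG b a c.
rewrite (_ : `|jK J| * `|b| * `|a| * `|c| = `|jK J| * `|a| * `|b| * `|c|); last by ring.
rewrite (_ : `|jK J| ^+2 * `|b| * `|a| * `|c| = `|jK J| ^+ 2 * `|a| * `|b| * `|c|); last by ring.
lra.
Qed.

(** The squared length of w at the point with displacement y, computed with the second-order Taylor
    polynomial of the metric. *)
Definition jN (y w : V) : R := g0 w w + B y w w + 2^-1 * H y y w w.

(** In the intended use x and u have order 1 in m, y2 and w1 order 2, y3 and w2 order 3, and w3
    order 4. The terms of order at most 4 stand in front; the final parenthesis collects those of
    order at least 5. *)
Lemma jN_expand x y2 y3 u w1 w2 w3 :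
  jN (x + (y2 + y3)) (u + (w1 + (w2 + w3))) =
  g0 u u + 2 * g0 u w1 + 2 * g0 u w2 + g0 w1 w1 + B x u u + B y2 u u + 2 * B x u w1
  + 2^-1 * H x x u u +
  (2 * g0 u w3 + 2 * g0 w1 (w2 + w3) + g0 (w2 + w3) (w2 + w3)
   + B y3 u u + 2 * B x u (w2 + w3) + 2 * B (y2 + y3) u (w1 + (w2 + w3))
   + B (x + (y2 + y3)) (w1 + (w2 + w3)) (w1 + (w2 + w3))
   + H x (y2 + y3) u u + 2^-1 * H (y2 + y3) (y2 + y3) u u
   + H (x + (y2 + y3)) (x + (y2 + y3)) u (w1 + (w2 + w3))
   + 2^-1 * H (x + (y2 + y3)) (x + (y2 + y3)) (w1 + (w2 + w3)) (w1 + (w2 + w3))).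
Proof.
have E1 (a b c : V) : g0 (a + (b + c)) (a + (b + c)) = g0 a a + 2 * g0 a b + 2 * g0 a c
    + g0 b b + 2 * g0 b c + g0 c c.
  by rewrite !jgD !jgDr (jgC J b a) (jgC J c a) (jgC J c b); ring.
have E3 (a b c d : V) : B (a + b) (c + d) (c + d) = B a c c + B b c c + 2 * B a c d
    + 2 * B b c d + B (a + b) d d.
  by rewrite !jBD1 !jBD !jBDr (jBC J a d c) (jBC J b d c); ring.
have E6 (a c d : V) : H a a (c + d) (c + d) = H a a c c + 2 * H a a c d + H a a d d.
  by rewrite jHD !jHDr (jHC J _ _ d c); ring.
have E7 (a b c : V) : H (a + b) (a + b) c c = H a a c c + 2 * H a b c c + H b b c c.
  by rewrite jHD1 !jHD2 (jHC1 J b a); ring.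
rewrite /jN E1 (E3 x) (E6 _ u) (E7 x (y2 + y3) u) (jgDr u w2 w3).
rewrite (jBD1 J y2 y3 u u) (jBDr x u w1); lra.
Qed.

(* x + phi2 x + phi3 x expands the exponential map to third order. *)
Definition phi2 (x : V) : V := (- 2^-1) *: Ga x x.
Definition phi3 (x : V) : V := 6^-1 *: (2 *: Ga x (Ga x x) - G x x x).
Definition dphi2 (x u : V) : V := - Ga x u.
Definition dphi3 (x u : V) : V :=
  6^-1 *: (4 *: Ga x (Ga x u) + 2 *: Ga u (Ga x x) - G u x x - 2 *: G x x u).

(** The classical expansion g_0 - R/3 of the metric in normal coordinates. The terms of order 3
    cancel by compatibility with the metric, and those of order 4 combine into the curvature by the
    lowered identities for [G]. *)
Lemma jet_phi_identity x u :
  g0 u u + 2 * g0 u (dphi2 x u) + 2 * g0 u (dphi3 x u) + g0 (dphi2 x u) (dphi2 x u)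
  + B x u u + B (phi2 x) u u + 2 * B x u (dphi2 x u) + 2^-1 * H x x u u =
  g0 u u - 3^-1 * jQ x u.
Proof.
rewrite /phi2 /dphi2 /dphi3 /jQ jR_lower jBZ1 !(jgNr, jgZr, jgDr, jBNr, jgN) opprK.
have h1 := jG_lower J u x x u; have h2 := jG_lower J x x u u.
have c1 := jet_compat u (Ga x x) u; have c2 := jet_compat x (Ga x u) u.
have c3 := jet_compat x u u; have c4 := jet_compat (Ga x x) u u.
have s1 : H u x x u = H x u u x by rewrite jHC1 jHC.
have s2 : H x u x u = H x u u x by rewrite jHC.
have s3 : g0 (Ga u x) (Ga x u) = g0 (Ga x u) (Ga x u) by rewrite jGaC.
have s4 : Ga (Ga x x) u = Ga u (Ga x x) by rewrite jGaC.
have s5 w : g0 u w = g0 w u by rewrite jgC.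
have s6 : B x u (Ga x u) = B x (Ga x u) u by rewrite jBC.
move: c4 c3; rewrite s4 !s5 s6 => c4 c3.
lra.
Qed.
End JetAlgebra.

(** * Normal coordinates and the calibration *)

Section JetEstimates.
Context {R : realType} {n : nat} (J : jet R n).
Local Notation V := 'rV[R]_n.
Local Notation g0 := (jg J).
Local Notation B := (jB J).
Local Notation H := (jH J).
Local Notation Ga := (jGa J).
Local Notation G := (jG J).

(* The third order expansion of normal coordinates, inverse to that of the
   exponential map given by [phi2] and [phi3]. *)
Definition psi (y : V) : V := y + (2^-1 *: Ga y y + 6^-1 *: (G y y y + Ga y (Ga y y))).
Definition dpsi3 (y u : V) : V :=
  6^-1 *: (G u y y + 2 *: G y u y + Ga u (Ga y y) + 2 *: Ga y (Ga y u)).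
Definition dpsi (y u : V) : V := u + (Ga y u + dpsi3 y u).

(** The same expansion read in the given chart, as an exact identity; the last parenthesis is
    O(|y|^3 |u|^2) because [dpsi3] is quadratic in y. *)
Lemma jet_psi_identity y u :
  jN J y u = g0 (dpsi y u) (dpsi y u) - 3^-1 * jQ J y u
    - (2 * g0 (Ga y u) (dpsi3 y u) + g0 (dpsi3 y u) (dpsi3 y u)).
Proof.
have E1 (a b c : V) : g0 (a + (b + c)) (a + (b + c)) = g0 a a + 2 * g0 a b + 2 * g0 c a
    + g0 b b + 2 * g0 b c + g0 c c.
  by rewrite !(jgD J) !jgDr (jgC J b a) (jgC J a c) (jgC J c b); ring.
rewrite /jN /dpsi E1 /jQ jR_lower.
have -> : g0 (dpsi3 y u) u = 6^-1 * (g0 (G u y y) u + 2 * g0 (G y u y) u + g0 (Ga u (Ga y y)) u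
   + 2 * g0 (Ga y (Ga y u)) u) by rewrite /dpsi3 !(jgZ J, jgD J).
have h1 := jG_lower J u y y u; have h2 := jG_lower J y u y u.
have c1 := jet_compat J u (Ga y y) u; have c2 := jet_compat J y (Ga y u) u.
have c3 := jet_compat J y u u.
have s0 : Ga u y = Ga y u by rewrite jGaC.
have s1 : H u y y u = H y u u y by rewrite jHC1 jHC.
have s2 : H y u y u = H y u u y by rewrite jHC.
have s3 : g0 u (Ga y u) = g0 (Ga y u) u by rewrite jgC.
have s4 : g0 (Ga y y) (Ga u u) = g0 (Ga u u) (Ga y y) by rewrite jgC.
move: c1 h2; rewrite s0 s3 s4 => c1 h2.
lra.
Qed.

(* For a unit vector e this is a calibration up to third order: its gradient at y
   has norm at most 1 + O(|y|^3). *)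
Definition cal (e y : V) : R := g0 e (psi y) - 6^-1 * (g0 e y * jQ J y e).
Definition dcal (e y u : V) : R :=
  g0 e (dpsi y u) - 6^-1 * (g0 e u * jQ J y e + g0 e y * (2 * jF J e y u)).

Section Families.
Context {P : Type} (D : set P) (m : P -> R).
Hypothesis m01 : forall p, D p -> 0 <= m p <= 1.
Local Notation bO := (bo D m).

Lemma bo_g k k' a b : bO k a -> bO k' b -> bO (k + k') (fun p => g0 (a p) (b p)).
Proof. exact: (bo_bil (jg_le J)). Qed.
Lemma bo_B k k' k2 a b c : bO k a -> bO k' b -> bO k2 c ->
  bO (k + k' + k2) (fun p => B (a p) (b p) (c p)).
Proof. exact: (bo_tri (jB_le J)). Qed.
Lemma bo_H k k' k2 k3 a b c d : bO k a -> bO k' b -> bO k2 c -> bO k3 d ->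
  bO (k + k' + k2 + k3) (fun p => H (a p) (b p) (c p) (d p)).
Proof. exact: (bo_quad (jH_le J)). Qed.
Lemma bo_Ga k k' a b : bO k a -> bO k' b -> bO (k + k') (fun p => Ga (a p) (b p)).
Proof. exact: (bo_bil (jGa_le J)). Qed.
Lemma bo_G k k' k2 a b c : bO k a -> bO k' b -> bO k2 c ->
  bO (k + k' + k2) (fun p => G (a p) (b p) (c p)).
Proof. exact: (bo_tri (jG_le J)). Qed.
Lemma bo_F k k' k2 a b c : bO k a -> bO k' b -> bO k2 c ->
  bO (k' + k + k + k2) (fun p => jF J (a p) (b p) (c p)).
Proof.
move=> ak bk ck; have [K RK] := jR_le J.
exact: bo_g (bo_tri RK bk ak ak) ck.
Qed.
Lemma bo_Q k k' a b : bO k a -> bO k' b ->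
  bO (k + k' + k' + k) (fun p => jQ J (a p) (b p)).
Proof.
move=> ak bk; have [K RK] := jR_le J.
exact: bo_g (bo_tri RK ak bk bk) ak.
Qed.

End Families.
End JetEstimates.

(** The order of a product is an existential variable, filled with the sum of the orders of its
    factors as found in the context. [bo_prod] then lowers it to the requested order by [boW], where
    the comparison of exponents is a computation. *)
Ltac bo_leaf := lazymatch goal with
  | |- bo _ _ _ (fun p => @?a p *: @?b p) => eapply boZ; bo_leaf
  | |- bo _ _ _ (fun p => @?a p * @?b p) => eapply boM; bo_leaf
  | |- bo _ _ _ (fun p => jg _ (@?a p) (@?b p)) => eapply bo_g; bo_leaf
  | |- bo _ _ _ (fun p => jB _ (@?a p) (@?b p) (@?c p)) => eapply bo_B; bo_leaf
  | |- bo _ _ _ (fun p => jH _ (@?a p) (@?b p) (@?c p) (@?d p)) => eapply bo_H; bo_leaf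
  | |- bo _ _ _ (fun p => jGa _ (@?a p) (@?b p)) => eapply bo_Ga; bo_leaf
  | |- bo _ _ _ (fun p => jG _ (@?a p) (@?b p) (@?c p)) => eapply bo_G; bo_leaf
  | |- bo _ _ _ (fun p => jF _ (@?a p) (@?b p) (@?c p)) => eapply bo_F; bo_leaf
  | |- bo _ _ _ (fun p => jQ _ (@?a p) (@?b p)) => eapply bo_Q; bo_leaf
  | |- bo _ _ _ (fun=> ?c) => exact: boC
  | _ => eassumption
  end.
Ltac bo_prod m01 := eapply (boW m01); [bo_leaf | done].
Ltac bo_tac m01 := lazymatch goal with
  | |- bo _ _ _ (fun p => @?a p + - @?b p) => apply: boB; bo_tac m01
  | |- bo _ _ _ (fun p => @?a p + @?b p) => apply: boD; bo_tac m01
  | |- bo _ _ _ (fun p => - @?a p) => apply: boN; bo_tac m01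
  | |- bo _ _ _ (fun p => @?c p * @?b p) => first [apply: bo_mul; bo_tac m01 | bo_prod m01]
  | |- bo _ _ _ (fun p => @?c p *: @?b p) => first [apply: bo_scale; bo_tac m01 | bo_prod m01]
  | _ => bo_prod m01
  end.

Section JetFamilies.
Context {R : realType} {n : nat} (J : jet R n).
Local Notation V := 'rV[R]_n.
Local Notation g0 := (jg J).
Local Notation B := (jB J).
Local Notation H := (jH J).
Local Notation Ga := (jGa J).
Local Notation G := (jG J).
Context {P : Type} (D : set P) (m : P -> R).
Hypothesis m01 : forall p, D p -> 0 <= m p <= 1.
Local Notation bO := (bo D m).
Local Notation psi := (psi J).
Local Notation dpsi3 := (dpsi3 J).
Local Notation dpsi := (dpsi J).
Local Notation cal := (cal J).
Local Notation dcal := (dcal J).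

Lemma metric_phi_bo x u y3 w3 : bO 1 x -> bO 1 u -> bO 3 y3 -> bO 4 w3 ->
  bO 5 (fun p => jN J (x p + (phi2 J (x p) + y3 p))
      (u p + (dphi2 J (x p) (u p) + (dphi3 J (x p) (u p) + w3 p)))
    - (g0 (u p) (u p) - 3^-1 * jQ J (x p) (u p))).
Proof.
move=> hx hu hy3 hw3.
pose y2 p := phi2 J (x p); pose w1 p := dphi2 J (x p) (u p); pose w2 p := dphi3 J (x p) (u p).
have hy2 : bO 2 y2 by rewrite /y2 /phi2; bo_tac m01.
have hw1 : bO 2 w1 by rewrite /w1 /dphi2; bo_tac m01.
have hw2 : bO 3 w2 by rewrite /w2 /dphi3; bo_tac m01.
have hy' : bO 2 (fun p => y2 p + y3 p) by bo_tac m01.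
have hw'' : bO 3 (fun p => w2 p + w3 p) by bo_tac m01.
have hw' : bO 2 (fun p => w1 p + (w2 p + w3 p)) by bo_tac m01.
have hy : bO 1 (fun p => x p + (y2 p + y3 p)) by bo_tac m01.
apply: bo_eq => [p _|]; first by rewrite -jet_phi_identity jN_expand [RHS]addrC addKr.
rewrite -/(y2 _); bo_tac m01.
Qed.

Lemma jQ_F e y : jQ J y e = jF J e y y. Proof. by rewrite jF_diag jQ_sym. Qed.

(** Split u = a e + q + r, where a e + q is [dpsi y u], q is orthogonal to e and r = O(m). In the
    difference of the two sides the terms in a alone cancel: the 1/3 of the metric is twice the 1/6
    of the correction. What contains q is |q| times O(m^2), absorbed by the positive term [g0 q q]
    at a cost O(m^4). *)
Lemma calibration_bo e y u : bO 0 e -> bO 1 y -> bO 0 u ->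
  (forall p, D p -> g0 (e p) (e p) = 1) ->
  exists2 C, 0 <= C & forall p, D p ->
    dcal (e p) (y p) (u p) ^+ 2 <= jN J (y p) (u p) + C * m p ^+ 3.
Proof.
move=> he hy hu ge1.
pose w p := Ga (y p) (u p) + dpsi3 (y p) (u p).
pose a p := g0 (e p) (dpsi (y p) (u p)).
pose q p := dpsi (y p) (u p) - a p *: e p.
(* The direction of q, equal to 0 when q = 0: a bounded family through which |q| is factored out of
   multilinear terms. *)
pose qh p := `|q p|^-1 *: q p.
pose r p := - w p.
have hd3 : bO 2 (fun p => dpsi3 (y p) (u p)) by rewrite /dpsi3; bo_tac m01.
have hw : bO 1 w by rewrite /w; bo_tac m01.
have hr : bO 1 r by exact: boN.
have hd : bO 0 (fun p => dpsi (y p) (u p)) by apply: boD => //; exact: boW hw _.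
have ha : bO 0 a by rewrite /a; bo_tac m01.
have hq : bO 0 q by rewrite /q; bo_tac m01.
have hqh : bO 0 qh.
  apply: bo_le1 => p _; rewrite /qh normrZ normfV normr_id.
  by have [->|q0] := eqVneq (`|q p|) 0; rewrite ?mulr0// mulVf.
have qE p : q p = `|q p| *: qh p.
  rewrite /qh scalerA; have [q0|q0] := eqVneq (`|q p|) 0.
    by rewrite q0 mul0r scale0r; apply/eqP; rewrite -normr_eq0 q0.
  by rewrite mulfV// scale1r.
have uE p : u p = a p *: e p + q p + r p.
  by rewrite /q /r [a p *: _ + _]addrC subrK /dpsi -/(w p) addrK.
have geq p : D p -> g0 (e p) (q p) = 0.
  by move=> Dp; rewrite /q jgDr jgNr jgZr ge1// mulr1 subrr.
have aE p : g0 (e p) (dpsi (y p) (u p)) = a p by [].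
have dpE p : dpsi (y p) (u p) = a p *: e p + q p by rewrite /q addrC subrK.
clearbody qh r q a.
have gqe p : D p -> g0 (q p) (e p) = 0 by move=> Dp; rewrite jgC geq.
pose Q p := jQ J (y p) (e p).
pose s p := jF J (e p) (y p) (q p).
pose X p := - (6^-1 * (a p * Q p)) - 3^-1 * (g0 (e p) (y p) * s p).
pose E1 p := - (6^-1 * (g0 (e p) (r p) * Q p)) - 3^-1 * (g0 (e p) (y p) * jF J (e p) (y p) (r p)).
have hQ : bO 2 Q by rewrite /Q; bo_tac m01.
have hs : bO 1 s by rewrite /s; bo_tac m01.
have hX : bO 2 X by rewrite /X; bo_tac m01.
have hE1 : bO 3 E1 by rewrite /E1; bo_tac m01.
have dE p : D p -> dcal (e p) (y p) (u p) = a p + X p + E1 p.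
  move=> Dp; rewrite /dcal aE -/(Q p).
  have -> : jF J (e p) (y p) (u p) = s p + jF J (e p) (y p) (r p).
    by rewrite uE !jF_Dr jF_Zr (jF_sym _ _ (y p) (e p)) jF_self mulr0 add0r.
  have -> : g0 (e p) (u p) = a p + g0 (e p) (r p).
    by rewrite {1}uE !jgDr jgZr geq// ge1// mulr1 addr0.
  rewrite /X /E1; lra.
pose E2 p := X p * X p + 2 * (a p * E1 p) + 2 * (X p * E1 p) + E1 p * E1 p.
have hE2 : bO 3 E2 by rewrite /E2; bo_tac m01.
pose F1 p := jF J (y p) (e p) (q p); pose F2 p := jF J (y p) (q p) (q p).
pose E4 p := - (3^-1 * (2 * (a p * jF J (y p) (e p) (r p)) + 2 * jF J (y p) (q p) (r p)
     + jF J (y p) (r p) (r p)))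
   - (2 * g0 (Ga (y p) (u p)) (dpsi3 (y p) (u p)) + g0 (dpsi3 (y p) (u p)) (dpsi3 (y p) (u p))).
have hE4 : bO 3 E4 by rewrite /E4; bo_tac m01.
have NE p : D p -> jN J (y p) (u p) = a p ^+ 2 + g0 (q p) (q p) - 3^-1 * (a p ^+ 2 * Q p)
    - 3^-1 * (2 * (a p * F1 p) + F2 p) + E4 p.
  move=> Dp; rewrite jet_psi_identity.
  have -> : g0 (dpsi (y p) (u p)) (dpsi (y p) (u p)) = a p ^+ 2 + g0 (q p) (q p).
    by rewrite dpE (jgD J) !jgDr !jgZr !(jgZ J) geq// gqe// ge1//; ring.
  have -> : jQ J (y p) (u p) = a p ^+ 2 * Q p + 2 * (a p * F1 p) + F2 p
     + 2 * (a p * jF J (y p) (e p) (r p)) + 2 * jF J (y p) (q p) (r p) + jF J (y p) (r p) (r p).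
    rewrite -jF_diag {1 2}uE !jF_D !jF_Dr !jF_Z !jF_Zr (jF_sym _ _ (q p) (e p)).
    rewrite (jF_sym _ _ (r p) (e p)) (jF_sym _ _ (r p) (q p)) jF_diag -/(Q p) -/(F1 p) -/(F2 p).
    by ring.
  rewrite /E4; lra.
(* The sum of all terms linear in q or better, divided by |q|; it mixes those of the metric and
   those of the squared differential. *)
pose T p := - (3^-1 * (2 * (a p * jF J (y p) (e p) (qh p)) + jF J (y p) (q p) (qh p)))
  + 2 * 3^-1 * (a p * (g0 (e p) (y p) * jF J (e p) (y p) (qh p))).
have hT : bO 2 T by rewrite /T; bo_tac m01.
have [C C0 HC] := hT; have [C2 C20 HC2] := hE2; have [C4 C40 HC4] := hE4.
exists (C ^+ 2 / (4 * jc J) + C2 + C4).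
  by rewrite !addr_ge0// divr_ge0 ?sqr_ge0// mulr_ge0// ltW// jc_gt0.
move=> p Dp; rewrite dE// NE//.
have TE : `|q p| * T p = - (3^-1 * (2 * (a p * F1 p) + F2 p))
  + 2 * 3^-1 * (a p * (g0 (e p) (y p) * s p)).
  by rewrite /T /F1 /F2 /s {3 5 6}qE !jF_Zr; ring.
have d2 : (a p + X p + E1 p) ^+ 2 = a p ^+ 2 - 3^-1 * (a p ^+ 2 * Q p)
   - 2 * 3^-1 * (a p * (g0 (e p) (y p) * s p)) + E2 p.
  by rewrite /E2 /X; field.
have := HC _ Dp; have := HC2 _ Dp; have := HC4 _ Dp.
rewrite !ler_norml => /andP[h4 _] /andP[_ h2] /andP[h1 _].
have qc := jg_ge J (q p); have c0 := jc_gt0 J.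
have [m0 m1] := andP (m01 Dp).
have m43 : m p ^+ 4 <= m p ^+ 3 by rewrite ler_wiXn2l.
(* Completing the square, with the coercivity constant [jc J] of the metric as weight of |q|^2. *)
have amgm : C * m p ^+ 2 * `|q p| <= jc J * `|q p| ^+ 2 + C ^+ 2 / (4 * jc J) * m p ^+ 4.
  rewrite -subr_ge0 [leRHS](_ : _ = (2 * jc J * `|q p| - C * m p ^+ 2) ^+ 2 / (4 * jc J)).
    by rewrite divr_ge0 ?sqr_ge0// mulr_ge0// ltW.
  by field; rewrite gt_eqF.
have m43' : C ^+ 2 / (4 * jc J) * m p ^+ 4 <= C ^+ 2 / (4 * jc J) * m p ^+ 3.
  by rewrite ler_wpM2l// divr_ge0 ?sqr_ge0// mulr_ge0// ltW.
have Tq : - (C * m p ^+ 2 * `|q p|) <= `|q p| * T p.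
  by rewrite -mulNr [leRHS]mulrC ler_wpM2r.
rewrite d2; move: TE Tq amgm m43' qc h1 h2 h4.
move: (C ^+ 2 / (4 * jc J)) => K TE Tq amgm m43' qc h1 h2 h4.
rewrite 2!mulrDl; lra.
Qed.

(** [psi] inverts the cubic expansion of the exponential map up to order 4, which leaves <e,x>. In
    the correction term, replacing y by x costs O(m^4): the difference y - x has order 2 and enters
    beside quantities of total order at least 2. *)
Lemma calibration_phi e x eps : bO 0 e -> bO 1 x -> bO 4 eps ->
  bO 4 (fun p => cal (e p) (x p + (phi2 J (x p) + (phi3 J (x p) + eps p)))
    - (g0 (e p) (x p) - 6^-1 * (g0 (e p) (x p) * jQ J (x p) (e p)))).
Proof.
move=> he hx heps.
pose y2 p := phi2 J (x p); pose y3 p := phi3 J (x p) + eps p; pose y' p := y2 p + y3 p.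
pose y p := x p + y' p.
have hy2 : bO 2 y2 by rewrite /y2 /phi2; bo_tac m01.
have hp3 : bO 3 (fun p => phi3 J (x p)) by rewrite /phi3; bo_tac m01.
have hy3 : bO 3 y3 by rewrite /y3; bo_tac m01.
have hy' : bO 2 y' by rewrite /y'; bo_tac m01.
have hy : bO 1 y by rewrite /y; bo_tac m01.
pose E p := g0 (e p) (eps p) + g0 (e p) (Ga (x p) (y3 p)) + 2^-1 * g0 (e p) (Ga (y' p) (y' p))
  + 6^-1 * (g0 (e p) (G (y' p) (y p) (y p)) + g0 (e p) (G (x p) (y' p) (y p))
      + g0 (e p) (G (x p) (x p) (y' p)) + g0 (e p) (Ga (y' p) (Ga (y p) (y p)))
      + g0 (e p) (Ga (x p) (Ga (y' p) (y p))) + g0 (e p) (Ga (x p) (Ga (x p) (y' p))))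
  - 6^-1 * (g0 (e p) (y' p) * jQ J (y p) (e p)
      + g0 (e p) (x p) * (2 * jF J (e p) (x p) (y' p) + jF J (e p) (y' p) (y' p))).
have hF : bO 3 (fun p => 2 * jF J (e p) (x p) (y' p) + jF J (e p) (y' p) (y' p)) by bo_tac m01.
have hE : bO 4 E by rewrite /E; bo_tac m01.
apply: bo_eq hE => p _; rewrite -/(y2 p) -/(y3 p) -/(y' p) -/(y p).
have Ey : y p = x p + y' p by [].
have y'S : y' p = y2 p + y3 p by [].
have y2E : g0 (e p) (Ga (x p) (y2 p)) = - 2^-1 * g0 (e p) (Ga (x p) (Ga (x p) (x p))).
  by rewrite /y2 /phi2 jGaZr jgZr.
have y'E : g0 (e p) (y' p) = - 2^-1 * g0 (e p) (Ga (x p) (x p)) + 6^-1 * (2 *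
    g0 (e p) (Ga (x p) (Ga (x p) (x p))) - g0 (e p) (G (x p) (x p) (x p))) + g0 (e p) (eps p).
  by rewrite /y' /y2 /y3 /phi2 /phi3 !(jgDr, jgZr, jgNr) addrA.
rewrite /E; clearbody y y' y3 y2.
have QE : jQ J (y p) (e p) = jQ J (x p) (e p)
    + (2 * jF J (e p) (x p) (y' p) + jF J (e p) (y' p) (y' p)).
  rewrite !jQ_F Ey !jF_D !jF_Dr (jF_sym _ _ (y' p)); ring.
have G1 : g0 (e p) (G (y p) (y p) (y p)) = g0 (e p) (G (x p) (x p) (x p)) +
    (g0 (e p) (G (y' p) (y p) (y p)) + g0 (e p) (G (x p) (y' p) (y p))
      + g0 (e p) (G (x p) (x p) (y' p))).
  rewrite {1}Ey (jGD1 J) jgDr {1}Ey (jGD J) jgDr {1}Ey jGDr jgDr; ring.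
have Ga1 : g0 (e p) (Ga (y p) (Ga (y p) (y p))) = g0 (e p) (Ga (x p) (Ga (x p) (x p))) +
    (g0 (e p) (Ga (y' p) (Ga (y p) (y p)))
      + g0 (e p) (Ga (x p) (Ga (y' p) (y p))) + g0 (e p) (Ga (x p) (Ga (x p) (y' p)))).
  rewrite {1}Ey (jGaD J) jgDr {1}Ey (jGaD J) jGaDr jgDr {1}Ey jGaDr jGaDr jgDr; ring.
have Ga2 : g0 (e p) (Ga (y p) (y p)) = g0 (e p) (Ga (x p) (x p)) + 2 * g0 (e p) (Ga (x p) (y2 p))
   + 2 * g0 (e p) (Ga (x p) (y3 p)) + g0 (e p) (Ga (y' p) (y' p)).
  have -> : g0 (e p) (Ga (x p) (y2 p)) = g0 (e p) (Ga (x p) (y' p)) - g0 (e p) (Ga (x p) (y3 p)).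
    by rewrite y'S jGaDr jgDr addrK.
  rewrite Ey (jGaD J) !jGaDr (jGaC J (y' p) (x p)) !jgDr; ring.
rewrite /cal /psi !(jgDr, jgZr) G1 Ga1 Ga2 QE y2E.
have -> : g0 (e p) (y p) = g0 (e p) (x p) + g0 (e p) (y' p) by rewrite Ey jgDr.
rewrite y'E; lra.
Qed.
End JetFamilies.

(** * Third order expansion of geodesics *)

Section GeodesicJet.
Context {R : realType} {n : nat} (J : jet R n).
Local Notation V := 'rV[R]_n.
Local Notation Ga := (jGa J).
Local Notation G := (jG J).

Lemma is_derive_powc (c : V) (k : nat) (t : R) :
  is_derive t 1 (fun s : R => s ^+ k.+1 *: c) ((k.+1%:R * t ^+ k) *: c).
Proof.
apply/is_derive_rv => a; rewrite mxE.
rewrite (_ : (fun s => _) = c 0 a \*: (fun s : R => s ^+ k.+1)); last first.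
  by apply/funext => s; rewrite mxE mulrC.
rewrite (_ : _ * c 0 a = c 0 a *: 'D_1 ((@GRing.exp R) ^~ k.+1) t); last first.
  by rewrite exp_derive /GRing.scale /= mulr1 mulrC.
by apply: is_deriveZ; split => //; exact: exprn_derivable.
Qed.

Lemma is_derive_affine (x u : V) (t : R) : is_derive t 1 (fun s : R => x + s *: u) u.
Proof.
have := is_derive_powc u 0 t; rewrite expr0 mulr1 scale1r => ud.
have := is_deriveD (is_derive_cst x t 1) ud; rewrite add0r.
by under eq_fun do rewrite expr1.
Qed.

(** The time is one of the parameters, so that the bound on the derivative is uniform in it;
    integrating over a time at most 1 keeps the order. *)
Lemma bo_integral (Q : Type) (D0 : set Q) (m0 : Q -> R) k (X X' : Q -> R -> V) :
  (forall q, D0 q -> 0 <= m0 q) ->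
  (forall q (t : R), D0 q -> 0 <= t <= 1 -> is_derive t 1 (X q) (X' q t)) ->
  (forall q, D0 q -> X q 0 = 0) ->
  bo (fun p : Q * R => D0 p.1 /\ 0 <= p.2 <= 1) (fun p => m0 p.1) k (fun p => X' p.1 p.2) ->
  bo (fun p : Q * R => D0 p.1 /\ 0 <= p.2 <= 1) (fun p => m0 p.1) k (fun p => X p.1 p.2).
Proof.
move=> m0_ge XX' X0 [C C0 HC]; exists C => // -[q t] /= [Dq /andP[t0 t1]].
have mk0 : 0 <= C * m0 q ^+ k by rewrite mulr_ge0// exprn_ge0// m0_ge.
apply: rv_norm_le => // a.
have : `|X q t 0 a - X q 0 0 a| <= C * m0 q ^+ k * (t - 0).
  apply: (@mvt_bound _ (fun s => X q s 0 a) (fun s => X' q s 0 a)) => // s /andP[s0 st].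
    by apply: (is_derive_rv _ _ _ _).2; apply: XX' => //; rewrite s0 (le_trans st).
  apply: le_trans (rv_coord_le _ _) _; apply: (HC (q, s)); split => //=.
  by rewrite s0 (le_trans st).
by rewrite X0// mxE !subr0 => /le_trans; apply; rewrite ler_piMr.
Qed.

(** A bootstrap on the order. The geodesic equation is quadratic in the velocity, so an
    approximation of position and velocity, put back into the equation and integrated, yields a
    velocity correct to one order more. Integrating the last one and setting t = 1 gives the
    coefficients of [phi2] and [phi3]. *)
Lemma geodesic_jet (Gx : V -> V -> V -> V) (C r : R) : 0 <= C -> 0 < r ->
  (forall y u w, `|y| <= r -> `|Gx y u w - Ga u w - G y u w| <= C * `|y| ^+ 2 * `|u| * `|w|) ->
  exists2 C', 0 <= C' & forall (xi : V) (y v : R -> V), `|xi| <= 1 -> 2 * `|xi| <= r ->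
    y 0 = 0 -> v 0 = xi ->
    (forall t : R, 0 <= t <= 1 -> is_derive t 1 y (v t)) ->
    (forall t : R, 0 <= t <= 1 -> is_derive t 1 v (- Gx (y t) (v t) (v t))) ->
    (forall t : R, 0 <= t <= 1 -> `|y t| <= 2 * `|xi| /\ `|v t| <= 2 * `|xi|) ->
    `|y 1 - (xi + (phi2 J xi + phi3 J xi))| <= C' * `|xi| ^+ 4.
Proof.
move=> C0 r0 GxT.
(* A parameter is a whole geodesic, recorded as its initial velocity, position and velocity; this
   makes the final constant common to all geodesics. *)
pose Q := (V * (R -> V) * (R -> V))%type.
pose xi_ (q : Q) := q.1.1; pose y_ (q : Q) := q.1.2; pose v_ (q : Q) := q.2.
pose D0 (q : Q) := [/\ `|xi_ q| <= 1, 2 * `|xi_ q| <= r, y_ q 0 = 0 /\ v_ q 0 = xi_ q,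
  (forall t : R, 0 <= t <= 1 -> is_derive t 1 (y_ q) (v_ q t)) /\
  (forall t : R, 0 <= t <= 1 -> is_derive t 1 (v_ q) (- Gx (y_ q t) (v_ q t) (v_ q t))) &
  (forall t : R, 0 <= t <= 1 -> `|y_ q t| <= 2 * `|xi_ q| /\ `|v_ q t| <= 2 * `|xi_ q|)].
pose D (p : Q * R) := D0 p.1 /\ 0 <= p.2 <= 1.
pose m0 (q : Q) := `|xi_ q|; pose m (p : Q * R) := m0 p.1.
have m01 p : D p -> 0 <= m p <= 1 by move=> [[? _ _ _ _] _]; rewrite /m /m0 normr_ge0.
have m0ge q : D0 q -> 0 <= m0 q by move=> _; rewrite /m0.
pose x (p : Q * R) := xi_ p.1; pose y (p : Q * R) := y_ p.1 p.2.
pose v (p : Q * R) := v_ p.1 p.2; pose t (p : Q * R) := p.2.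
have hx : bo D m 1 x by exists 1 => // p _; rewrite mul1r expr1.
have hy : bo D m 1 y by exists 2 => // -[q s] [[_ _ _ _ H] s01]; rewrite expr1; have [] := H _ s01.
have hv : bo D m 1 v by exists 2 => // -[q s] [[_ _ _ _ H] s01]; rewrite expr1; have [] := H _ s01.
have ht : bo D m 0 t.
  by apply: bo_le1 => -[q s] [_ /= /andP[s0 s1]]; rewrite ger0_norm.
pose rem p := Gx (y p) (v p) (v p) - Ga (v p) (v p) - G (y p) (v p) (v p).
have hrem : bo D m 4 rem.
  have [Cy Cy0 Hy] := hy; have [Cv Cv0 Hv] := hv.
  exists (C * Cy ^+ 2 * Cv * Cv); first by rewrite !mulr_ge0 ?sqr_ge0.
  move=> p Dp; have yr : `|y p| <= r.
    by case: p Dp => q s [[_ xr _ _ H] s01]; have [+ _] := H _ s01; move=> /le_trans; apply.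
  apply: le_trans (GxT _ _ _ yr) _.
  have := Hy _ Dp; have := Hv _ Dp; rewrite !expr1 => h1 h2.
  rewrite (_ : _ * m p ^+ 4 = C * (Cy * m p) ^+ 2 * (Cv * m p) * (Cv * m p)); last by ring.
  rewrite !ler_pM ?mulr_ge0 ?sqr_ge0//.

have GxE p : Gx (y p) (v p) (v p) = rem p + Ga (v p) (v p) + G (y p) (v p) (v p).
  by rewrite /rem; apply/rowP => i; rewrite !mxE; ring.
have dy q (s : R) : D0 q -> 0 <= s <= 1 -> is_derive s 1 (y_ q) (v_ q s).
  by move=> [_ _ _ [H _] _]; exact: H.
have dv q (s : R) : D0 q -> 0 <= s <= 1 -> is_derive s 1 (v_ q) (- Gx (y_ q s) (v_ q s) (v_ q s)).
  by move=> [_ _ _ [_ H] _]; exact: H.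
have ha : bo D m 2 (fun p => v p - x p).
  apply: (@bo_integral _ D0 m0 2 (fun q s => v_ q s - xi_ q) (fun q s => - Gx (y_ q s) (v_ q s) (v_ q s))) => //.
  - move=> q s Dq s01; rewrite -[- Gx _ _ _]subr0; apply: is_deriveB; exact: dv.
  - by move=> q [_ _ [_ ->] _ _]; rewrite subrr.
  - apply: bo_eq => [p _|]; first by rewrite -/(y p) -/(v p) GxE.
    by bo_tac m01.
have hb : bo D m 2 (fun p => y p - t p *: x p).
  apply: (@bo_integral _ D0 m0 2 (fun q s => y_ q s - s *: xi_ q) (fun q s => v_ q s - xi_ q)) => //.
  - move=> q s Dq s01; apply: is_deriveB; first exact: dy.
    by apply: is_derive_eq; [exact: (is_derive_powc _ 0)|rewrite expr0 mulr1 scale1r].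
  - by move=> q [_ _ [-> _] _ _]; rewrite scale0r subrr.
have hc : bo D m 3 (fun p => v p - x p + t p *: Ga (x p) (x p)).
  apply: (@bo_integral _ D0 m0 3 (fun q s => v_ q s - xi_ q + s ^+ 1 *: Ga (xi_ q) (xi_ q))
    (fun q s => - Gx (y_ q s) (v_ q s) (v_ q s) + Ga (xi_ q) (xi_ q))) => //.
  - move=> q s Dq s01; apply: is_deriveD.
      by rewrite -[- Gx _ _ _]subr0; apply: is_deriveB; exact: dv.
    by apply: is_derive_eq; [exact: (is_derive_powc _ 0)|rewrite expr0 mulr1 scale1r].
  - by move=> q [_ _ [_ ->] _ _]; rewrite expr1 scale0r subrr addr0.
  - apply: (@bo_eq _ _ D m _ 3 (fun p => - rem p - Ga (v p - x p) (v p) - Ga (x p) (v p - x p)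
        - G (y p) (v p) (v p))) => [p _|]; last by bo_tac m01.
    rewrite -/(y p) -/(v p) -/(x p) GxE.
    have -> : Ga (v p - x p) (v p) = Ga (v p) (v p) - Ga (x p) (v p).
      by rewrite (jGaD J) -scaleN1r (jGaZ J) scaleN1r.
    have -> : Ga (x p) (v p - x p) = Ga (x p) (v p) - Ga (x p) (x p).
      by rewrite (jGaDr J) -scaleN1r (jGaZr J) scaleN1r.
    by apply/rowP => i; rewrite !mxE; ring.
pose GG p := Ga (x p) (Ga (x p) (x p)).
have hd : bo D m 4 (fun p => v p - x p + t p *: Ga (x p) (x p)
    + t p ^+ 2 *: (2^-1 *: G (x p) (x p) (x p) - GG p)).
  apply: (@bo_integral _ D0 m0 4 (fun q s => v_ q s - xi_ q + s ^+ 1 *: Ga (xi_ q) (xi_ q)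
      + s ^+ 2 *: (2^-1 *: G (xi_ q) (xi_ q) (xi_ q) - Ga (xi_ q) (Ga (xi_ q) (xi_ q))))
    (fun q s => - Gx (y_ q s) (v_ q s) (v_ q s) + Ga (xi_ q) (xi_ q)
      + (2 * s) *: (2^-1 *: G (xi_ q) (xi_ q) (xi_ q) - Ga (xi_ q) (Ga (xi_ q) (xi_ q))))) => //.
  - move=> q s Dq s01; apply: is_deriveD.
      apply: is_deriveD.
        by rewrite -[- Gx _ _ _]subr0; apply: is_deriveB; exact: dv.
      by apply: is_derive_eq; [exact: (is_derive_powc _ 0)|rewrite expr0 mulr1 scale1r].
    by apply: is_derive_eq; [exact: (is_derive_powc _ 1)|rewrite expr1].
  - by move=> q [_ _ [_ ->] _ _]; rewrite expr1 expr0n /= !scale0r subrr !addr0.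
  - pose c p := v p - x p + t p *: Ga (x p) (x p).
    pose a p := v p - x p; pose b p := y p - t p *: x p.
    have ha' : bo D m 2 a by []. have hb' : bo D m 2 b by []. have hc' : bo D m 3 c by [].
    apply: (@bo_eq _ _ D m _ 4 (fun p => - rem p - 2 *: Ga (x p) (c p) - Ga (a p) (a p)
        - G (b p) (v p) (v p) - t p *: G (x p) (a p) (v p) - t p *: G (x p) (x p) (a p))) => [p _|].
      rewrite -/(y p) -/(v p) -/(x p) -/(t p) GxE.
      have vE : v p = x p + a p by rewrite /a addrC subrK.
      have yE : y p = t p *: x p + b p by rewrite /b addrC subrK.
      have aE : a p = c p - t p *: Ga (x p) (x p) by rewrite /c addrK.
      clearbody a b c.
      have -> : Ga (v p) (v p) = Ga (x p) (x p) + 2 *: Ga (x p) (c p) - (2 * t p) *: GG p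
         + Ga (a p) (a p).
        rewrite {1 2}vE (jGaD J) !(jGaDr J) (jGaC J (a p) (x p)).
        have -> : Ga (x p) (a p) = Ga (x p) (c p) - t p *: GG p.
          by rewrite {1}aE (jGaDr J) -scaleNr (jGaZr J) scaleNr.
        by apply/rowP => i; rewrite !mxE; ring.
      have -> : G (y p) (v p) (v p) = t p *: (G (x p) (x p) (x p) + G (x p) (x p) (a p)
          + G (x p) (a p) (v p)) + G (b p) (v p) (v p).
        rewrite {1}yE (jGD1 J) (jGZ1 J); congr (_ *: _ + _).
        by rewrite {1}vE (jGD J) {1}vE (jGDr J).
      rewrite -/(GG p); apply/rowP => i; rewrite !mxE; lra.
    have ht1 k h : bo D m k h -> bo D m k (fun p => t p *: h p) by move=> /(boZ ht).
    by bo_tac m01.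
have : bo D m 4 (fun p => y p - t p *: x p + t p ^+ 2 *: (2^-1 *: Ga (x p) (x p))
    + t p ^+ 3 *: (3^-1 *: (2^-1 *: G (x p) (x p) (x p) - GG p))).
  apply: (@bo_integral _ D0 m0 4 (fun q s => y_ q s - s ^+ 1 *: xi_ q
      + s ^+ 2 *: (2^-1 *: Ga (xi_ q) (xi_ q))
      + s ^+ 3 *: (3^-1 *: (2^-1 *: G (xi_ q) (xi_ q) (xi_ q) - Ga (xi_ q) (Ga (xi_ q) (xi_ q)))))
    (fun q s => v_ q s - xi_ q + s *: Ga (xi_ q) (xi_ q)
      + s ^+ 2 *: (2^-1 *: G (xi_ q) (xi_ q) (xi_ q) - Ga (xi_ q) (Ga (xi_ q) (xi_ q))))) => //.
  - move=> q s Dq s01; apply: is_derive_eq.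
      apply: is_deriveD; last exact: is_derive_powc.
      apply: is_deriveD; last exact: is_derive_powc.
      by apply: is_deriveB; [exact: dy|exact: is_derive_powc].
    by apply/rowP => i; rewrite !mxE; field.
  - by move=> q [_ _ [-> _] _ _]; rewrite !expr0n /= !scale0r subrr !addr0.
move=> [C' C'0 HC']; exists C' => // xi y1 v1 h1 h2 h3 h4 h5 h6 h7.
have := HC' ((xi, y1, v1), 1); rewrite /m /y /x /t /GG /xi_ /y_ /v_ /m0 /=.
rewrite [X in `|X| <= _](_ : _ = y1 1 - (xi + (phi2 J xi + phi3 J xi))).
  by apply; split=> //=; rewrite ler01 lexx.
by rewrite /phi2 /phi3; apply/rowP => i; rewrite !mxE; field.
Qed.
End GeodesicJet.

(** * Metrics on open sets of R^n *)

Section BilinearForms.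
Context {R : realType} {n : nat}.
Local Notation V := 'rV[R]_n.
Implicit Types (A : 'I_n -> 'I_n -> R) (u w : V).

Definition bf A u w : R := \sum_a \sum_b A a b * u 0 a * w 0 b.

Lemma eq_bf A A' u w : (forall a b, A a b = A' a b) -> bf A u w = bf A' u w.
Proof. by move=> E; apply: eq_bigr => a _; apply: eq_bigr => b _; rewrite E. Qed.

Lemma bfD A u u' w : bf A (u + u') w = bf A u w + bf A u' w.
Proof.
rewrite /bf -big_split; apply: eq_bigr => a _; rewrite -big_split; apply: eq_bigr => b _.
by rewrite mxE /=; ring.
Qed.

Lemma bfZ A c u w : bf A (c *: u) w = c * bf A u w.
Proof.
rewrite /bf mulr_sumr; apply: eq_bigr => a _; rewrite mulr_sumr; apply: eq_bigr => b _.
by rewrite mxE; ring.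
Qed.

Lemma bfZr A c u w : bf A u (c *: w) = c * bf A u w.
Proof.
rewrite /bf mulr_sumr; apply: eq_bigr => a _; rewrite mulr_sumr; apply: eq_bigr => b _.
by rewrite mxE; ring.
Qed.

Lemma bf0l A w : bf A 0 w = 0.
Proof. by rewrite -(scale0r (0 : V)) bfZ mul0r. Qed.

Lemma bf0r A u : bf A u 0 = 0.
Proof. by apply: big1 => a _; apply: big1 => b _; rewrite mxE mulr0. Qed.

Lemma bfC A u w : (forall a b, A a b = A b a) -> bf A u w = bf A w u.
Proof.
move=> AC; rewrite /bf exchange_big; apply: eq_bigr => a _; apply: eq_bigr => b _.
by rewrite (AC b a); ring.
Qed.

Lemma bfDA A A' u w : bf (fun a b => A a b + A' a b) u w = bf A u w + bf A' u w.
Proof.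
rewrite /bf -big_split; apply: eq_bigr => a _; rewrite -big_split; apply: eq_bigr => b _.
by rewrite /=; ring.
Qed.

Lemma bfZA A c u w : bf (fun a b => c * A a b) u w = c * bf A u w.
Proof.
rewrite /bf mulr_sumr; apply: eq_bigr => a _; rewrite mulr_sumr; apply: eq_bigr => b _; ring.
Qed.

Lemma bfNA A u w : bf (fun a b => - A a b) u w = - bf A u w.
Proof. by rewrite -mulN1r -bfZA; apply: eq_bf => a b; rewrite mulN1r. Qed.

Lemma bf_le A (K : 'I_n -> 'I_n -> R) s u w : (forall a b, `|A a b| <= K a b * s) ->
  `|bf A u w| <= (\sum_a \sum_b K a b) * s * `|u| * `|w|.
Proof.
move=> AK; rewrite !mulr_suml; apply: le_trans (ler_norm_sum _ _ _) _; apply: ler_sum => a _.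
rewrite !mulr_suml; apply: le_trans (ler_norm_sum _ _ _) _; apply: ler_sum => b _.
rewrite !normrM !ler_pM ?mulr_ge0 ?rv_coord_le//; exact: AK.
Qed.

Lemma bf_continuous A : continuous (fun u => bf A u u).
Proof.
move=> u; apply: for_continuous_sum => a; apply: for_continuous_sum => b.
apply: (@continuousM _ _ (fun u : V => A a b * u 0 a) (fun u : V => u 0 b)).
  apply: (@continuousM _ _ (fun=> A a b) (fun u : V => u 0 a)); first exact: cst_continuous.
  exact: coord_continuous.
exact: coord_continuous.
Qed.

Lemma is_deriveMf (W : normedModType R) (f g : W -> R) x v df dg :
  is_derive x v f df -> is_derive x v g dg ->
  is_derive x v (fun y => f y * g y) (df * g x + f x * dg).
Proof.
move=> fd gd; have := @is_deriveM R W f g x v df dg fd gd.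
by rewrite /GRing.scale /= addrC [g x * df]mulrC.
Qed.

Lemma is_deriveMc (W : normedModType R) (f : W -> R) (c : R) x v df :
  is_derive x v f df -> is_derive x v (fun y => c * f y) (c * df).
Proof. by move=> fd; have := @is_deriveZ R W _ f c x v df fd. Qed.

Lemma is_derive_bf (W : normedModType R) (A : W -> 'I_n -> 'I_n -> R) (c d : W -> V) x v dA dc dd :
  (forall a b, is_derive x v (fun y => A y a b) (dA a b)) ->
  is_derive x v c dc -> is_derive x v d dd ->
  is_derive x v (fun y => bf (A y) (c y) (d y))
    (bf dA (c x) (d x) + bf (A x) dc (d x) + bf (A x) (c x) dd).
Proof.
move=> Ad cd ddd; rewrite /bf -!big_split; apply: is_derive_sumf => a /=.
rewrite -!big_split; apply: is_derive_sumf => b /=.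
have ca : is_derive x v (fun y => c y 0 a) (dc 0 a) by apply: (is_derive_rv _ _ _ _).2.
have db : is_derive x v (fun y => d y 0 b) (dd 0 b) by apply: (is_derive_rv _ _ _ _).2.
have := is_deriveMf (is_deriveMf (Ad a b) ca) db.
rewrite [X in is_derive _ _ _ X](_ : _ = dA a b * c x 0 a * d x 0 b + A x a b * dc 0 a * d x 0 b +
     A x a b * c x 0 a * dd 0 b) //; ring.
Qed.

Lemma is_derive_bfl (W : normedModType R) (A : W -> 'I_n -> 'I_n -> R) u w (x v : W) dA :
  (forall a b, is_derive x v (fun y => A y a b) (dA a b)) ->
  is_derive x v (fun y => bf (A y) u w) (bf dA u w).
Proof.
move=> Ad; have := is_derive_bf Ad (is_derive_cst u x v) (is_derive_cst w x v).
by rewrite (bf0l _ w) (bf0r _ u) !addr0.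
Qed.

Lemma is_derive_unique (W W' : normedModType R) (f : W -> W') x v d d' :
  is_derive x v f d -> is_derive x v f d' -> d = d'.
Proof. by move=> [_ <-] [_ <-]. Qed.

Lemma dir_le_sum (f : V -> R) x y : `|dir f x y| <= (\sum_a `|partial a f x|) * `|y|.
Proof.
rewrite /dir mulr_suml; apply: le_trans (ler_norm_sum _ _ _) _; apply: ler_sum => a _.
by rewrite normrM mulrC ler_pM// rv_coord_le.
Qed.

Lemma dir2_le_sum (f : V -> R) x y z :
  `|dir2 f x y z| <= (\sum_a \sum_b `|partial b (partial a f) x|) * (`|y| * `|z|).
Proof.
rewrite /dir2 mulr_suml; apply: le_trans (ler_norm_sum _ _ _) _; apply: ler_sum => a _.
rewrite normrM mulrCA ler_pM//; first exact: rv_coord_le.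
exact: dir_le_sum.
Qed.

Lemma dir2C (U : set V) (f : V -> R) x y z : open U -> U x -> Ck 3 U f ->
  dir2 f x y z = dir2 f x z y.
Proof.
move=> Uo Ux fk; rewrite /dir2 /dir.
under eq_bigr do rewrite mulr_sumr.
under [RHS]eq_bigr do rewrite mulr_sumr.
rewrite exchange_big; apply: eq_bigr => a _; apply: eq_bigr => b _.
by rewrite (Schwarz_sym b a Uo Ux fk); ring.
Qed.

Lemma dir2D (f : V -> R) x y y' z : dir2 f x (y + y') z = dir2 f x y z + dir2 f x y' z.
Proof.
by rewrite /dir2 -big_split; apply: eq_bigr => a _; rewrite mxE /=; ring.
Qed.

Lemma dir2Z (f : V -> R) x c y z : dir2 f x (c *: y) z = c * dir2 f x y z.
Proof.
by rewrite /dir2 mulr_sumr; apply: eq_bigr => a _; rewrite mxE /=; ring.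
Qed.

Lemma derive_dir (U : set V) (f : V -> R) x u y : open U -> U x -> Ck 2 U f ->
  is_derive x y (fun x => dir f x u) (dir2 f x u y).
Proof.
move=> Uo Ux fk; apply: is_derive_sumf => a.
by apply: is_deriveMc; exact: (Ck_derive y Uo (Ck_partial a fk) Ux).
Qed.

Lemma exists_norm1 (u : V) : u != 0 -> `| (`|u|)^-1 *: u | = 1.
Proof. by move=> u0; rewrite normrZ normfV normr_id mulVf// normr_eq0. Qed.

Lemma posdef_min A : (forall u, u != 0 -> 0 < bf A u u) ->
  exists2 c, 0 < c & forall u, c * `|u| ^+ 2 <= bf A u u.
Proof.
move=> Apos; pose S : set V := [set u | `|u| = 1].
(* The unit sphere is empty when n = 0; the only vector is then 0 and the constant 1 serves. *)
have [[u1 Su1]|S0] := pselect (S !=set0); last first.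
  exists 1 => // u; have [->|u0] := eqVneq u 0.
    by rewrite normr0 expr0n /= mulr0 bf0l.
  by exfalso; apply: S0; exists (`|u|^-1 *: u); exact: exists_norm1.
have cS : compact S.
  apply: bounded_closed_compact.
    by exists 1; split => // M M1 u; rewrite /S /= => ->; exact: ltW.
  apply: (@closed_comp _ _ (fun u : V => `|u|) [set 1]); last exact: closed_eq.
  by move=> u _; exact: norm_continuous.
have [c Sc cmin] := @EVT_min_rV R n (fun u => bf A u u) S (ex_intro _ u1 Su1) cS
  (continuous_subspaceT (bf_continuous (A := A))).
exists (bf A c c).
  apply: Apos; apply: contraTneq (isT) => c0; move: Sc; rewrite inE /S /= c0 normr0 => /esym/eqP.
  by rewrite oner_eq0.
move=> u; have [->|u0] := eqVneq u 0.
  by rewrite normr0 expr0n /= mulr0 bf0l.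
have := cmin (`|u|^-1 *: u); rewrite inE => /(_ (exists_norm1 u0)).
rewrite bfZ (_ : bf A u _ = `|u|^-1 * bf A u u); last first.
  rewrite /bf mulr_sumr; apply: eq_bigr => a _; rewrite mulr_sumr; apply: eq_bigr => b _.
  by rewrite mxE; ring.
rewrite mulrA -invfM -expr2 mulrC ler_pdivlMr// exprn_gt0// normr_gt0//.
Qed.

Lemma fin_unif_pair (I : finType) (h : I -> V -> V -> R) (G : V -> V -> R) :
  (forall y y', 0 <= G y y') ->
  (forall i, exists r C, [/\ 0 < r, 0 <= C & forall y y', `|y| < r -> `|y'| < r ->
     h i y y' <= C * G y y']) ->
  exists r C, [/\ 0 < r, 0 <= C & forall i y y', `|y| < r -> `|y'| < r ->
     h i y y' <= C * G y y'].
Proof.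
move=> G0 H; have [r rP] := choice H; have [C CP] := choice rP.
have FF : Filter (nbhs (0 : V)) := nbhs_filter _.
have : \forall y \near (0 : V), forall i, `|y| < r i.
  apply: (@filter_forall _ _ (fun i (y : V) => `|y| < r i) (nbhs (0 : V)) FF) => i.
  by have [ri _ _] := CP i; apply: (ball_near0 ri).
move=> /near0_ball[s s0 Hs]; exists s, (\sum_i C i); split => //.
  by apply: sumr_ge0 => i _; have [] := CP i.
move=> i y y' ys y's; have [_ Ci CPi] := CP i.
apply: le_trans (CPi y y' (Hs _ ys i) (Hs _ y's i)) _.
rewrite ler_wpM2r// (bigD1 i)//= lerDl; apply: sumr_ge0 => j _; by have [] := CP j.
Qed.
End BilinearForms.

(** * Christoffel symbols and Taylor expansions of a metric on an open set *)

Section LocalMetric.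
Context {R : realType} {n : nat}.
Local Notation V := 'rV[R]_n.
Variables (U : set V) (gr : V -> 'M[R]_n).
Hypotheses (Uo : open U)
  (grC : forall x, U x -> forall a b, gr x a b = gr x b a)
  (gr_pos : forall x, U x -> forall u, u != 0 -> 0 < bf (gr x) u u)
  (gr_k : forall k a b, Ck k U (fun x => gr x a b)).

(** The body of [christoffel] for an arbitrary field of Gram matrices: for [gram g i] the two are
    convertible. *)
Definition chr (k a b : 'I_n) (x : V) : R :=
  2^-1 * \sum_(l < n) invmx (gr x) k l *
    (partial a (fun y => gr y b l) x + partial b (fun y => gr y a l) x
     - partial l (fun y => gr y a b) x).

Definition Gax (x u w : V) : V := \row_k bf (fun a b => chr k a b x) u w.

Lemma gr_unit x : U x -> gr x \in unitmx.
Proof.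
move=> Ux; rewrite unitmxE unitfE; apply/negP => /det0P[u u0 ug].
have := gr_pos Ux u0; rewrite (_ : bf _ _ _ = (u *m gr x *m u^T) 0 0).
  by rewrite ug mul0mx mxE ltxx.
rewrite mxE /bf exchange_big; apply: eq_bigr => b _.
by rewrite !mxE mulr_suml; apply: eq_bigr => a _; rewrite [gr x a b * _]mulrC.
Qed.

Lemma chr_Ck k a b j : Ck j U (chr k a b).
Proof.
apply: CkZ => //; apply: Ck_sum => // l; apply: CkM => //.
  by apply: Ck_invmx => //; exact: gr_unit.
apply: CkB => //; first apply: CkD => //; exact: Ck_partial (gr_k _ _ _).
Qed.

Lemma partial_grC c a b x : U x -> partial c (fun y => gr y a b) x = partial c (fun y => gr y b a) x.
Proof. by move=> Ux; exact: (eq_partial c Uo (fun y Uy => grC Uy a b) Ux). Qed.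

Lemma chrC k a b x : U x -> chr k a b x = chr k b a x.
Proof.
move=> Ux; rewrite /chr; congr (_ * _); apply: eq_bigr => l _; congr (_ * _).
by rewrite (partial_grC l a b Ux); ring.
Qed.

Lemma chr_lower a b l x : U x -> \sum_k gr x k l * chr k a b x =
  2^-1 * (partial a (fun y => gr y b l) x + partial b (fun y => gr y a l) x
     - partial l (fun y => gr y a b) x).
Proof.
move=> Ux; rewrite /chr.
pose T l := partial a (fun y => gr y b l) x + partial b (fun y => gr y a l) x
     - partial l (fun y => gr y a b) x.
under eq_bigr do rewrite mulrCA mulr_sumr.
rewrite -mulr_sumr; congr (_ * _); rewrite exchange_big /=.
rewrite (eq_bigr (fun l' => (l == l')%:R * T l')) => [|l' _].
  rewrite (bigD1 l)//= big1 ?addr0 ?eqxx ?mul1r// => l' /negbTE ll'.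
  by rewrite eq_sym ll' mul0r.
under eq_bigr do rewrite mulrA.
rewrite -mulr_suml; congr (_ * _).
have := mulmxV (gr_unit Ux) => /matrixP/(_ l l'); rewrite !mxE => <-.
by apply: eq_bigr => k _; rewrite (grC Ux).
Qed.

Definition tri (T : 'I_n -> 'I_n -> 'I_n -> R) (u w l : V) : R :=
  \sum_a \sum_b \sum_c T a b c * u 0 a * w 0 b * l 0 c.

(** The Koszul formula for constant fields. It holds at all points of U, so that it can be
    differentiated in x. *)
Lemma Gax_lower x u w l : U x -> bf (gr x) (Gax x u w) l =
  2^-1 * (bf (fun a b => dir (fun y => gr y a b) x u) w l
    + bf (fun a b => dir (fun y => gr y a b) x w) u l
    - bf (fun a b => dir (fun y => gr y a b) x l) u w).
Proof.
move=> Ux; transitivity (tri (fun a b c => \sum_k gr x k c * chr k a b x) u w l).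
  transitivity (\sum_k \sum_c \sum_a \sum_b (gr x k c * chr k a b x) * u 0 a * w 0 b * l 0 c).
    apply: eq_bigr => k _; apply: eq_bigr => c _; rewrite mxE mulr_sumr mulr_suml.
    apply: eq_bigr => a _; rewrite mulr_sumr mulr_suml; apply: eq_bigr => b _; ring.
  rewrite exchange_big /=; under eq_bigr do rewrite exchange_big /=.
  under eq_bigr do under eq_bigr do rewrite exchange_big /=.
  rewrite exchange_big /=; apply: eq_bigr => a _; rewrite exchange_big /=.
  apply: eq_bigr => b _; apply: eq_bigr => c _.
  by rewrite !mulr_suml.
have -> : bf (fun a b => dir (fun y => gr y a b) x u) w l =
    tri (fun a b c => partial a (fun y => gr y b c) x) u w l.
  rewrite /tri exchange_big; apply: eq_bigr => b _ /=.
  rewrite exchange_big; apply: eq_bigr => c _ /=; rewrite /dir !mulr_suml.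
  by apply: eq_bigr => a _; ring.
have -> : bf (fun a b => dir (fun y => gr y a b) x w) u l =
    tri (fun a b c => partial b (fun y => gr y a c) x) u w l.
  apply: eq_bigr => a _ /=; rewrite exchange_big; apply: eq_bigr => c _ /=.
  by rewrite /dir !mulr_suml; apply: eq_bigr => b _; ring.
have -> : bf (fun a b => dir (fun y => gr y a b) x l) u w =
    tri (fun a b c => partial c (fun y => gr y a b) x) u w l.
  apply: eq_bigr => a _ /=; apply: eq_bigr => b _ /=.
  by rewrite /dir !mulr_suml; apply: eq_bigr => c _; ring.
rewrite /tri -big_split -sumrB mulr_sumr; apply: eq_bigr => a _ /=.
rewrite -big_split -sumrB mulr_sumr; apply: eq_bigr => b _ /=.
rewrite -big_split -sumrB mulr_sumr; apply: eq_bigr => c _ /=.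
by rewrite chr_lower//; ring.
Qed.

Section AtPoint.
Variables (x0 : V) (Ux0 : U x0).

Definition tg (u w : V) : R := bf (gr x0) u w.
Definition tB (y u w : V) : R := bf (fun a b => dir (fun x => gr x a b) x0 y) u w.
Definition tH (y z u w : V) : R := bf (fun a b => dir2 (fun x => gr x a b) x0 y z) u w.
Definition tGa (u w : V) : V := Gax x0 u w.
Definition tG (y u w : V) : V := \row_k bf (fun a b => dir (chr k a b) x0 y) u w.

Lemma dir_grC y a b : dir (fun x => gr x a b) x0 y = dir (fun x => gr x b a) x0 y.
Proof. by apply: eq_bigr => c _; rewrite partial_grC. Qed.

Lemma dir2_grC y z a b : dir2 (fun x => gr x a b) x0 y z = dir2 (fun x => gr x b a) x0 y z.
Proof.
have E c d : partial d (partial c (fun x => gr x a b)) x0 =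
    partial d (partial c (fun x => gr x b a)) x0.
  by apply: (eq_partial d Uo _ Ux0) => x Ux; exact: partial_grC.
refine (eq_bigr _ (fun c _ => congr1 (fun t => y 0 c * t) _)).
exact: (eq_bigr _ (fun d _ => congr1 (fun t => z 0 d * t) (E c d))).
Qed.

Lemma dir_chrC k y a b : dir (chr k a b) x0 y = dir (chr k b a) x0 y.
Proof.
by apply: eq_bigr => d _; rewrite (eq_partial d Uo (fun x Ux => chrC k a b Ux) Ux0).
Qed.

Lemma tHC1 y z u w : tH y z u w = tH z y u w.
Proof. by apply: eq_bf => a b; exact: (dir2C _ _ Uo Ux0 (gr_k 3 a b)). Qed.

(** Both sides are the derivative at x0 along y of the Koszul formula [Gax_lower]; the two terms on
    the left come from the product rule. *)
Lemma tG_lower y u w l : tg (tG y u w) l + tB y (tGa u w) l =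
  2^-1 * (tH y u w l + tH y w u l - tH y l u w).
Proof.
have dgr a b z : is_derive x0 z (fun x => gr x a b) (dir (fun x => gr x a b) x0 z).
  exact: (Ck_derive z Uo (gr_k 1 a b) Ux0).
have dcst (c : V) : is_derive x0 y (fun=> c) 0 by exact: is_derive_cst.
have h1 : is_derive x0 y (fun x => bf (gr x) (Gax x u w) l)
    (tg (tG y u w) l + tB y (tGa u w) l).
  have dG : is_derive x0 y (fun x => Gax x u w) (tG y u w).
    apply/is_derive_rv => k; rewrite (_ : (fun x => _) = (fun x => bf (fun a b => chr k a b x) u w)).
      have := is_derive_bf (fun a b => Ck_derive y Uo (chr_Ck k a b 1) Ux0) (dcst u) (dcst w).
      by rewrite bf0l bf0r !addr0 mxE.
    by apply/funext => x; rewrite mxE.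
  have := is_derive_bf (fun a b => dgr a b y) dG (dcst l).
  by rewrite bf0r addr0 addrC.
have dB v p q : is_derive x0 y (fun x => bf (fun a b => dir (fun y => gr y a b) x v) p q) (tH y v p q).
  have := is_derive_bf (fun a b => derive_dir v y Uo Ux0 (gr_k 2 a b)) (dcst p) (dcst q).
  by rewrite bf0l bf0r !addr0 -/(tH v y p q) tHC1.
have h2 : is_derive x0 y (fun x => bf (gr x) (Gax x u w) l)
    (2^-1 * (tH y u w l + tH y w u l - tH y l u w)).
  apply: (@near_eq_is_derive _ _ _ (fun x => 2^-1 * (bf (fun a b => dir (fun y => gr y a b) x u) w l
    + bf (fun a b => dir (fun y => gr y a b) x w) u l
    - bf (fun a b => dir (fun y => gr y a b) x l) u w))).
    have : nbhs x0 U by apply: open_nbhs_nbhs.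
    by apply: filterS => x Ux; rewrite Gax_lower.
by case: h1 => _ <-; case: h2 => _ <-.
Qed.

Lemma local_bounds : exists K, [/\ (forall u w, `|tg u w| <= K * `|u| * `|w|),
  (forall y u w, `|tB y u w| <= K * `|y| * `|u| * `|w|),
  (forall y z u w, `|tH y z u w| <= K * `|y| * `|z| * `|u| * `|w|),
  (forall u w, `|tGa u w| <= K * `|u| * `|w|) &
  (forall y u w, `|tG y u w| <= K * `|y| * `|u| * `|w|)].
Proof.
pose K1 := \sum_a \sum_b `|gr x0 a b|.
pose K2 := \sum_a \sum_b \sum_c `|partial c (fun x => gr x a b) x0|.
pose K3 := \sum_a \sum_b \sum_c \sum_d `|partial d (partial c (fun x => gr x a b)) x0|.
pose K4 := \sum_k \sum_a \sum_b `|chr k a b x0|.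
pose K5 := \sum_k \sum_a \sum_b \sum_c `|partial c (chr k a b) x0|.
have K10 : 0 <= K1 by do 2! (apply: sumr_ge0 => ? _).
have K20 : 0 <= K2 by do 3! (apply: sumr_ge0 => ? _).
have K30 : 0 <= K3 by do 4! (apply: sumr_ge0 => ? _).
have K40 : 0 <= K4 by do 3! (apply: sumr_ge0 => ? _).
have K50 : 0 <= K5 by do 4! (apply: sumr_ge0 => ? _).
have W (k : R) (x y : R) : 0 <= y -> k <= K1 + K2 + K3 + K4 + K5 -> x <= k * y ->
    x <= (K1 + K2 + K3 + K4 + K5) * y.
  by move=> y0 kK /le_trans; apply; rewrite ler_wpM2r.
exists (K1 + K2 + K3 + K4 + K5); split.
- move=> u w; rewrite -mulrA; apply: (W K1); [by rewrite mulr_ge0|lra|].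
  have := @bf_le _ _ (gr x0) (fun a b => `|gr x0 a b|) 1 u w.
  by rewrite mulr1 -mulrA; apply => a b; rewrite mulr1.
- move=> y u w; rewrite -!mulrA; apply: (W K2); [by rewrite !mulr_ge0|lra|].
  have := @bf_le _ _ _ (fun a b => \sum_c `|partial c (fun x => gr x a b) x0|) `|y| u w.
  by rewrite -!mulrA; apply => a b; exact: dir_le_sum.
- move=> y z u w; rewrite -!mulrA; apply: (W K3); [by rewrite !mulr_ge0|lra|].
  have := @bf_le _ _ _ (fun a b => \sum_c \sum_d `|partial d (partial c (fun x => gr x a b)) x0|)
    (`|y| * `|z|) u w.
  by rewrite -!mulrA; apply => a b; exact: dir2_le_sum.
- move=> u w; rewrite -mulrA; apply: (W K4); [by rewrite mulr_ge0|lra|].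
  apply: rv_norm_le => [|k]; first by rewrite !mulr_ge0.
  rewrite mxE; have := @bf_le _ _ (fun a b => chr k a b x0) (fun a b => `|chr k a b x0|) 1 u w.
  rewrite mulr1 -mulrA => HK; apply: le_trans (HK _) _ => [a b|]; first by rewrite mulr1.
  rewrite ler_wpM2r ?mulr_ge0// /K4 [leRHS](bigD1 k)//= lerDl.
  by do 3! (apply: sumr_ge0 => ? _).
- move=> y u w; rewrite -!mulrA; apply: (W K5); [by rewrite !mulr_ge0|lra|].
  apply: rv_norm_le => [|k]; first by rewrite !mulr_ge0.
  rewrite mxE; have := @bf_le _ _ (fun a b => dir (chr k a b) x0 y)
    (fun a b => \sum_c `|partial c (chr k a b) x0|) `|y| u w.
  rewrite -!mulrA => HK; apply: le_trans (HK _) _ => [a b|]; first exact: dir_le_sum.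
  rewrite ler_wpM2r ?mulr_ge0// /K5 [leRHS](bigD1 k)//= lerDl.
  by do 4! (apply: sumr_ge0 => ? _).
Qed.

Lemma local_jet : exists J : jet R n, [/\ jg J = tg, jB J = tB, jH J = tH, jGa J = tGa & jG J = tG].
Proof.
have [K [K1 K2 K3 K4 K5]] := local_bounds.
have [c c0 cP] := posdef_min (gr_pos Ux0).
unshelve eexists (@Jet R n tg tB tH tGa tG _ _ _ _ _ _ _ _ _ _ _ _ _ _ _ _ _ _ _ _ _ _ K K1 K2 K3 K4 K5 c c0 cP _ tG_lower).
- by move=> u w; apply: bfC; exact: grC.
- by move=> u u' w; exact: bfD.
- by move=> a u w; exact: bfZ.
- by move=> y u w; apply: bfC => a b; exact: dir_grC.
- by move=> y y' u w; rewrite -bfDA; apply: eq_bf => a b; exact: dirD.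
- by move=> a y u w; rewrite -bfZA; apply: eq_bf => i j; exact: dirZ.
- by move=> *; exact: bfD.
- by move=> *; exact: bfZ.
- by move=> y z u w; apply: bfC => a b; exact: dir2_grC.
- exact: tHC1.
- by move=> y y' z u w; rewrite -bfDA; apply: eq_bf => a b; exact: dir2D.
- by move=> a y z u w; rewrite -bfZA; apply: eq_bf => i j; exact: dir2Z.
- by move=> *; exact: bfD.
- by move=> *; exact: bfZ.
- by move=> u w; apply/rowP => k; rewrite !mxE; apply: bfC => a b; exact: chrC.
- by move=> u u' w; apply/rowP => k; rewrite !mxE; exact: bfD.
- by move=> a u w; apply/rowP => k; rewrite !mxE; exact: bfZ.
- by move=> y u w; apply/rowP => k; rewrite !mxE; apply: bfC => a b; exact: dir_chrC.
- by move=> y y' u w; apply/rowP => k; rewrite !mxE -bfDA; apply: eq_bf => a b; exact: dirD.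
- by move=> a y u w; apply/rowP => k; rewrite !mxE -bfZA; apply: eq_bf => i j; exact: dirZ.
- by move=> y u u' w; apply/rowP => k; rewrite !mxE; exact: bfD.
- by move=> a y u w; apply/rowP => k; rewrite !mxE; exact: bfZ.
- by move=> u w l; exact: Gax_lower.
by split.
Qed.

Lemma metric_taylor : exists2 C, 0 <= C & \forall y \near (0 : V), forall u w,
  `|bf (gr (x0 + y)) u w - (tg u w + tB y u w + 2^-1 * tH y y u w)|
    <= C * `|y| ^+ 3 * `|u| * `|w|.
Proof.
have [C C0 HC] : exists2 C, 0 <= C & \forall y \near (0 : V), forall ab : 'I_n * 'I_n,
    `|gr (x0 + y) ab.1 ab.2 - gr x0 ab.1 ab.2 - dir (fun x => gr x ab.1 ab.2) x0 y
      - 2^-1 * dir2 (fun x => gr x ab.1 ab.2) x0 y y| <= C * `|y| ^+ 3.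
  apply: (@fin_unif0 _ _ _ (fun ab y => `|gr (x0 + y) ab.1 ab.2 - gr x0 ab.1 ab.2
    - dir (fun x => gr x ab.1 ab.2) x0 y - 2^-1 * dir2 (fun x => gr x ab.1 ab.2) x0 y y|)
    (fun y => `|y| ^+ 3)) => [y|[a b]]; first by rewrite exprn_ge0.
  exact: (Ck3_taylor Uo Ux0 (gr_k 3 a b)).
exists (\sum_(a < n) \sum_(b < n) C); first by do 2! (apply: sumr_ge0 => ? _).
apply: filterS HC => y Hy u w.
rewrite /tg /tB /tH -bfZA -!bfDA -bfNA -bfDA.
apply: (@bf_le _ _ _ (fun _ _ => C) (`|y| ^+ 3)) => a b.
rewrite [X in `|X| <= _](_ : _ = gr (x0 + y) a b - gr x0 a b - dir (fun x => gr x a b) x0 y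
  - 2^-1 * dir2 (fun x => gr x a b) x0 y y); last by ring.
exact: (Hy (a, b)).
Qed.

Lemma christoffel_taylor : exists2 C, 0 <= C & \forall y \near (0 : V), forall u w,
  `|Gax (x0 + y) u w - tGa u w - tG y u w| <= C * `|y| ^+ 2 * `|u| * `|w|.
Proof.
have [C C0 HC] : exists2 C, 0 <= C & \forall y \near (0 : V), forall i : 'I_n * 'I_n * 'I_n,
    `|chr i.1.1 i.1.2 i.2 (x0 + y) - chr i.1.1 i.1.2 i.2 x0 - dir (chr i.1.1 i.1.2 i.2) x0 y|
      <= C * `|y| ^+ 2.
  apply: (@fin_unif0 _ _ _ (fun i y => `|chr i.1.1 i.1.2 i.2 (x0 + y) - chr i.1.1 i.1.2 i.2 x0
     - dir (chr i.1.1 i.1.2 i.2) x0 y|)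
    (fun y => `|y| ^+ 2)) => [y|[[k a] b]]; first by rewrite exprn_ge0.
  exact: (Ck2_taylor Uo Ux0 (chr_Ck k a b 2)).
have S0 : 0 <= \sum_(a < n) \sum_(b < n) C by do 2! (apply: sumr_ge0 => ? _).
exists (\sum_(a < n) \sum_(b < n) C) => //.
apply: filterS HC => y Hy u w; apply: rv_norm_le => [|k]; first by rewrite !mulr_ge0 ?exprn_ge0.
rewrite !mxE -!bfNA -!bfDA.
apply: (@bf_le _ _ _ (fun _ _ => C) (`|y| ^+ 2)) => a b.
exact: (Hy (k, a, b)).
Qed.

Lemma christoffel_lip : exists r C, [/\ 0 < r, 0 <= C &
  forall (k a b : 'I_n) y y', `|y| < r -> `|y'| < r ->
     `|chr k a b (x0 + y) - chr k a b (x0 + y')| <= C * `|y - y'|].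
Proof.
have [|i|r [C [r0 C0 H]]] := @fin_unif_pair _ _ ('I_n * 'I_n * 'I_n)%type
  (fun i y y' => `|chr i.1.1 i.1.2 i.2 (x0 + y) - chr i.1.1 i.1.2 i.2 (x0 + y')|)
  (fun y y' => `|y - y'|).
- by move=> y y'.
- exact: (Ck1_lip Uo Ux0 (chr_Ck _ _ _ 1)).
by exists r, C; split => // k a b; exact: (H (k, a, b)).
Qed.
End AtPoint.
End LocalMetric.

(** * Expansion of the metric along the exponential map *)

Section MultilinearDerivative.
Context {R : realType} {n : nat}.
Local Notation V := 'rV[R]_n.

Lemma lin_expand (f : V -> R) : (forall u u', f (u + u') = f u + f u') ->
  (forall c u, f (c *: u) = c * f u) -> forall u, f u = \sum_a u 0 a * f (basis_vec a).
Proof.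
move=> fD fZ u; rewrite {1}(row_sum_basis u).
have f0 : f 0 = 0 by rewrite -(scale0r (0 : V)) fZ mul0r.
rewrite (big_morph f fD f0); by apply: eq_bigr => a _; rewrite fZ.
Qed.

Lemma is_derive_lin (f : V -> R) : (forall u u', f (u + u') = f u + f u') ->
  (forall c u, f (c *: u) = c * f u) ->
  forall (x : R -> V) (t : R) dx, is_derive t 1 x dx -> is_derive t 1 (fun s => f (x s)) (f dx).
Proof.
move=> fD fZ x t dx xd; rewrite (_ : (fun s => _) = (fun s => \sum_a f (basis_vec a) * x s 0 a)).
  rewrite (lin_expand fD fZ dx); under eq_bigr do rewrite mulrC.
  by apply: is_derive_sumf => a; apply: is_deriveMc; apply: (is_derive_rv _ _ _ _).2.
by apply/funext => s; rewrite (lin_expand fD fZ); apply: eq_bigr => a _; rewrite mulrC.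
Qed.

Lemma is_derive_bil (f : V -> V -> R) : (forall u u' w, f (u + u') w = f u w + f u' w) ->
  (forall c u w, f (c *: u) w = c * f u w) ->
  (forall u w w', f u (w + w') = f u w + f u w') ->
  (forall c u w, f u (c *: w) = c * f u w) ->
  forall (x y : R -> V) (t : R) dx dy, is_derive t 1 x dx -> is_derive t 1 y dy ->
  is_derive t 1 (fun s => f (x s) (y s)) (f dx (y t) + f (x t) dy).
Proof.
move=> fD fZ fDr fZr x y t dx dy xd yd.
rewrite (_ : (fun s => _) = (fun s => \sum_a x s 0 a * f (basis_vec a) (y s))).
  have fyD a := is_derive_lin (fDr (basis_vec a)) (fun c => fZr c (basis_vec a)) yd.
  have xa a : is_derive t 1 (fun s => x s 0 a) (dx 0 a) by apply: (is_derive_rv _ _ _ _).2.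
  rewrite (lin_expand (fun u u' => fD u u' (y t)) (fun c u => fZ c u (y t)) dx).
  rewrite (lin_expand (fun u u' => fD u u' dy) (fun c u => fZ c u dy) (x t)) -big_split /=.
  apply: is_derive_sumf => a; exact: (is_deriveMf (xa a) (fyD a)).
apply/funext => s.
exact: (lin_expand (fun u u' => fD u u' (y s)) (fun c u => fZ c u (y s)) (x s)).
Qed.

Lemma is_derive_trilin (f : V -> V -> V -> R) :
  (forall u u' w z, f (u + u') w z = f u w z + f u' w z) ->
  (forall c u w z, f (c *: u) w z = c * f u w z) ->
  (forall u w w' z, f u (w + w') z = f u w z + f u w' z) ->
  (forall c u w z, f u (c *: w) z = c * f u w z) ->
  (forall u w z z', f u w (z + z') = f u w z + f u w z') ->
  (forall c u w z, f u w (c *: z) = c * f u w z) ->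
  forall (x y z : R -> V) (t : R) dx dy dz,
  is_derive t 1 x dx -> is_derive t 1 y dy -> is_derive t 1 z dz ->
  is_derive t 1 (fun s => f (x s) (y s) (z s))
    (f dx (y t) (z t) + (f (x t) dy (z t) + f (x t) (y t) dz)).
Proof.
move=> fD1 fZ1 fD2 fZ2 fD3 fZ3 x y z t dx dy dz xd yd zd.
rewrite (_ : (fun s => _) = (fun s => \sum_a x s 0 a * f (basis_vec a) (y s) (z s))).
  have fyD a := is_derive_bil (fD2 (basis_vec a)) (fun c => fZ2 c (basis_vec a))
    (fD3 (basis_vec a)) (fun c => fZ3 c (basis_vec a)) yd zd.
  have xa a : is_derive t 1 (fun s => x s 0 a) (dx 0 a) by apply: (is_derive_rv _ _ _ _).2.
  rewrite (lin_expand (fun u u' => fD1 u u' (y t) (z t)) (fun c u => fZ1 c u (y t) (z t)) dx).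
  rewrite (lin_expand (fun u u' => fD1 u u' dy (z t)) (fun c u => fZ1 c u dy (z t)) (x t)).
  rewrite (lin_expand (fun u u' => fD1 u u' (y t) dz) (fun c u => fZ1 c u (y t) dz) (x t)).
  rewrite -!big_split /=; apply: is_derive_sumf => a.
  rewrite -mulrDr; exact: (is_deriveMf (xa a) (fyD a)).
apply/funext => s.
exact: (lin_expand (fun u u' => fD1 u u' (y s) (z s)) (fun c u => fZ1 c u (y s) (z s)) (x s)).
Qed.

Variable J : jet R n.

Lemma is_derive_jGa (x y : R -> V) (t : R) dx dy : is_derive t 1 x dx -> is_derive t 1 y dy ->
  is_derive t 1 (fun s => jGa J (x s) (y s)) (jGa J dx (y t) + jGa J (x t) dy).
Proof.
move=> xd yd; apply/is_derive_rv => k; rewrite mxE.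
apply: (@is_derive_bil (fun u w => jGa J u w 0 k)) => //.
- by move=> *; rewrite jGaD mxE.
- by move=> *; rewrite jGaZ mxE.
- by move=> *; rewrite jGaDr mxE.
- by move=> *; rewrite jGaZr mxE.
Qed.

Lemma is_derive_jG (x y z : R -> V) (t : R) dx dy dz :
  is_derive t 1 x dx -> is_derive t 1 y dy -> is_derive t 1 z dz ->
  is_derive t 1 (fun s => jG J (x s) (y s) (z s))
    (jG J dx (y t) (z t) + (jG J (x t) dy (z t) + jG J (x t) (y t) dz)).
Proof.
move=> xd yd zd; apply/is_derive_rv => k; rewrite !mxE.
apply: (@is_derive_trilin (fun u w z => jG J u w z 0 k)) => //.
- by move=> *; rewrite jGD1 mxE.
- by move=> *; rewrite jGZ1 mxE.
- by move=> *; rewrite jGD mxE.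
- by move=> *; rewrite jGZ mxE.
- by move=> *; rewrite jGDr mxE.
- by move=> *; rewrite jGZr mxE.
Qed.

Lemma is_derive_psi (y : R -> V) (t : R) dy : is_derive t 1 y dy ->
  is_derive t 1 (fun s => psi J (y s)) (dpsi J (y t) dy).
Proof.
move=> yd; have h1 := is_derive_jGa yd yd.
have h2 := is_derive_jG yd yd yd; have h3 := is_derive_jGa yd h1.
have := is_deriveD yd (is_deriveD (is_deriveZ 2^-1 h1) (is_deriveZ 6^-1 (is_deriveD h2 h3))).
rewrite [X in is_derive _ _ _ X -> _](_ : _ = dpsi J (y t) dy) //.
rewrite /dpsi /dpsi3 (jGaC J dy (y t)) (jGC J (y t) (y t) dy) (jGaDr J (y t)).
by apply/rowP => k; rewrite !mxE; lra.
Qed.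

Lemma is_derive_cal e (y : R -> V) (t : R) dy : is_derive t 1 y dy ->
  is_derive t 1 (fun s => cal J e (y s)) (dcal J e (y t) dy).
Proof.
move=> yd.
have h1 := is_derive_lin (jgDr J e) (fun c => jgZr J c e) (is_derive_psi yd).
have h2 := is_derive_lin (jgDr J e) (fun c => jgZr J c e) yd.
have h3 := is_derive_bil (jF_D J e) (fun c => jF_Z J c e) (jF_Dr J e) (fun c => jF_Zr J c e) yd yd.
have h4 := is_deriveB h1 (is_deriveMc 6^-1 (is_deriveMf h2 h3)).
rewrite (_ : (fun s => _) = (fun s => jg J e (psi J (y s)) - 6^-1 * (jg J e (y s) * jF J e (y s) (y s)))).
  rewrite [X in is_derive _ _ _ X](_ : _ = jg J e (dpsi J (y t) dy) -
     6^-1 * (jg J e dy * jF J e (y t) (y t) + jg J e (y t) * (jF J e dy (y t) + jF J e (y t) dy))) //.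
  by rewrite /dcal jQ_F (jF_sym J e dy); ring.
by apply/funext => s; rewrite /cal jQ_F.
Qed.

Lemma is_derive_phi xi u (c : R -> V) dc (t : R) : is_derive t 1 c dc ->
  let x := fun s : R => xi + s *: u in
  is_derive t 1 (fun s => x s + (phi2 J (x s) + (phi3 J (x s) + c s)))
    (u + (dphi2 J (x t) u + (dphi3 J (x t) u + dc))).
Proof.
move=> cd x.
have xd : is_derive t 1 x u by exact: is_derive_affine.
have h1 := is_derive_jGa xd xd.
have h2 := is_derive_jG xd xd xd; have h3 := is_derive_jGa xd h1.
have h5 := is_deriveZ 6^-1 (is_deriveB (is_deriveZ 2 h3) h2).
have := is_deriveD xd (is_deriveD (is_deriveZ (- 2^-1) h1) (is_deriveD h5 cd)).
rewrite [X in is_derive _ _ _ X -> _](_ : _ = u + (dphi2 J (x t) u + (dphi3 J (x t) u + dc))) //.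
rewrite /dphi2 /dphi3 (jGaC J u (x t)) (jGC J (x t) u (x t)) (jGaDr J (x t)).
by apply/rowP => k; rewrite !mxE; lra.
Qed.

Lemma dcalZ e y c u : dcal J e y (c *: u) = c * dcal J e y u.
Proof.
rewrite /dcal /dpsi /dpsi3 !(jGZ1, jGZ, jGaZ, jGaZr, jF_Zr, jgDr, jgZr, jGZr).
by ring.
Qed.
End MultilinearDerivative.

(** * Uniform estimates of speeds and of the calibration near a point *)

Section LocalEstimates.
Context {R : realType} {n : nat}.
Local Notation V := 'rV[R]_n.
Variables (gr : V -> 'M[R]_n) (x0 : V) (J : jet R n).
Hypothesis HT : exists2 C, 0 <= C & \forall y \near (0 : V), forall u w,
  `|bf (gr (x0 + y)) u w - (jg J u w + jB J y u w + 2^-1 * jH J y y u w)|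
    <= C * `|y| ^+ 3 * `|u| * `|w|.

Lemma metric_coercive : \forall y \near (0 : V), forall u,
  2^-1 * jc J * `|u| ^+ 2 <= bf (gr (x0 + y)) u u.
Proof.
have [C C0 HC] := HT; have c0 := jc_gt0 J.
pose A := `|jK J| + `|jK J| + C + 1.
have A0 : 0 < A by rewrite /A ltr_wpDl// !addr_ge0.
have H : \forall y \near (0 : V), forall u,
    `|bf (gr (x0 + y)) u u - jg J u u| <= A * `|y| * `|u| ^+ 2.
  apply: filterS2 HC (ball_near0 ltr01 (fun y (h : `|y| < 1) => h)) => y Hy y1 u.
  have yy : `|y| ^+ 2 <= `|y| by rewrite expr2 ler_piMr// ltW.
  have yyy : `|y| ^+ 3 <= `|y| by rewrite exprS ler_piMr// (le_trans yy)// ltW.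
  have hB : `|jB J y u u| <= `|jK J| * `|y| * `|u| ^+ 2.
    apply: le_trans (jB_le _ _ _ _) _; rewrite expr2 mulrA.
    by rewrite !ler_wpM2r// ler_norm.
  have hH : `|jH J y y u u| <= `|jK J| * `|y| * `|u| ^+ 2.
    apply: le_trans (jH_le _ _ _ _ _) _; rewrite (expr2 `|u|) mulrA !ler_wpM2r//.
    apply: (@le_trans _ _ (`|jK J| * `|y|)); first by rewrite ler_wpM2r// ler_norm.
    by rewrite ler_piMr// ltW.
  have := Hy u u; rewrite -mulrA -expr2 => hr.
  have {}hr : `|bf (gr (x0 + y)) u u - (jg J u u + jB J y u u + 2^-1 * jH J y y u u)| <=
      C * `|y| * `|u| ^+ 2.
    by apply: le_trans hr _; rewrite ler_wpM2r ?sqr_ge0// ler_wpM2l.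
  have p0 : 0 <= `|jK J| * `|y| * `|u| ^+ 2 by rewrite !mulr_ge0 ?sqr_ge0.
  have p1 : 0 <= `|y| * `|u| ^+ 2 by rewrite !mulr_ge0 ?sqr_ge0.
  move: hB hH hr p0; rewrite !ler_norml /A !mulrDl mul1r => /andP[? ?] /andP[? ?] /andP[? ?] ?.
  by apply/andP; split; lra.
apply: filterS2 H (ball_near0 (_ : 0 < jc J / (2 * A)) (fun y h => h)) => [y Hy yA u|]; last first.
  by rewrite divr_gt0// mulr_gt0.
have := Hy u; have := jg_ge J u; rewrite ler_norml => h1 /andP[h2 _].
have : A * `|y| * `|u| ^+ 2 <= 2^-1 * jc J * `|u| ^+ 2.
  rewrite ler_wpM2r ?sqr_ge0//; move: yA; rewrite /= ltr_pdivlMr ?mulr_gt0//; lra.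
lra.
Qed.

(** The competing curve is the image of the segment, with the remainders e1 and e2 of the two
    endpoints interpolated linearly. The range |t| <= 2 leaves room around [0, 1] for the C^1
    extension that [C1_segment] asks for. *)
Lemma upper_estimate (E : R) : 0 <= E -> exists C d, [/\ 0 < d, 0 <= C &
  forall xi eta e1 e2 m t, `|xi| <= m -> `|eta| <= m -> m <= d ->
    `|e1| <= E * m ^+ 4 -> `|e2| <= E * m ^+ 4 -> `|t| <= 2 ->
    let u := eta - xi in let x := xi + t *: u in
    let y := x + (phi2 J x + (phi3 J x + (e1 + t *: (e2 - e1)))) in
    let w := u + (dphi2 J x u + (dphi3 J x u + (e2 - e1))) in
    `|y| <= C * m /\
    `|bf (gr (x0 + y)) w w - (jg J u u - 3^-1 * jQ J xi eta)| <= C * m ^+ 5].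
Proof.
move=> E0.
pose P := (V * V * V * V * R * R)%type.
pose xi (p : P) := p.1.1.1.1.1; pose eta (p : P) := p.1.1.1.1.2.
pose e1 (p : P) := p.1.1.1.2; pose e2 (p : P) := p.1.1.2.
pose m (p : P) := p.1.2; pose t (p : P) := p.2.
pose D (p : P) := [/\ `|xi p| <= m p, `|eta p| <= m p, m p <= 1,
  `|e1 p| <= E * m p ^+ 4 /\ `|e2 p| <= E * m p ^+ 4 & `|t p| <= 2].
have m01 p : D p -> 0 <= m p <= 1.
  by move=> [h _ -> _ _]; rewrite andbT; apply: le_trans h.
have hxi : bo D m 1 xi by exists 1 => // p [h _ _ _ _]; rewrite mul1r expr1.
have heta : bo D m 1 eta by exists 1 => // p [_ h _ _ _]; rewrite mul1r expr1.
have he1 : bo D m 4 e1 by exists E => // p [_ _ _ [h _] _].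
have he2 : bo D m 4 e2 by exists E => // p [_ _ _ [_ h] _].
have ht : bo D m 0 t by exists 2 => // p [_ _ _ _ h]; rewrite expr0 mulr1.
pose u p := eta p - xi p; pose x p := xi p + t p *: u p.
have hu : bo D m 1 u by exact: boB.
have hx : bo D m 1 x by apply: boD => //; exact: (boZ ht hu).
pose y3 p := phi3 J (x p) + (e1 p + t p *: (e2 p - e1 p)).
pose w3 p := e2 p - e1 p.
have hw3 : bo D m 4 w3 by exact: boB.
have hphi2 : bo D m 2 (fun p => phi2 J (x p)) by rewrite /phi2; bo_tac m01.
have hphi3 : bo D m 3 (fun p => phi3 J (x p)) by rewrite /phi3; bo_tac m01.
have htw : bo D m 4 (fun p => e1 p + t p *: (e2 p - e1 p)).
  by apply: boD => //; exact: (boZ ht hw3).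
have hy3 : bo D m 3 y3 by apply: boD => //; apply: (boW m01 htw).
have hd2 : bo D m 2 (fun p => dphi2 J (x p) (u p)) by rewrite /dphi2; bo_tac m01.
have hd3 : bo D m 3 (fun p => dphi3 J (x p) (u p)) by rewrite /dphi3; bo_tac m01.
have [C1 C10 H1] := metric_phi_bo J m01 hx hu hy3 hw3.
pose y p := x p + (phi2 J (x p) + y3 p).
pose w p := u p + (dphi2 J (x p) (u p) + (dphi3 J (x p) (u p) + w3 p)).
have hy : bo D m 1 y by rewrite /y; bo_tac m01.
have hw : bo D m 1 w by rewrite /w; bo_tac m01.
have [Cy Cy0 Hy] := hy; have [Cw Cw0 Hw] := hw.
have [C C0 /near0_ball[r r0 HC]] := HT.
exists (Cy + (C * Cy ^+ 3 * Cw ^+ 2 + C1)), (Num.min 1 (r / (Cy + 1))); split.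
- by rewrite lt_min ltr01 divr_gt0// ltr_wpDl.
- by rewrite !(addr_ge0, mulr_ge0)// exprn_ge0.
move=> xi' eta' e1' e2' m' t' h1 h2; rewrite le_min => /andP[h3 h3'] h4 h5 h6.
pose p : P := (xi', eta', e1', e2', m', t').
have Dp : D p by split.
have [m0 m1] := andP (m01 p Dp).
have yb := Hy p Dp; rewrite expr1 in yb.
have K0 : 0 <= C * Cy ^+ 3 * Cw ^+ 2 + C1 by rewrite !(addr_ge0, mulr_ge0)// exprn_ge0.
move=> /=; split.
  by apply: le_trans yb _; rewrite ler_wpM2r// lerDl.
have yr : `|y p| < r.
  apply: le_lt_trans yb _; move: h3'; rewrite -[m']/(m p) ler_pdivlMr ?ltr_wpDl//.
  have [->|mn0] := eqVneq (m p) 0; first by rewrite mulr0.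
  apply: lt_le_trans; rewrite mulrC ltr_pM2l ?ltrDl// lt_neqAle eq_sym mn0; exact: m0.
have A := HC _ yr (w p) (w p); have B := H1 p Dp.
have Qe : jQ J (x p) (u p) = jQ J xi' eta'.
  rewrite /x jQ_shift jQ_sym /u -scaleN1r jQ_shift; exact: jQ_sym.
move: B; rewrite Qe -/(y p) -/(w p) => B.
have A' : `|bf (gr (x0 + y p)) (w p) (w p) - jN J (y p) (w p)| <= C * Cy ^+ 3 * Cw ^+ 2 * m p ^+ 5.
  apply: le_trans A _; have wb := Hw p Dp; rewrite expr1 in wb.
  rewrite [leRHS](_ : _ = C * (Cy * m p) ^+ 3 * (Cw * m p) * (Cw * m p)); last by ring.
  have py : `|y p| ^+ 3 <= (Cy * m p) ^+ 3 by rewrite lerXn2r ?nnegrE// mulr_ge0.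
  apply: ler_pM => //; first by rewrite !mulr_ge0 ?exprn_ge0.
  apply: ler_pM => //; first by rewrite mulr_ge0 ?exprn_ge0.
  by rewrite ler_wpM2l.
rewrite -[bf _ _ _](subrK (jN J (y p) (w p))) -addrA.
apply: le_trans (ler_normD _ _) _; rewrite mulrDl [leLHS]addrC [(C * _ * _ + C1) * _]mulrDl.
rewrite -[leLHS]add0r lerD// ?mulr_ge0// ?exprn_ge0//.
by rewrite addrC lerD.
Qed.

(** [calibration_bo] has an additive error for bounded u. By homogeneity it suffices to treat unit
    vectors, for which coercivity makes the error proportional to the squared length, a form that
    can be integrated along curves. *)
Lemma lower_estimate (rho : R) : 0 <= rho -> exists C d, [/\ 0 < d, 0 <= C &
  forall e y u m, jg J e e = 1 -> `|y| <= rho * m -> m <= d -> 0 <= m ->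
    dcal J e y u ^+ 2 <= (1 + C * m ^+ 3) * bf (gr (x0 + y)) u u].
Proof.
move=> rho0; have c0 := jc_gt0 J.
pose P := (V * V * V * R)%type.
pose e (p : P) := p.1.1.1; pose y (p : P) := p.1.1.2; pose u (p : P) := p.1.2.
pose m (p : P) := p.2.
pose D (p : P) := [/\ jg J (e p) (e p) = 1, `|y p| <= rho * m p, 0 <= m p <= 1 & `|u p| <= 1].
have m01 p : D p -> 0 <= m p <= 1 by case.
have he : bo D m 0 e.
  (* From jc |e|^2 <= 1: either |e| <= 1, or |e| <= |e|^2 <= 1/jc. *)
  exists (1 + (jc J)^-1) => [|p [he _ _ _]]; first by rewrite addr_ge0// invr_ge0 ltW.
  rewrite expr0 mulr1; have := jg_ge J (e p); rewrite he -ler_pdivlMl// mulr1 => h.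
  have [e1|e1] := leP `|e p| 1; first by rewrite (le_trans e1)// lerDl invr_ge0 ltW.
  apply: (@le_trans _ _ (`|e p| ^+ 2)); first by rewrite expr2 ler_peMr// ltW.
  by rewrite (le_trans h)// lerDr.
have hy : bo D m 1 y by exists rho => // p [_ h _ _]; rewrite expr1.
have hu : bo D m 0 u by apply: bo_le1 => p [].
have hge p : D p -> jg J (e p) (e p) = 1 by case.
have [C1 C10 H1] := calibration_bo m01 he hy hu hge.
have [C C0 /near0_ball[r r0 HC]] := HT.
have /near0_ball[r1 r10 HK] := metric_coercive.
(* The factor 2 / jc comes from [metric_coercive], which gives 1 <= (2 / jc) g(v,v) for |v| = 1. The
   summand C rho^3 is the Taylor error of the metric at |y| <= rho m. *)
pose C2 := (C1 + C * rho ^+ 3) * (2 / jc J).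
exists C2, (Num.min 1 (Num.min r r1 / (rho + 1))); split.
- by rewrite lt_min ltr01 divr_gt0// ?lt_min ?r0// ltr_wpDl.
- apply: mulr_ge0; last by rewrite divr_ge0// ltW.
  by rewrite addr_ge0// mulr_ge0// exprn_ge0.
move=> e' y' u' m' ee yb; rewrite le_min => /andP[m1 mr] m0.
have yr : `|y'| < Num.min r r1.
  move: mr; rewrite ler_pdivlMr ?ltr_wpDl// => mr.
  have rr : 0 < Num.min r r1 by rewrite lt_min r0.
  apply: le_lt_trans yb _; have [->|mn0] := eqVneq m' 0; first by rewrite mulr0.
  apply: lt_le_trans mr; rewrite mulrC ltr_pM2l ?ltrDl//.
  by rewrite lt_neqAle eq_sym mn0.
move: yr; rewrite lt_min => /andP[yr yr1].
suff S v : `|v| = 1 -> dcal J e' y' v ^+ 2 <= (1 + C2 * m' ^+ 3) * bf (gr (x0 + y')) v v.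
  have [->|u0] := eqVneq u' 0.
    by rewrite -(scale0r (0 : V)) dcalZ mul0r expr0n /= bfZ mul0r mulr0.
  have [s [v [v1 ->]]] : exists s v, `|v| = 1 /\ u' = s *: v.
    exists `|u'|, (`|u'|^-1 *: u'); split; first exact: exists_norm1.
    by rewrite scalerA mulfV ?normr_eq0// scale1r.
  rewrite dcalZ bfZ bfZr exprMn.
  rewrite [leRHS](_ : _ = s ^+ 2 * ((1 + C2 * m' ^+ 3) * bf (gr (x0 + y')) v v)); last by ring.
  by rewrite ler_wpM2l ?sqr_ge0// S.
move=> v1; pose p : P := (e', y', v, m').
have Dp : D p by split => //=; rewrite ?m0 ?v1.
have A := H1 p Dp; have := HC _ yr v v; rewrite v1 !mulr1 ler_norml => /andP[B _].
have B' : C * `|y'| ^+ 3 <= C * rho ^+ 3 * m' ^+ 3.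
  by rewrite -mulrA ler_wpM2l// -exprMn lerXn2r ?nnegrE// mulr_ge0.
have := HK _ yr1 v; rewrite v1 expr1n mulr1 => lb.
have : (C1 + C * rho ^+ 3) * m' ^+ 3 <= C2 * m' ^+ 3 * bf (gr (x0 + y')) v v.
  have hb : 1 <= 2 / jc J * bf (gr (x0 + y')) v v.
    by rewrite mulrAC ler_pdivlMr// mul1r; lra.
  rewrite [leRHS](_ : _ = (C1 + C * rho ^+ 3) * m' ^+ 3 * (2 / jc J * bf (gr (x0 + y')) v v)).
    by rewrite ler_peMr// mulr_ge0 ?exprn_ge0// addr_ge0// mulr_ge0// exprn_ge0.
  by rewrite /C2; ring.
move: A B B'; rewrite /= /jN; clearbody C2; rewrite (mulrDl 1) mul1r; lra.
Qed.

Lemma endpoint_estimate (E : R) : 0 <= E -> exists2 C, 0 <= C &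
  forall e x eps m, jg J e e = 1 -> `|x| <= m -> m <= 1 -> `|eps| <= E * m ^+ 4 ->
  `|cal J e (x + (phi2 J x + (phi3 J x + eps)))
    - (jg J e x - 6^-1 * (jg J e x * jQ J x e))| <= C * m ^+ 4.
Proof.
move=> E0; have c0 := jc_gt0 J.
pose P := (V * V * V * R)%type.
pose e (p : P) := p.1.1.1; pose x (p : P) := p.1.1.2; pose eps (p : P) := p.1.2.
pose m (p : P) := p.2.
pose D (p : P) := [/\ jg J (e p) (e p) = 1, `|x p| <= m p, m p <= 1 & `|eps p| <= E * m p ^+ 4].
have m01 p : D p -> 0 <= m p <= 1 by move=> [_ h -> _]; rewrite andbT; apply: le_trans h.
have he : bo D m 0 e.
  exists (1 + (jc J)^-1) => [|p [he _ _ _]]; first by rewrite addr_ge0// invr_ge0 ltW.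
  rewrite expr0 mulr1; have := jg_ge J (e p); rewrite he -ler_pdivlMl// mulr1 => h.
  have [e1|e1] := leP `|e p| 1; first by rewrite (le_trans e1)// lerDl invr_ge0 ltW.
  apply: (@le_trans _ _ (`|e p| ^+ 2)); first by rewrite expr2 ler_peMr// ltW.
  by rewrite (le_trans h)// lerDr.
have hx : bo D m 1 x by exists 1 => // p [_ h _ _]; rewrite mul1r expr1.
have heps : bo D m 4 eps by exists E => // p [].
have [C C0 HC] := calibration_phi J m01 he hx heps.
exists C => // e' x' eps' m' h1 h2 h3 h4.
exact: (HC (e', x', eps', m') (And4 h1 h2 h3 h4)).
Qed.
End LocalEstimates.

(** * Charts and tangent vectors *)

Section ManifoldCharts.
Context {R : realType} {n : nat} (M : manifold R n).
Local Notation V := 'rV[R]_n.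
Implicit Types (i j k : chart_index M) (p q : M) (x u v w : V).

Definition chart_image i : set V := chart i @` chart_dom i.
Definition overlap i j : set V := chart i @` (chart_dom i `&` chart_dom j).

Lemma chart_image_inv i x : chart_image i x ->
  chart_dom i (chart_inv i x) /\ chart i (chart_inv i x) = x.
Proof. by move=> [p pi <-]; rewrite chartK. Qed.

Lemma chart_in_image i p : chart_dom i p -> chart_image i (chart i p).
Proof. by move=> pi; exists p. Qed.

Lemma overlapP i j x : overlap i j x <-> chart_image i x /\ chart_dom j (chart_inv i x).
Proof.
split=> [[p [pi pj] <-]|[[p pi <-]]]; first by rewrite chartK//; split => //; exists p.
by rewrite chartK// => pj; exists p.
Qed.

Lemma chart_image_openE i : open (chart_image i).
Proof. exact: chart_image_open. Qed.

Lemma overlap_open i j : open (overlap i j).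
Proof.
rewrite openE => x xo; have [xi xj] := (overlapP i j x).1 xo.
have [p pi xE] := xi; rewrite -xE in xi xj *.
have h1 : nbhs (chart i p) (chart_image i).
  by apply: open_nbhs_nbhs; split => //; exact: chart_image_open.
have h2 : nbhs (chart i p) (chart_inv i @^-1` chart_dom j).
  apply: (chart_inv_continuous pi); apply: open_nbhs_nbhs; split => //.
  exact: chart_dom_open.
have FF : Filter (nbhs (chart i p)) := nbhs_filter _.
by apply: (@filterS2 _ _ FF _ _ _ _ h1 h2) => y y1 y2; apply/overlapP.
Qed.

Lemma transition_Ck i j (a : 'I_n) m : Ck m (overlap i j) (fun x => transition i j x 0 a).
Proof. exact/smooth_on_Ck/transition_smooth. Qed.

Definition dtr i j x v : V := \row_a dir (fun x => transition i j x 0 a) x v.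

Lemma transition_derive i j x v : overlap i j x -> is_derive x v (transition i j) (dtr i j x v).
Proof.
move=> xo; apply/is_derive_rv => a; rewrite mxE.
exact: (Ck_derive v (@overlap_open i j) (transition_Ck i j a 1) xo).
Qed.

Lemma D_transition i j x v : overlap i j x -> 'D_v (transition i j) x = dtr i j x v.
Proof. by move=> xo; have [_ <-] := transition_derive v xo. Qed.

Lemma dtrD i j x u v : dtr i j x (u + v) = dtr i j x u + dtr i j x v.
Proof. by apply/rowP => a; rewrite !mxE dirD. Qed.

Lemma dtrZ i j x c v : dtr i j x (c *: v) = c *: dtr i j x v.
Proof. by apply/rowP => a; rewrite !mxE dirZ. Qed.

Lemma dtr_id i x v : chart_image i x -> dtr i i x v = v.
Proof.
move=> xi; have xo : overlap i i x by apply/overlapP; split => //; case: (chart_image_inv xi).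
rewrite -D_transition//; rewrite (@near_eq_derive _ _ _ _ id).
  by rewrite derive_id.
have : nbhs x (chart_image i) by apply: open_nbhs_nbhs; split => //; exact: chart_image_open.
by apply: filterS => y yi; rewrite /transition; case: (chart_image_inv yi).
Qed.

Lemma is_derive_transition_comp (W : normedModType R) i j (c : W -> V) (x v : W) (dc : V) :
  overlap i j (c x) -> is_derive x v c dc ->
  is_derive x v (fun y => transition i j (c y)) (dtr i j (c x) dc).
Proof.
move=> xo cd; apply/is_derive_rv => a; rewrite mxE.
exact: (is_derive_comp cd (Ck_is_diff (@overlap_open i j) (transition_Ck i j a 1) xo)).
Qed.

Lemma dtr_comp i j k p v : chart_dom i p -> chart_dom j p -> chart_dom k p ->
  dtr j k (chart j p) (dtr i j (chart i p) v) = dtr i k (chart i p) v.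
Proof.
move=> pi pj pk; set x := chart i p.
have xij : overlap i j x by exists p.
have xik : overlap i k x by exists p.
have yjk : overlap j k (transition i j x) by rewrite /transition /x chartK//; exists p.
have := is_derive_transition_comp yjk (transition_derive v xij).
rewrite {3}/transition /x chartK// -/x => h1.
have [_ <-] := transition_derive v xik; case: h1 => _ <-.
apply/esym/near_eq_derive.
have : nbhs x (overlap i j) by apply: open_nbhs_nbhs; split => //; exact: overlap_open.
apply: filterS => y /overlapP[yi yj]; rewrite /transition chartK//.
Qed.

Lemma tangent0 p : tangent p (0 : tvec M).
Proof.
split => // i j pi pj; have xo : overlap i j (chart i p) by exists p.
by rewrite (_ : (0 : tvec M) i = 0)// derive0.
Qed.

Lemma tangent_lin p (c : R) (v w : tvec M) : tangent p v -> tangent p w -> tangent p (c *: v + w).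
Proof.
move=> [v0 vt] [w0 wt]; split => [i pi|i j pi pj].
  by rewrite -[LHS]/(c *: v i + w i) v0// w0// scaler0 addr0.
have xo : overlap i j (chart i p) by exists p.
rewrite -[LHS]/(c *: v j + w j) -[(c *: v + w) i]/(c *: v i + w i).
by rewrite (vt i j)// (wt i j)// !D_transition// dtrD dtrZ.
Qed.

Lemma tangentZ p (c : R) (v : tvec M) : tangent p v -> tangent p (c *: v).
Proof. by move=> vt; rewrite -[c *: v]addr0; apply: tangent_lin => //; exact: tangent0. Qed.

Lemma tangentD p (v w : tvec M) : tangent p v -> tangent p w -> tangent p (v + w).
Proof. by move=> vt wt; rewrite -[v]scale1r; exact: tangent_lin. Qed.

Lemma tangentB p (v w : tvec M) : tangent p v -> tangent p w -> tangent p (v - w).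
Proof. by move=> vt wt; rewrite -scaleN1r addrC; exact: tangent_lin. Qed.

Definition tvec_of i p (u : V) : tvec M := at_charts p (fun j => dtr i j (chart i p) u).

Lemma tangent_tvec_of i p u : chart_dom i p -> tangent p (tvec_of i p u).
Proof.
move=> pi; split => [j pj|j k pj pk]; rewrite /tvec_of /at_charts; first by case: asboolP.
have xo : overlap j k (chart j p) by exists p.
by case: asboolP => // _; case: asboolP => // _; rewrite D_transition// dtr_comp.
Qed.

Lemma tvec_ofE i p u : chart_dom i p -> tvec_of i p u i = u.
Proof.
move=> pi; rewrite /tvec_of /at_charts; case: asboolP => // _; apply: dtr_id.
exact: chart_in_image.
Qed.

Lemma tangent_eq i p (v w : tvec M) : chart_dom i p -> tangent p v -> tangent p w ->
  v i = w i -> v = w.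
Proof.
move=> pi [v0 vt] [w0 wt] vw; apply/funext => j.
have [pj|pj] := pselect (chart_dom j p); last by rewrite v0// w0.
by rewrite (vt i j)// (wt i j)// vw.
Qed.

Lemma tvec_ofK i p (v : tvec M) : chart_dom i p -> tangent p v -> tvec_of i p (v i) = v.
Proof.
move=> pi vt; apply: (tangent_eq pi) => //; first exact: tangent_tvec_of.
exact: tvec_ofE.
Qed.

Lemma coord_vecE i a p : chart_dom i p -> coord_vec i a p = tvec_of i p (basis_vec a).
Proof.
move=> pi; apply/funext => j; rewrite /coord_vec /tvec_of /at_charts.
by case: asboolP => // pj; rewrite D_transition//; exists p.
Qed.

Lemma tvec_of_lin i p (c : R) u w : chart_dom i p ->
  tvec_of i p (c *: u + w) = c *: tvec_of i p u + tvec_of i p w.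
Proof.
move=> pi; apply: (tangent_eq pi).
- exact: tangent_tvec_of.
- by apply: tangent_lin; exact: tangent_tvec_of.
- by rewrite -[RHS]/(c *: tvec_of i p u i + tvec_of i p w i) !tvec_ofE.
Qed.

Section Metric.
Variable g : riemannian_metric M.

(** The metric is bilinear on tangent vectors only, so it is expanded along [tvec_of], all of whose
    values are tangent. *)
Lemma metric_tvec_of i p u w : chart_dom i p ->
  g p (tvec_of i p u) (tvec_of i p w) = bf (gram g i (chart i p)) u w.
Proof.
move=> pi; have tt x := tangent_tvec_of x pi.
have linl (c : R) u1 u2 w1 : g p (tvec_of i p (c *: u1 + u2)) (tvec_of i p w1) =
    c * g p (tvec_of i p u1) (tvec_of i p w1) + g p (tvec_of i p u2) (tvec_of i p w1).
  by rewrite tvec_of_lin// Defs.metric_linear.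
have sym u1 w1 : g p (tvec_of i p u1) (tvec_of i p w1) = g p (tvec_of i p w1) (tvec_of i p u1).
  by rewrite Defs.metric_sym.
have z0 w1 : g p (tvec_of i p 0) (tvec_of i p w1) = 0.
  by have := linl (-1) 0 0 w1; rewrite scaler0 addr0 mulN1r addNr.
have lD w1 u1 u2 : g p (tvec_of i p (u1 + u2)) (tvec_of i p w1) =
    g p (tvec_of i p u1) (tvec_of i p w1) + g p (tvec_of i p u2) (tvec_of i p w1).
  by rewrite -[u1]scale1r linl mul1r scale1r.
have lZ w1 (c : R) u1 : g p (tvec_of i p (c *: u1)) (tvec_of i p w1) =
    c * g p (tvec_of i p u1) (tvec_of i p w1).
  by rewrite -[c *: u1]addr0 linl z0 addr0.
rewrite (lin_expand (f := fun u => g p (tvec_of i p u) (tvec_of i p w)) (lD w) (lZ w)).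
apply: eq_bigr => a _; rewrite sym.
rewrite (lin_expand (f := fun u => g p (tvec_of i p u) _) (lD (basis_vec a)) (lZ (basis_vec a))).
rewrite mulr_sumr; apply: eq_bigr => b _.
by rewrite mxE chartK// !coord_vecE// sym; ring.
Qed.

Lemma metric_chart i p (v w : tvec M) : chart_dom i p -> tangent p v -> tangent p w ->
  g p v w = bf (gram g i (chart i p)) (v i) (w i).
Proof. by move=> pi vt wt; rewrite -metric_tvec_of// !tvec_ofK. Qed.

Lemma gram_sym i x : chart_image i x -> forall a b, gram g i x a b = gram g i x b a.
Proof.
move=> [p pi <-] a b; rewrite !mxE chartK// !coord_vecE// Defs.metric_sym//; exact: tangent_tvec_of.
Qed.

Lemma gram_pos i x : chart_image i x -> forall u, u != 0 -> 0 < bf (gram g i x) u u.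
Proof.
move=> [p pi <-] u u0; rewrite -metric_tvec_of//; apply: Defs.metric_pos; first exact: tangent_tvec_of.
by move=> uE; move/eqP: u0; apply; rewrite -(tvec_ofE u pi) uE.
Qed.

Lemma gram_Ck i m a b : Ck m (chart_image i) (fun x => gram g i x a b).
Proof.
have := @Defs.metric_smooth R n M g i a b => /(@smooth_on_Ck _ _ _ _ m).
by apply: eq_Ck => [|x _]; [exact: chart_image_open|rewrite mxE].
Qed.

Lemma gram_transition i j x u w : overlap i j x ->
  bf (gram g i x) u w = bf (gram g j (transition i j x)) (dtr i j x u) (dtr i j x w).
Proof.
move=> [p [pi pj] <-]; rewrite /transition chartK// -metric_tvec_of//.
rewrite (metric_chart pj (tangent_tvec_of u pi) (tangent_tvec_of w pi)).
by rewrite /tvec_of /at_charts; case: asboolP.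
Qed.
End Metric.
End ManifoldCharts.

(** * Christoffel symbols, curves and geodesics under a change of chart *)

Section ChartChange.
Context {R : realType} {n : nat} (M : manifold R n) (g : riemannian_metric M).
Local Notation V := 'rV[R]_n.
Implicit Types (i j k : chart_index M) (p q : M) (x u v w : V).

Lemma gram_Gax_lower i x u w l : chart_image i x ->
  bf (gram g i x) (Gax (gram g i) x u w) l =
  2^-1 * (bf (fun a b => dir (fun y => gram g i y a b) x u) w l
    + bf (fun a b => dir (fun y => gram g i y a b) x w) u l
    - bf (fun a b => dir (fun y => gram g i y a b) x l) u w).
Proof.
move=> xi; apply: (Gax_lower (U := chart_image i)) => //; [exact: gram_sym|exact: gram_pos].
Qed.

Definition d2tr i j x u w : V := \row_k dir2 (fun x => transition i j x 0 k) x u w.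

Lemma d2trC i j x u w : overlap i j x -> d2tr i j x u w = d2tr i j x w u.
Proof.
move=> xo; apply/rowP => k; rewrite !mxE.
exact: (dir2C _ _ (@overlap_open _ _ _ i j) xo (transition_Ck i j k 3)).
Qed.

Lemma is_derive_dtr i j x u y : overlap i j x ->
  is_derive x y (fun x => dtr i j x u) (d2tr i j x u y).
Proof.
move=> xo; apply/is_derive_rv => k; rewrite mxE.
rewrite [X in is_derive _ _ X _](_ : _ = (fun x => dir (fun x => transition i j x 0 k) x u)).
  exact: (derive_dir u y (@overlap_open _ _ _ i j) xo (transition_Ck i j k 2)).
by apply/funext => z; rewrite mxE.
Qed.

Lemma dgram_transition i j x y u w : overlap i j x ->
  bf (fun a b => dir (fun z => gram g i z a b) x y) u w =
  bf (fun a b => dir (fun z => gram g j z a b) (transition i j x) (dtr i j x y))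
     (dtr i j x u) (dtr i j x w)
  + bf (gram g j (transition i j x)) (d2tr i j x u y) (dtr i j x w)
  + bf (gram g j (transition i j x)) (dtr i j x u) (d2tr i j x w y).
Proof.
move=> xo; have [xi xj] := (overlapP i j x).1 xo.
have yj : chart_image j (transition i j x) by exact: chart_in_image.
have h1 : is_derive x y (fun x => bf (gram g i x) u w)
    (bf (fun a b => dir (fun z => gram g i z a b) x y) u w).
  apply: is_derive_bfl => a b.
  exact: (Ck_derive y (@chart_image_openE _ _ _ i) (gram_Ck g i 1 a b) xi).
have hA a b : is_derive x y (fun x => gram g j (transition i j x) a b)
    (dir (fun z => gram g j z a b) (transition i j x) (dtr i j x y)).
  exact: (is_derive_comp (transition_derive y xo)
    (Ck_is_diff (@chart_image_openE _ _ _ j) (gram_Ck g j 1 a b) yj)).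
have h2 := is_derive_bf hA (is_derive_dtr u y xo) (is_derive_dtr w y xo).
apply: (is_derive_unique h1); apply: near_eq_is_derive h2.
have : nbhs x (overlap i j) by apply: open_nbhs_nbhs; split => //; exact: overlap_open.
by apply: filterS => z zo; exact: (esym (gram_transition g u w zo)).
Qed.

Lemma dtr_inv i j x l : overlap i j x ->
  exists l', dtr i j x l' = l.
Proof.
move=> [p [pi pj] <-]; exists (dtr j i (chart j p) l).
by rewrite (dtr_comp l pj pi pj) dtr_id//; exact: chart_in_image.
Qed.

Lemma gram_nondegenerate i x u w : chart_image i x ->
  (forall l, bf (gram g i x) u l = bf (gram g i x) w l) -> u = w.
Proof.
move=> xi uw; apply/eqP; rewrite -subr_eq0; apply/negP => /negP d0.
have := gram_pos g xi d0; rewrite -scaleN1r bfD bfZ uw mulN1r subrr ltxx//.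
Qed.

(** Paired with an arbitrary vector, both Christoffel terms are given by the Koszul formula, and
    differentiating the transformation law of the Gram matrix relates the two. The diagonal case is
    the one that the geodesic equation contains. *)
Lemma christoffel_transition i j x u : overlap i j x ->
  dtr i j x (Gax (gram g i) x u u) =
  Gax (gram g j) (transition i j x) (dtr i j x u) (dtr i j x u) + d2tr i j x u u.
Proof.
move=> xo; have [xi xj] := (overlapP i j x).1 xo.
have yj : chart_image j (transition i j x) by exact: chart_in_image.
apply: (gram_nondegenerate yj) => l'; have [l <-] := dtr_inv l' xo.
rewrite [RHS]bfD.
(* P pairs the second derivative of the transition map along (u, u) with l, and survives; Q, S and W
   contain its mixed derivative along u and l, and cancel. *)
have L (X Y B1 B2 D1 D2 P Q S W Z : R) : X = Y -> Y = 2^-1 * (B1 + B1 - B2) ->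
    Z = 2^-1 * (D1 + D1 - D2) -> B1 = D1 + P + Q -> B2 = D2 + S + W -> S = W -> Q = W ->
    X = Z + P by lra.
apply: (L _ _ _ _ _ _ _ _ _ _ _ (esym (gram_transition g _ l xo)) (gram_Gax_lower u u l xi)
  (gram_Gax_lower _ _ _ yj) (dgram_transition u u l xo) (dgram_transition l u u xo)).
  by apply: bfC; exact: gram_sym.
by rewrite (d2trC l u xo).
Qed.

Lemma is_derive_dtr_curve i j (x p : R -> V) (t : R) (p' : V) : overlap i j (x t) ->
  is_derive t 1 x (p t) -> is_derive t 1 p p' ->
  is_derive t 1 (fun s => dtr i j (x s) (p s)) (d2tr i j (x t) (p t) (p t) + dtr i j (x t) p').
Proof.
move=> xo xd pd; apply/is_derive_rv => k; rewrite !mxE /dir2 /dir -big_split /=.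
rewrite [X in is_derive _ _ X _](_ : _ = (fun s => \sum_a p s 0 a * partial a (fun x => transition i j x 0 k) (x s))).
  apply: is_derive_sumf => a.
  have pa : is_derive t 1 (fun s => p s 0 a) (p' 0 a) by apply: (is_derive_rv _ _ _ _).2.
  have ta := is_derive_comp xd (Ck_is_diff (@overlap_open _ _ _ i j)
    (Ck_partial a (transition_Ck i j k 2)) xo).
  by have := is_deriveMf pa ta; rewrite addrC.
by apply/funext => s; rewrite mxE.
Qed.

Lemma continuous_dtr_curve i j (x p : R -> V) (t : R) : overlap i j (x t) ->
  {for t, continuous x} -> {for t, continuous p} ->
  {for t, continuous (fun s => dtr i j (x s) (p s))}.
Proof.
move=> xo xc pc; apply: continuous_rv => k.
rewrite (_ : (fun s => _) = (fun s => \sum_a p s 0 a * partial a (fun x => transition i j x 0 k) (x s))).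
  apply: for_continuous_sum => a; apply: continuousM; first exact: continuous_coord.
  apply: (@continuous_comp _ _ _ x (partial a (fun x => transition i j x 0 k))) => //.
  exact: (Ck_continuous (Ck_partial a (transition_Ck i j k 1)) xo).
by apply/funext => s; rewrite mxE.
Qed.

Section CurvesInCharts.
Variables (i : chart_index M) (a b : R) (x p : R -> V).
Hypotheses (xi : forall t, a < t < b -> chart_image i (x t))
  (xd : forall t : R, a < t < b -> is_derive t 1 x (p t)).
Let c t := chart_inv i (x t).

Let xc t : a < t < b -> {for t, continuous x}.
Proof.
move=> tab; apply: differentiable_continuous; apply/derivable1_diffP.
by case: (xd tab).
Qed.

Lemma chart_curve_continuous t : a < t < b -> {for t, continuous c}.
Proof.
move=> tab; apply: (@continuous_comp _ _ _ x (chart_inv i)); first exact: xc.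
by have [q qi <-] := xi tab; exact: chart_inv_continuous.
Qed.

Lemma near_itv (t : R) : a < t < b -> \forall s \near t, a < s < b.
Proof.
move=> tab; have : nbhs t `]a, b[%classic by apply: open_nbhs_nbhs; split => //; rewrite /= in_itv.
by apply: filterS => s; rewrite /= in_itv.
Qed.

Lemma chart_curve_overlap t j : a < t < b -> chart_dom j (c t) -> overlap i j (x t).
Proof. by move=> tab tj; apply/overlapP; split => //; exact: xi. Qed.

Lemma chart_curve_near t j : a < t < b -> chart_dom j (c t) ->
  \forall s \near t, a < s < b /\ chart_dom j (c s).
Proof.
move=> tab tj; apply: filterI; first exact: near_itv.
by apply: (chart_curve_continuous tab); apply: open_nbhs_nbhs; split => //; exact: chart_dom_open.
Qed.

Lemma chart_curve_derive t j : a < t < b -> chart_dom j (c t) ->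
  is_derive t 1 (fun s => chart j (c s)) (dtr i j (x t) (p t)).
Proof.
move=> tab tj.
exact: (is_derive_transition_comp (chart_curve_overlap tab tj) (xd tab)).
Qed.

Lemma chart_curve_derive1 t j : a < t < b -> chart_dom j (c t) ->
  derive1 (fun s => chart j (c s)) t = dtr i j (x t) (p t).
Proof. by move=> tab tj; rewrite derive1E; case: (chart_curve_derive tab tj). Qed.

Lemma chart_curve_derive1_near t j : a < t < b -> chart_dom j (c t) ->
  \forall s \near t, dtr i j (x s) (p s) = derive1 (fun s => chart j (c s)) s.
Proof.
move=> tab tj; apply: filterS (chart_curve_near tab tj) => s [sab sj].
by rewrite chart_curve_derive1.
Qed.

Lemma chart_curve_velocity t : a < t < b -> velocity c t = tvec_of i (c t) (p t).
Proof.
move=> tab; apply/funext => j; rewrite /velocity /tvec_of /at_charts.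
case: asboolP => // tj; rewrite chart_curve_derive1//.
by rewrite /c; case: (chart_image_inv (xi tab)) => _ ->.
Qed.

Lemma chart_curve_C1 : (forall t, a < t < b -> {for t, continuous p}) -> C1_curve a b c.
Proof.
move=> pc t tab; split; first exact: chart_curve_continuous.
move=> j tj; split; first by case: (chart_curve_derive tab tj).
apply: near_eq_continuous (chart_curve_derive1_near tab tj) _.
apply: continuous_dtr_curve; [exact: chart_curve_overlap|exact: xc|exact: pc].
Qed.

(** [geodesic] asks for the equation in every chart around each point, whereas the equation is
    solved in the chart i. The second derivative of the transition map produced by the chain rule is
    the inhomogeneous term of [christoffel_transition]. *)
Lemma chart_curve_geodesic :
  (forall t : R, a < t < b -> is_derive t 1 p (- Gax (gram g i) (x t) (p t) (p t))) ->
  geodesic g a b c.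
Proof.
move=> pd t tab; split; first exact: chart_curve_continuous.
move=> j tj; have tov := chart_curve_overlap tab tj.
have d2 : is_derive t 1 (derive1 (fun s => chart j (c s)))
    (- Gax (gram g j) (chart j (c t)) (derive1 (fun s => chart j (c s)) t)
        (derive1 (fun s => chart j (c s)) t)).
  rewrite chart_curve_derive1// -[chart j (c t)]/(transition i j (x t)).
  apply: near_eq_is_derive (chart_curve_derive1_near tab tj) _.
  have := is_derive_dtr_curve tov (xd tab) (pd _ tab).
  rewrite -scaleN1r dtrZ scaleN1r christoffel_transition// opprD addrCA subrr addr0//.
split.
- by case: (chart_curve_derive tab tj).
- by case: d2.
- move=> k; have [_ E] := d2; rewrite [derive1 (derive1 _) t]derive1E E !mxE addrC.
  apply/eqP; rewrite subr_eq0; apply/eqP.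
  by apply: eq_bigr => l _; apply: eq_bigr => m _.
Qed.
End CurvesInCharts.

Lemma velocity_chart (c : R -> M) t i : chart_dom i (c t) ->
  velocity c t i = derive1 (fun s => chart i (c s)) t.
Proof. by move=> ci; rewrite /velocity /at_charts; case: asboolP. Qed.

Lemma velocity_tangent (c : R -> M) t i : {for t, continuous c} -> chart_dom i (c t) ->
  derivable (fun s => chart i (c s)) t 1 -> tangent (c t) (velocity c t).
Proof.
move=> cc ci cd; have cd' := derivableP cd.
suff -> : velocity c t = tvec_of i (c t) (derive1 (fun s => chart i (c s)) t).
  exact: tangent_tvec_of.
apply/funext => j; rewrite /velocity /tvec_of /at_charts; case: asboolP => // cj.
have xo : overlap i j (chart i (c t)) by exists (c t).
have := is_derive_transition_comp xo cd'; rewrite !derive1E => -[_ <-].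
apply: near_eq_derive.
have : \forall s \near t, chart_dom i (c s).
  by apply: cc; apply: open_nbhs_nbhs; split => //; exact: chart_dom_open.
by apply: filterS => s si; rewrite /transition chartK.
Qed.

Lemma speed_chart (c : R -> M) t i : {for t, continuous c} -> chart_dom i (c t) ->
  derivable (fun s => chart i (c s)) t 1 ->
  tnorm g (c t) (velocity c t) = Num.sqrt (bf (gram g i (chart i (c t)))
    (derive1 (fun s => chart i (c s)) t) (derive1 (fun s => chart i (c s)) t)).
Proof.
move=> cc ci cd; have vt := velocity_tangent cc ci cd.
by rewrite /tnorm (metric_chart g ci vt vt) velocity_chart.
Qed.
End ChartChange.

(** * The exponential map in a chart *)

Section LocalODE.
Context {R : realType} {n : nat}.
Local Notation V := 'rV[R]_n.

(* Clipping makes the geodesic field globally bounded and Lipschitz, so that the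
   Picard iteration never leaves its domain. *)
Definition clipv (s : R) (y : V) : V := \row_a Num.max (- s) (Num.min s (y 0 a)).

Lemma clipv_le s y : 0 <= s -> `|clipv s y| <= s.
Proof.
move=> s0; apply: rv_norm_le => // a; rewrite mxE ler_norml le_max lexx /= ge_max ge_min lexx /= andbT.
by move: s0; lra.
Qed.

Lemma clipv_id s y : `|y| <= s -> clipv s y = y.
Proof.
move=> ys; apply/rowP => a; rewrite mxE.
have := le_trans (rv_coord_le y a) ys; rewrite ler_norml => /andP[h1 h2].
by rewrite min_r// max_r.
Qed.

Lemma clipv_lip s y y' : `|clipv s y - clipv s y'| <= `|y - y'|.
Proof.
apply: rv_norm_le => // a; rewrite !mxE; apply: le_trans (rv_coord_le _ a).
rewrite !mxE; move: (y 0 a) (y' 0 a) => u w; rewrite ler_norml.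
have := ler_norm (u - w); have := ler_norm (w - u); rewrite (distrC w u).
rewrite /Num.max /Num.min; case: (ltP s u) => ?; case: (ltP s w) => ?;
  case: (ltP (- s) s) => ?; case: (ltP (- s) u) => ?; case: (ltP (- s) w) => ? *;
  by apply/andP; split; lra.
Qed.

Lemma quadratic_lip (A : 'I_n -> 'I_n -> V -> R) (r C K : R) : 0 <= r -> 0 <= C -> 0 <= K ->
  (forall a b y y', `|y| <= r -> `|y'| <= r -> `|A a b y - A a b y'| <= C * `|y - y'|) ->
  (forall a b y, `|y| <= r -> `|A a b y| <= K) ->
  forall y y' p p' d, `|y| <= r -> `|y'| <= r -> `|p| <= r -> `|p'| <= r ->
    `|y - y'| <= d -> `|p - p'| <= d ->
    `|bf (fun a b => A a b y) p p - bf (fun a b => A a b y') p' p'|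
      <= (\sum_(a < n) \sum_(b < n) (C * r * r + 2 * K * r)) * d.
Proof.
move=> r0 C0 K0 AC AK y y' p p' d yr y'r pr p'r yd pd.
have d0 : 0 <= d by apply: le_trans yd.
rewrite /bf -sumrB mulr_suml; apply: le_trans (ler_norm_sum _ _ _) _; apply: ler_sum => a _.
rewrite -sumrB mulr_suml; apply: le_trans (ler_norm_sum _ _ _) _; apply: ler_sum => b _.
have c1 (x : V) : `|x| <= r -> forall e, `|x 0 e| <= r by move=> xr e; exact: le_trans (rv_coord_le _ _) xr.
have c2 e : `|p 0 e - p' 0 e| <= d.
  by have := le_trans (rv_coord_le (p - p') e) pd; rewrite !mxE.
rewrite [X in `|X| <= _](_ : _ = (A a b y - A a b y') * p 0 a * p 0 b
   + (A a b y' * (p 0 a - p' 0 a) * p 0 b + A a b y' * p' 0 a * (p 0 b - p' 0 b))); last by ring.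
apply: le_trans (ler_normD _ _) _.
rewrite [leRHS](_ : _ = C * d * r * r + (K * d * r + K * r * d)); last by ring.
apply: lerD.
  rewrite !normrM !ler_pM ?mulr_ge0 ?c1//; apply: le_trans (AC _ _ _ _ yr y'r) _.
  by rewrite ler_wpM2l.
apply: le_trans (ler_normD _ _) _; rewrite !normrM; apply: lerD.
  by rewrite !ler_pM ?mulr_ge0 ?c1 ?c2 ?AK.
by rewrite !ler_pM ?mulr_ge0 ?c1 ?c2 ?AK.
Qed.

Lemma local_ode (A : 'I_n -> 'I_n -> 'I_n -> V -> R) (r C K : R) :
  0 < r -> 0 <= C -> 0 <= K ->
  (forall k a b y y', `|y| <= r -> `|y'| <= r -> `|A k a b y - A k a b y'| <= C * `|y - y'|) ->
  (forall k a b y, `|y| <= r -> `|A k a b y| <= K) ->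
  exists T rho, [/\ 0 < T, 0 < rho & forall v0, `|v0| <= rho ->
    exists y p : R -> V, [/\ y 0 = 0, p 0 = v0 & forall t : R, `|t| < T ->
      [/\ is_derive t 1 y (p t),
          is_derive t 1 p (- \row_k bf (fun a b => A k a b (y t)) (p t) (p t)) & `|y t| <= r]]].
Proof.
move=> r0 C0 K0 AC AK.
(* The second-order equation becomes a first-order system, with the position in the left half of X
   and the velocity in the right half. *)
pose q (X : 'rV[R]_(n + n)) : V := lsubmx X; pose w (X : 'rV[R]_(n + n)) : V := rsubmx X.
pose F (X : 'rV[R]_(n + n)) : 'rV[R]_(n + n) := row_mx (clipv r (w X))
  (- \row_k bf (fun a b => A k a b (clipv r (q X))) (clipv r (w X)) (clipv r (w X))).
have r0' := ltW r0.
have row_le (u u' : V) c : 0 <= c -> `|u| <= c -> `|u'| <= c -> `|row_mx u u'| <= c.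
  move=> c0 h1 h2; apply: rv_norm_le => // a; rewrite mxE; case: splitP => b _.
    exact: le_trans (rv_coord_le _ _) h1.
  exact: le_trans (rv_coord_le _ _) h2.
have q_le X : `|q X| <= `|X|.
  by apply: rv_norm_le => // a; rewrite mxE; exact: rv_coord_le.
have w_le X : `|w X| <= `|X|.
  by apply: rv_norm_le => // a; rewrite mxE; exact: rv_coord_le.
have qB X Y : q X - q Y = q (X - Y) by apply/rowP => a; rewrite !mxE.
have wB X Y : w X - w Y = w (X - Y) by apply/rowP => a; rewrite !mxE.
pose L := \sum_(a < n) \sum_(b < n) (C * r * r + 2 * K * r).
have L0 : 0 <= L by do 2! (apply: sumr_ge0 => ? _); rewrite addr_ge0 ?mulr_ge0.
have FL X Y : `|F X - F Y| <= (1 + L) * `|X - Y|.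
  rewrite /F opp_row_mx add_row_mx; apply: row_le.
  - by rewrite mulr_ge0// addr_ge0.
  - apply: le_trans (clipv_lip _ _ _) _; rewrite wB; apply: le_trans (w_le _) _.
    by rewrite ler_peMl// lerDl.
  - apply: rv_norm_le => [|k]; first by rewrite mulr_ge0// addr_ge0.
    rewrite !mxE opprK addrC; apply: (@le_trans _ _ (L * `|X - Y|)); last first.
      by rewrite ler_wpM2r// lerDr.
    rewrite /L; apply: (quadratic_lip r0' C0 K0) => //.
    + exact: AC.
    + exact: AK.
    + exact: clipv_le.
    + exact: clipv_le.
    + exact: clipv_le.
    + exact: clipv_le.
    + by apply: le_trans (clipv_lip _ _ _) _; rewrite distrC qB; exact: q_le.
    + by apply: le_trans (clipv_lip _ _ _) _; rewrite distrC wB; exact: w_le.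
pose M := r + \sum_(a < n) \sum_(b < n) K * r * r.
have M0 : 0 < M.
  by rewrite ltr_wpDr//; do 2! (apply: sumr_ge0 => ? _); rewrite !mulr_ge0.
have FM X : `|F X| <= M.
  apply: row_le; [exact: ltW| |].
    rewrite (le_trans (clipv_le _ _))// lerDl.
    by do 2! (apply: sumr_ge0 => ? _); rewrite !mulr_ge0.
  apply: rv_norm_le => [|k]; first exact: ltW.
  rewrite !mxE normrN.
  have := @bf_le _ _ (fun a b => A k a b (clipv r (q X))) (fun _ _ => K) 1 (clipv r (w X)) (clipv r (w X)).
  rewrite !mulr1 => H; apply: le_trans (H _) _ => [a b|].
    by rewrite AK// clipv_le.
  apply: (@le_trans _ _ (\sum_(a < n) \sum_(b < n) K * r * r)); last by rewrite lerDr.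
  do 2! (rewrite ?mulr_suml; apply: ler_sum => ? _).
  by rewrite !ler_pM ?mulr_ge0 ?clipv_le.
(* The first bound makes the Picard operator a contraction. The second keeps X within r/2 of its
   initial value, hence both halves within r, where clipping is the identity. *)
pose T := Num.min ((2 * (1 + L))^-1) (r / (2 * M)).
have T0 : 0 < T.
  by rewrite lt_min invr_gt0 mulr_gt0 ?ltr_wpDr//= divr_gt0// mulr_gt0.
have LT : (1 + L) * T <= 2^-1.
  rewrite -ler_pdivlMl ?ltr_wpDr// mulrC -invfM; rewrite /T ge_min; apply/orP; left.
  by rewrite lexx.
have MT : M * T <= r / 2.
  rewrite -ler_pdivlMl// /T ge_min; apply/orP; right.
  by rewrite le_eqVlt; apply/orP; left; apply/eqP; field; rewrite gt_eqF.
exists T, (r / 2); split => //; first by rewrite divr_gt0.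
move=> v0 v0r.
have L1 : 0 <= 1 + L by rewrite addr_ge0.
have [X [X0 Xd]] := @picard R (n + n) F (1 + L) T (row_mx 0 v0) T0 L1 LT FL.
have Xb (t : R) : `|t| < T -> `|X t - X 0| <= r / 2.
  move=> tT; apply: rv_norm_le => [|a]; first by rewrite divr_ge0.
  have : `|X t 0 a - X 0 0 a| <= M * `|t|.
    apply: (@mvt0_bound _ (fun s => X s 0 a) (fun s => F (X s) 0 a)) => s st.
      by apply: (is_derive_rv _ _ _ _).2; apply: Xd; exact: le_lt_trans st tT.
    exact: le_trans (rv_coord_le _ _) (FM _).
  rewrite !mxE => /le_trans; apply; apply: le_trans MT.
  by rewrite ler_wpM2l// ltW.
exists (fun t => q (X t)), (fun t => w (X t)); split.
- by rewrite /q X0 row_mxKl.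
- by rewrite /w X0 row_mxKr.
move=> t tT.
have yb : `|q (X t)| <= r / 2.
  have := le_trans (q_le _) (Xb _ tT); rewrite -qB X0 /q row_mxKl subr0//.
have pb : `|w (X t)| <= r.
  have := le_trans (w_le _) (Xb _ tT); rewrite -wB X0 {2}/w row_mxKr => h.
  rewrite -[w (X t)](subrK v0) (le_trans (ler_normD _ _))// (splitr r) lerD//.
have yr : `|q (X t)| <= r by rewrite (le_trans yb)// ler_pdivrMr// ler_peMr// ler1n.
have FE : F (X t) = row_mx (w (X t)) (- \row_k bf (fun a b => A k a b (q (X t))) (w (X t)) (w (X t))).
  by rewrite /F !clipv_id.
have Xdt := Xd t tT; rewrite FE in Xdt.
split => //.
- apply/is_derive_rv => a; have := (is_derive_rv _ _ _ _).2 Xdt (lshift n a).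
  rewrite row_mxEl [X in _ -> is_derive _ _ X _](_ : _ = (fun y => X y 0 (lshift n a))) //.
  by apply/funext => s; rewrite mxE.
- apply/is_derive_rv => a; have := (is_derive_rv _ _ _ _).2 Xdt (rshift n a).
  rewrite row_mxEr [X in _ -> is_derive _ _ X _](_ : _ = (fun y => X y 0 (rshift n a))) //.
  by apply/funext => s; rewrite mxE.
Qed.

Lemma is_derive_is_diff (W : normedModType R) (f : R -> W) (t : R) d :
  is_derive t 1 f d -> is_diff t f (fun h => h *: d).
Proof.
move=> fd; have dt : derivable f t 1 by case: fd.
split; first exact/derivable1_diffP.
by rewrite deriv1E// derive1E; case: fd => _ ->.
Qed.

Lemma is_derive_rescale (W : normedModType R) (f : R -> W) (s t : R) d :
  is_derive (s * t) 1 f d -> is_derive t 1 (fun t => f (s * t)) (s *: d).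
Proof.
move=> fd; have st : is_derive t 1 (fun t : R => s * t) s.
  by have := is_derive_mulc s t; under eq_fun do rewrite mulrC.
exact: (is_derive_comp st (is_derive_is_diff fd)).
Qed.

(** Induction on the real interval, through the supremum of the T such that G holds on [0, T]. It
    serves twice as a continuation argument, for geodesics and for arbitrary curves. *)
Lemma interval_induction (G : R -> Prop) : G 0 ->
  (forall T, 0 <= T < 1 -> (forall t, 0 <= t <= T -> G t) -> \forall t \near T, G t) ->
  (forall T, 0 < T <= 1 -> (forall t, 0 <= t < T -> G t) -> G T) ->
  forall t, 0 <= t <= 1 -> G t.
Proof.
move=> G0 Gopen Gclosed.
pose S := [set T : R | 0 <= T <= 1 /\ forall t, 0 <= t <= T -> G t].
have S0 : S 0.
  split; first by rewrite lexx ler01.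
  by move=> t /andP[t0 t0']; rewrite (le_anti (_ : t <= 0 <= t)) ?t0'.
have supS : has_sup S by split; [exists 0|exists 1 => T [/andP[]]].
pose T := sup S.
have T0 : 0 <= T by apply: ub_le_sup => //; case: supS.
have T1 : T <= 1 by apply: ge_sup; [exists 0|move=> x [/andP[]]].
have GT t : 0 <= t < T -> G t.
  move=> /andP[t0 tT]; have Tt : 0 < T - t by rewrite subr_gt0.
  have [s [Ss Gs] ts] := sup_adherent Tt supS.
  by apply: Gs; rewrite t0 /=; move: ts; rewrite -/T subKr => /ltW.
have GTT t : 0 <= t <= T -> G t.
  move=> /andP[t0]; rewrite le_eqVlt => /predU1P[->|tT]; last by apply: GT; rewrite t0.
  have [->//|T0'] := eqVneq T 0.
  by apply: Gclosed => //; rewrite T1 andbT lt_neqAle eq_sym T0' T0.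
have TE : T = 1.
  apply/eqP; rewrite eq_le T1 /= leNgt; apply/negP => T1'.
  have := Gopen T; rewrite T0 T1' => /(_ isT GTT) /nbhs_normP[e /= e0 He].
  pose T' := Num.min 1 (T + e / 2).
  have TT' : T < T' by rewrite lt_min T1' ltrDl divr_gt0.
  have ST' : S T'.
    split; first by rewrite (le_trans T0 (ltW TT')) ge_min lexx.
    move=> t /andP[t0 tT']; have [tT|tT] := leP t T; first by apply: GTT; rewrite t0.
    apply: He => /=; rewrite distrC gtr0_norm ?subr_gt0//.
    have : T' <= T + e / 2 by rewrite ge_min lexx orbT.
    by move: e0; lra.
  have : T' <= T by apply: ub_le_sup => //; case: supS.
  by rewrite leNgt TT'.
by move=> t t01; apply: GTT; rewrite TE.
Qed.

Lemma left_witness (T : R) (P Q : R -> Prop) : 0 < T -> (forall t, 0 <= t < T -> P t) ->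
  (\forall t \near T, Q t) -> exists2 t, P t & Q t.
Proof.
move=> T0 HP /nbhs_normP[e /= e0 He].
pose t := T - Num.min (e / 2) T / 2.
have m0 : 0 < Num.min (e / 2) T by rewrite lt_min divr_gt0.
have mT : Num.min (e / 2) T <= T by rewrite ge_min lexx orbT.
have me : Num.min (e / 2) T <= e / 2 by rewrite ge_min lexx.
exists t; first by apply: HP; rewrite /t; apply/andP; split; lra.
apply: He; rewrite /t /= opprB addrC subrK ger0_norm; lra.
Qed.
End LocalODE.

(** * Existence, a priori bounds and endpoints of small geodesics *)

Section ExpMap.
Context {R : realType} {n : nat} (M : manifold R n) (g : riemannian_metric M).
Local Notation V := 'rV[R]_n.
Variables (i : chart_index M) (z : M) (zi : chart_dom i z).
Let x0 := chart i z.
Let x0i : chart_image i x0 := chart_in_image zi.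

(** A compact ball carried to M is compact, hence closed as M is Hausdorff. Thus a continuous curve
    cannot leave the chart domain while its coordinates remain in the ball. *)
Lemma closed_chart_ball r : (forall y, `|y| <= r -> chart_image i (x0 + y)) ->
  closed [set q : M | chart_dom i q /\ `|chart i q - x0| <= r].
Proof.
move=> rU; pose B : set V := [set x | `|x - x0| <= r].
have BU x : B x -> chart_image i x.
  by move=> Bx; rewrite -[x](subrK x0) addrC; exact: rU.
have -> : [set q : M | chart_dom i q /\ `|chart i q - x0| <= r] = chart_inv i @` B.
  apply/seteqP; split => [q [qi qr]|_ [x Bx <-]]; first by exists (chart i q) => //; rewrite chartK.
  by have [? xE] := chart_image_inv (BU _ Bx); rewrite /= xE.
apply: compact_closed; first exact: manifold_hausdorff.
apply: continuous_compact.
  apply: continuous_in_subspaceT => x; rewrite inE => /BU[q qi <-].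
  exact: chart_inv_continuous.
apply: bounded_closed_compact.
  exists (r + `|x0|); split; first exact: num_real.
  move=> N rN x Bx; apply: ltW; apply: le_lt_trans rN.
  by rewrite -[x](subrK x0) (le_trans (ler_normD _ _))// lerD2r.
apply: (@closed_comp _ _ (fun x : V => `|x - x0|) [set t | t <= r]); last exact: closed_le.
move=> x _; apply: (@continuous_comp _ _ _ (fun x : V => x - x0) (fun u : V => `|u|)).
  by apply: continuousB => //; exact: cst_continuous.
exact: norm_continuous.
Qed.

(** Continuation: the bounds with 2 imply the same bounds with 3/2, which is an open condition. The
    geodesic is arbitrary, so the conclusion applies to whichever one defines [exp_map]. *)
Lemma geodesic_apriori (r K : R) : 0 < r -> 0 <= K ->
  (forall y, `|y| <= r -> chart_image i (x0 + y)) ->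
  (forall y u w, `|y| <= r -> `|Gax (gram g i) (x0 + y) u w| <= K * `|u| * `|w|) ->
  forall a b c, a < 0 -> 1 < b -> geodesic g a b c -> c 0 = z ->
  forall xi, xi = velocity c 0 i -> xi != 0 -> 2 * `|xi| <= r -> 8 * K * `|xi| <= 1 ->
  forall t, 0 <= t <= 1 -> [/\ chart_dom i (c t), `|chart i (c t) - x0| <= 2 * `|xi| &
     `|derive1 (fun s => chart i (c s)) t| <= 2 * `|xi|].
Proof.
move=> r0 K0 rU GK a b c a0 b1 gc c0 xi xiE xi0 xir xiK.
pose x s := chart i (c s); pose p := derive1 x.
have e0 : 0 < `|xi| by rewrite normr_gt0.
have p0 : p 0 = xi by rewrite xiE velocity_chart// c0.
have ab (t : R) : 0 <= t <= 1 -> a < t < b.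
  by move=> /andP[t0 t1]; rewrite (lt_le_trans a0 t0) (le_lt_trans t1 b1).
have dx (t : R) : 0 <= t <= 1 -> chart_dom i (c t) -> is_derive t 1 x (p t).
  move=> t01 ti; have [_ /(_ i ti)[xd _ _]] := gc t (ab _ t01).
  by split; [exact: xd|rewrite -derive1E].
have dp (t : R) : 0 <= t <= 1 -> chart_dom i (c t) ->
    is_derive t 1 p (- Gax (gram g i) (x t) (p t) (p t)).
  move=> t01 ti; have [_ /(_ i ti)[_ pd E]] := gc t (ab _ t01).
  split; first exact: pd.
  rewrite -derive1E; apply/rowP => k; rewrite !mxE; have := E k.
  by move=> /eqP; rewrite addr_eq0 => /eqP.
have cc (t : R) : 0 <= t <= 1 -> {for t, continuous c} by move=> /ab/gc[].
pose G t := [/\ chart_dom i (c t), `|x t - x0| <= 2 * `|xi| & `|p t| <= 2 * `|xi|].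
(* The acceleration is at most K (2|xi|)^2 = 4 K |xi|^2, which is at most |xi|/2 by the hypothesis
   on 8 K |xi|. So the velocity varies by at most |xi|/2 up to time 1. *)
have improve T : 0 <= T <= 1 -> (forall t, 0 <= t <= T -> G t) ->
    `|x T - x0| <= 3 / 2 * `|xi| /\ `|p T| <= 3 / 2 * `|xi|.
  move=> /andP[T0 T1] GT.
  have t01 t : 0 <= t <= T -> 0 <= t <= 1 by move=> /andP[-> /le_trans->].
  have pb t : 0 <= t <= T -> `|p t| <= 3 / 2 * `|xi|.
    move=> tT; have /andP[t0 tT'] := tT.
    have : `|p t - xi| <= 2^-1 * `|xi|.
      apply: rv_norm_le => [|k]; first by rewrite mulr_ge0.
      have : `|p t 0 k - p 0 0 k| <= 2^-1 * `|xi| * (t - 0).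
        apply: (@mvt_bound _ (fun s => p s 0 k) (fun s => - Gax (gram g i) (x s) (p s) (p s) 0 k)) => // s /andP[s0 st].
          have sT : 0 <= s <= T by rewrite s0 (le_trans st).
          have [si _ _] := GT s sT.
          by have := (is_derive_rv _ _ _ _).2 (dp s (t01 _ sT) si) k; rewrite mxE.
        have sT : 0 <= s <= T by rewrite s0 (le_trans st).
        have [si h1 h2] := GT s sT.
        rewrite normrN; apply: le_trans (rv_coord_le _ _) _.
        have := GK (x s - x0) (p s) (p s) (le_trans h1 xir); rewrite addrC subrK => /le_trans; apply.
        apply: (@le_trans _ _ (K * (2 * `|xi|) * (2 * `|xi|))).
          by rewrite !ler_pM ?mulr_ge0.
        have : 8 * K * `|xi| * `|xi| <= 1 * `|xi| by rewrite ler_wpM2r.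
        by lra.
      rewrite p0 !mxE subr0 => /le_trans; apply.
      by rewrite ler_piMr ?mulr_ge0// (le_trans tT').
    rewrite -{2}[p t](subrK xi) => h; apply: le_trans (ler_normD _ _) _; lra.
  split; last by apply: pb; rewrite T0 lexx.
  apply: rv_norm_le => [|k]; first by rewrite mulr_ge0.
  have : `|x T 0 k - x 0 0 k| <= 3 / 2 * `|xi| * (T - 0).
    apply: (@mvt_bound _ (fun s => x s 0 k) (fun s => p s 0 k)) => // s sT.
      have [si _ _] := GT s sT.
      exact: (is_derive_rv _ _ _ _).2 (dx s (t01 _ sT) si) k.
    exact: le_trans (rv_coord_le _ _) (pb _ sT).
  rewrite /x c0 -/x0 !mxE subr0 => /le_trans; apply.
  by rewrite ler_piMr ?mulr_ge0.
have xcont t : 0 <= t <= 1 -> chart_dom i (c t) -> {for t, continuous x}.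
  by move=> t01 ti; apply: differentiable_continuous; apply/derivable1_diffP; case: (dx t t01 ti).
have pcont t : 0 <= t <= 1 -> chart_dom i (c t) -> {for t, continuous p}.
  by move=> t01 ti; apply: differentiable_continuous; apply/derivable1_diffP; case: (dp t t01 ti).
have xncont t : 0 <= t <= 1 -> chart_dom i (c t) -> {for t, continuous (fun s => `|x s - x0|)}.
  move=> t01 ti; apply: (@continuous_comp _ _ _ (fun s => x s - x0) (fun u : V => `|u|)).
    by apply: continuousB; [exact: xcont|exact: cst_continuous].
  exact: norm_continuous.
have pncont t : 0 <= t <= 1 -> chart_dom i (c t) -> {for t, continuous (fun s => `|p s|)}.
  move=> t01 ti; apply: (@continuous_comp _ _ _ p (fun u : V => `|u|)); first exact: pcont.
  exact: norm_continuous.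
have below (f : R -> R) (t C : R) : {for t, continuous f} -> f t < C -> \forall s \near t, f s < C.
  by move=> fc ftC; exact: (cvgr_lt (f t) fc).
have above (f : R -> R) (t C : R) : {for t, continuous f} -> C < f t -> \forall s \near t, C < f s.
  by move=> fc ftC; exact: (cvgr_gt (f t) fc).
have s32 : 3 / 2 * `|xi| < 2 * `|xi| by rewrite ltr_pM2r//; lra.
apply: interval_induction.
- split; [by rewrite c0|by rewrite c0 subrr normr0 mulr_ge0|].
  by rewrite -/x -/p p0 ler_peMl// ler1n.
- move=> T /andP[T0 T1] GT; have T01 : 0 <= T <= 1 by rewrite T0 ltW.
  have [h1 h2] := improve T T01 GT.
  have [Ti _ _] := GT T (introT andP (conj T0 (lexx _))).
  have n1 : \forall s \near T, chart_dom i (c s).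
    by apply: (cc _ T01); apply: open_nbhs_nbhs; split => //; exact: chart_dom_open.
  have n2 := below _ _ _ (xncont _ T01 Ti) (le_lt_trans h1 s32).
  have n3 := below _ _ _ (pncont _ T01 Ti) (le_lt_trans h2 s32).
  by apply: filterS3 n1 n2 n3 => s ? ? ?; split => //; exact: ltW.
- move=> T /andP[T0 T1] GT; have T01 : 0 <= T <= 1 by rewrite ltW.
  (* The chart domain is open and could be left exactly at T; the closed ball that contains the
     earlier points prevents this. *)
  have Ti : chart_dom i (c T).
    pose Kb := [set q : M | chart_dom i q /\ `|chart i q - x0| <= r].
    have Kc : closed Kb by exact: closed_chart_ball.
    suff : Kb (c T) by case.
    apply: contrapT => nK.
    have nn : \forall s \near T, ~ Kb (c s).
      have nbK : nbhs (c T) (~` Kb).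
        by apply: open_nbhs_nbhs; split; [exact: closed_openC|].
      exact: (cc _ T01 _ nbK).
    have [t [ti h _] nt] := left_witness T0 GT nn.
    by apply: nt; split => //; exact: le_trans h xir.
  split => //.
  + rewrite leNgt; apply/negP => h.
    have [t [_ h1 _]] := left_witness T0 GT (above _ _ _ (xncont _ T01 Ti) h).
    by rewrite ltNge h1.
  + rewrite leNgt; apply/negP => h.
    have [t [_ _ h1]] := left_witness T0 GT (above _ _ _ (pncont _ T01 Ti) h).
    by rewrite ltNge h1.
Qed.

Lemma gram_christoffel_bound J : jGa J = tGa (gram g i) x0 -> jG J = tG (gram g i) x0 ->
  exists2 C, 0 <= C & \forall y \near (0 : V),
    [/\ forall u w, `|Gax (gram g i) (x0 + y) u w - jGa J u w - jG J y u w|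
          <= C * `|y| ^+ 2 * `|u| * `|w|,
        forall u w, `|Gax (gram g i) (x0 + y) u w| <= C * `|u| * `|w| &
        chart_image i (x0 + y)].
Proof.
move=> GaE GE.
have [C C0 HC] := christoffel_taylor (@chart_image_openE _ _ M i) (gram_pos g (i:=i)) (gram_Ck g i) x0i.
pose K := C + `|jK J| + `|jK J|.
have K0 : 0 <= K by rewrite !addr_ge0.
exists K => //.
apply: filterS3 HC (open_near0 (@chart_image_openE _ _ M i) x0i) (ball_near0 ltr01 (fun y (h : `|y| < 1) => h)).
move=> y Hy yU y1; rewrite -GaE -GE in Hy; split => // u w.
  apply: le_trans (Hy u w) _; rewrite !ler_wpM2r ?exprn_ge0//.
  by rewrite /K -addrA lerDl addr_ge0.
have h1 : `|jGa J u w| <= `|jK J| * `|u| * `|w|.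
  by apply: le_trans (jGa_le _ _ _) _; rewrite !ler_wpM2r// ler_norm.
have h2 : `|jG J y u w| <= `|jK J| * `|u| * `|w|.
  apply: le_trans (jG_le _ _ _ _) _; rewrite !ler_wpM2r//.
  apply: (@le_trans _ _ (`|jK J| * `|y|)); first by rewrite ler_wpM2r// ler_norm.
  by rewrite ler_piMr// ltW.
have h3 : `|Gax (gram g i) (x0 + y) u w - jGa J u w - jG J y u w| <= C * `|u| * `|w|.
  apply: le_trans (Hy u w) _; rewrite !ler_wpM2r// ler_piMr//.
  by rewrite expr2 mulr_ile1// ltW.
rewrite -[Gax _ _ _ _](subrK (jGa J u w)) -[_ - _](subrK (jG J y u w)).
apply: le_trans (ler_normD _ _) _; apply: le_trans (lerD (ler_normD _ _) (lexx _)) _.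
by rewrite /K !mulrDl !lerD.
Qed.

(** A solution on ]-T, T[ is slowed down by the factor k = T/2 so as to live on ]-2, 2[, beyond the
    time 1 of the exponential map. The initial velocity passed to [local_ode] is therefore v/k,
    whence the bound (T/2) rho on v. *)
Lemma geodesic_exists : exists2 d, 0 < d & forall v, tangent z v -> `|v i| <= d ->
  exists c, [/\ geodesic g (- 2) 2 c, c 0 = z & velocity c 0 = v].
Proof.
have [r [C [r0 C0 HC]]] := christoffel_lip (@chart_image_openE _ _ M i) (gram_pos g (i:=i)) (gram_Ck g i) x0i.
have [r1 r10 Hr1] := near0_ball (open_near0 (@chart_image_openE _ _ M i) x0i).
pose s := Num.min r r1 / 2.
have m0 : 0 < Num.min r r1 by rewrite lt_min r0.
have s0 : 0 < s by rewrite divr_gt0.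
have sm : s < Num.min r r1 by rewrite /s ltr_pdivrMr// ltr_pMr// ltr1n.
have sr y : `|y| <= s -> `|y| < r by move=> /le_lt_trans/(_ sm); rewrite lt_min => /andP[].
have sr1 y : `|y| <= s -> `|y| < r1 by move=> /le_lt_trans/(_ sm); rewrite lt_min => /andP[].
pose A k a b y := chr (gram g i) k a b (x0 + y).
pose K := (\sum_k \sum_a \sum_b `|A k a b 0|) + C * s.
have K0 : 0 <= K.
  apply: addr_ge0; last by rewrite mulr_ge0// ltW.
  by do 3! (apply: sumr_ge0 => ? _).
have AC k a b y y' : `|y| <= s -> `|y'| <= s -> `|A k a b y - A k a b y'| <= C * `|y - y'|.
  by move=> /sr ys /sr y's; exact: HC.
have AK k a b y : `|y| <= s -> `|A k a b y| <= K.
  move=> ys; have := AC k a b y 0 ys; rewrite normr0 (ltW s0) subr0 => /(_ isT) h.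
  rewrite -[A k a b y](subrK (A k a b 0)) (le_trans (ler_normD _ _))// addrC /K lerD//.
    rewrite (bigD1 k)//= (bigD1 a)//= (bigD1 b)//= -!addrA lerDl.
    by rewrite !addr_ge0//; do 3! (try apply: sumr_ge0 => ? _).
  by apply: le_trans h _; rewrite ler_wpM2l.
have [T [rho [T0 rho0 H]]] := local_ode s0 C0 K0 AC AK.
exists (T / 2 * rho); first by rewrite mulr_gt0// divr_gt0.
move=> v vt vd; pose k := T / 2.
have k0 : 0 < k by rewrite divr_gt0.
have [|y [p [y0 p0 Hyp]]] := H (k^-1 *: v i).
  by rewrite normrZ gtr0_norm ?invr_gt0// ler_pdivrMl.
have tk (t : R) : - 2 < t < 2 -> `|k * t| < T.
  move=> /andP[t1 t2]; rewrite normrM gtr0_norm// /k mulrAC ltr_pdivrMr// ltr_pM2l//.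
  by rewrite ltr_norml t1.
pose x t := x0 + y (k * t); pose q t := k *: p (k * t).
have xi (t : R) : - 2 < t < 2 -> chart_image i (x t).
  by move=> /tk/Hyp[_ _ /sr1 yr]; exact: Hr1.
have xd (t : R) : - 2 < t < 2 -> is_derive t 1 x (q t).
  move=> /tk/Hyp[yd _ _]; rewrite -[q t]add0r; apply: is_deriveD.
  exact: is_derive_rescale.
have qd (t : R) : - 2 < t < 2 -> is_derive t 1 q (- Gax (gram g i) (x t) (q t) (q t)).
  move=> /tk/Hyp[_ pd _]; have := is_deriveZ k (is_derive_rescale pd).
  rewrite (_ : - Gax _ _ _ _ = k *: (k *: - \row_k0 bf (fun a b => A k0 a b (y (k * t))) (p (k * t)) (p (k * t)))) //.
  by apply/rowP => e; rewrite !mxE /q bfZ bfZr; ring.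
exists (fun t => chart_inv i (x t)).
have x0E : x 0 = x0 by rewrite /x mulr0 y0 addr0.
have q0E : q 0 = v i by rewrite /q mulr0 p0 scalerA mulfV ?gt_eqF// scale1r.
have z2 : - 2 < (0 : R) < 2 by rewrite oppr_lt0 ltr0n.
have c0 : chart_inv i (x 0) = z by rewrite x0E /x0 chartK.
split => //.
- exact: (chart_curve_geodesic xi xd qd).
- by rewrite (chart_curve_velocity xi xd)// c0 q0E tvec_ofK.
Qed.

Theorem exp_map_chart J : jGa J = tGa (gram g i) x0 -> jG J = tG (gram g i) x0 ->
  exists C d, [/\ 0 < d, 0 <= C & forall v, tangent z v -> v i != 0 -> `|v i| <= d ->
    chart_dom i (exp_map g z v) /\
    `|chart i (exp_map g z v) - x0 - (v i + (phi2 J (v i) + phi3 J (v i)))| <= C * `|v i| ^+ 4].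
Proof.
move=> GaE GE.
have [d d0 Hd] := geodesic_exists.
have [K K0 /near0_ball[r1 r10 Hr1]] := gram_christoffel_bound GaE GE.
pose r := r1 / 2.
have r0 : 0 < r by rewrite divr_gt0.
have rr y : `|y| <= r -> `|y| < r1.
  by move=> /le_lt_trans; apply; rewrite /r ltr_pdivrMr// ltr_pMr// ltr1n.
have rU y : `|y| <= r -> chart_image i (x0 + y) by move=> /rr/Hr1[].
have GK y u w : `|y| <= r -> `|Gax (gram g i) (x0 + y) u w| <= K * `|u| * `|w|.
  by move=> /rr/Hr1[].
have GT y u w : `|y| <= r -> `|Gax (gram g i) (x0 + y) u w - jGa J u w - jG J y u w|
    <= K * `|y| ^+ 2 * `|u| * `|w|.
  by move=> /rr/Hr1[].
have [C C0 HC] := geodesic_jet (Gx := fun y => Gax (gram g i) (x0 + y)) K0 r0 GT.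
pose dd := Num.min (Num.min 1 d) (Num.min (r / 2) (1 / (8 * (K + 1)))).
have K8 : 0 < 8 * (K + 1) by rewrite mulr_gt0// ltr_wpDl.
exists C, dd; split => //; first by rewrite !lt_min ltr01 d0 !divr_gt0.
move=> v vt v0; rewrite !le_min => /andP[/andP[v1 vd] /andP[vr vK]].
have vr2 : 2 * `|v i| <= r by move: vr; rewrite ler_pdivlMr// mulrC.
have vK8 : 8 * K * `|v i| <= 1.
  move: vK; rewrite ler_pdivlMr// => /(le_trans _); apply.
  by rewrite [leRHS]mulrC ler_wpM2r// ler_wpM2l// lerDl.
(* Existence comes first, so that [xget] does not return its default value; the expansion then
   concerns the geodesic that it selected. *)
have := @xgetPex _ z [set q | exists (a b : R) (c : R -> M),
    [/\ a < 0, 1 < b, geodesic g a b c, c 0 = z & velocity c 0 = v /\ c 1 = q]].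
rewrite -/(exp_map g z v) => H.
have [|a [b [c [a0 b1 gc c0 [cv c1]]]]] := H.
  have [c [gc c0 cv]] := Hd v vt vd.
  by exists (c 1), (- 2), 2, c; split => //; rewrite ?oppr_lt0 ?ltr0n ?ltr1n.
have vE : v i = velocity c 0 i by rewrite cv.
have A := geodesic_apriori r0 K0 rU GK a0 b1 gc c0 vE v0 vr2 vK8.
rewrite -c1; have [|c1i _ _] := A 1; first by rewrite ler01 lexx.
split => //.
have ab (t : R) : 0 <= t <= 1 -> a < t < b.
  by move=> /andP[t0 t1]; rewrite (lt_le_trans a0 t0) (le_lt_trans t1 b1).
apply: (HC (v i) (fun t => chart i (c t) - x0) (derive1 (fun s => chart i (c s)))) => //.
- by rewrite c0 subrr.
- by rewrite vE velocity_chart// c0.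
- move=> t t01; have [ti _ _] := A t t01; have [_ /(_ i ti)[xd _ _]] := gc t (ab _ t01).
  rewrite -[derive1 _ t]subr0; apply: is_deriveB.
  by split; [exact: xd|rewrite -derive1E].
- move=> t t01; have [ti _ _] := A t t01; have [_ /(_ i ti)[_ pd E]] := gc t (ab _ t01).
  split; first exact: pd.
  rewrite -derive1E addrC subrK; apply/rowP => k; rewrite !mxE; have := E k.
  by move=> /eqP; rewrite addr_eq0 => /eqP.
- by move=> t t01; have [] := A t t01.
Qed.
End ExpMap.

(** * Lengths of curves *)

Section Integrals.
Context {R : realType}.
Local Notation mu := (@lebesgue_measure R).
Import HBNNSimple.

(* No measurability is needed, an integral of a nonnegative function being a
   supremum over the simple functions below it. *)
Lemma ge0_le_integral_any (D : set R) (f h : R -> \bar R) :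
  (forall t, D t -> 0 <= f t)%E -> (forall t, D t -> f t <= h t)%E ->
  (\int[mu]_(t in D) f t <= \int[mu]_(t in D) h t)%E.
Proof.
move=> f0 fh.
have h0 t : D t -> (0 <= h t)%E by move=> Dt; exact: le_trans (f0 _ Dt) (fh _ Dt).
rewrite !ge0_integralE//; apply: ereal_sup_le => _ [s sf <-] /=.
exists s => // t; apply: le_trans (sf t) _; rewrite /patch; case: ifPn => //.
by rewrite inE; exact: fh.
Qed.

(** Only the continuous majorant s is integrated: for an antiderivative G of s, the function G - F
    has a nonnegative derivative. *)
Lemma le_integral_of_derive (F dF s : R -> R) (a b : R) : a < b ->
  (forall t, a <= t <= b -> {for t, continuous s}) ->
  (forall t : R, a <= t <= b -> is_derive t 1 F (dF t)) ->
  (forall t, a <= t <= b -> dF t <= s t) ->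
  ((F b - F a)%:E <= \int[mu]_(t in `[a, b]) (s t)%:E)%E.
Proof.
move=> ab sc Fd Fs; have ab' := ltW ab.
(* Clamping the time to [a, b] extends s continuously to the whole line, as [antiderivative]
   requires. *)
pose k (t : R) := Num.max a (Num.min t b).
have kab t : a <= k t <= b.
  by rewrite /k le_max lexx /= ge_max ab' ge_min lexx orbT.
have kid t : a <= t <= b -> k t = t.
  by move=> /andP[at1 tb]; rewrite /k min_l// max_r.
have sk : continuous (s \o k).
  move=> t; apply: continuous_comp; last exact: sc.
  apply: (@continuous_max _ _ (cst a) (fun t => Num.min t b)); first exact: cst_continuous.
  by apply: (@continuous_min _ _ id (cst b)) => //; exact: cst_continuous.
have [G _ Gd] := antiderivative (1 + `|a| + `|b|) sk.
have Gd' (t : R) : a <= t <= b -> is_derive t 1 G (s t).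
  move=> tab; rewrite -[in s t](kid _ tab); apply: Gd; rewrite ltr_norml.
  have [h1 h2 h3 h4] : [/\ a <= `|a|, - a <= `|a|, b <= `|b| & - b <= `|b|].
    by split; rewrite ?ler_norm// -normrN ler_norm.
  by case/andP: tab => *; apply/andP; split; lra.
have Gc t : a <= t <= b -> {for t, continuous G}.
  by move=> /Gd' h; apply: differentiable_continuous; apply/derivable1_diffP; case: h.
rewrite (@continuous_FTC2 _ s G)//; first last.
- by move=> t; rewrite in_itv /= derive1E => /andP[h1 h2]; case: (Gd' t _) => //; rewrite !ltW.
- split.
  + by move=> t; rewrite in_itv /= => /andP[h1 h2]; case: (Gd' t _) => //; rewrite !ltW.
  + by apply: cvg_at_right_filter; apply: Gc; rewrite lexx.
  + by apply: cvg_at_left_filter; apply: Gc; rewrite lexx andbT.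
- by apply: continuous_in_subspaceT => t; rewrite inE /= in_itv /=; exact: sc.
rewrite lee_fin.
have [||c cab E] := @MVT_segment R (fun t => G t - F t) (fun t => s t - dF t) a b ab'.
- move=> t; rewrite in_itv/= => /andP[h1 h2].
  have tab : a <= t <= b by rewrite !ltW.
  exact: (is_deriveB (Gd' _ tab) (Fd _ tab)).
- apply: derivable_within_continuous => t; rewrite in_itv/= => tab.
  by have [] := is_deriveB (Gd' _ tab) (Fd _ tab).
rewrite -subr_ge0 (_ : _ - _ = (s c - dF c) * (b - a)); last by rewrite -E; ring.
by rewrite mulr_ge0// subr_ge0 ?Fs// ltW.
Qed.
End Integrals.

(** * Upper and lower bounds for lengths of piecewise C^1 curves *)

Section Lengths.
Context {R : realType} {n : nat} {M : manifold R n} (g : riemannian_metric M).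
Local Notation V := 'rV[R]_n.
Local Notation mu := (@lebesgue_measure R).
Implicit Types (i : chart_index M) (p q : M) (x : V).

Lemma speed_ge0 p (v : tvec M) : (0 <= (tnorm g p v)%:E)%E.
Proof. by rewrite lee_fin sqrtr_ge0. Qed.

Lemma integral01_cst (B : R) : (\int[mu]_(t in `[0%R, 1%R]) B%:E = B%:E)%E.
Proof. by rewrite integral_cst//= lebesgue_measure_itv /= lte01 oppr0 adde0 mule1. Qed.

Lemma chart_segment_dist i (e B : R) (X W : R -> V) : 0 < e -> 0 <= B ->
  (forall t, - e < t < 1 + e -> chart_image i (X t)) ->
  (forall t : R, - e < t < 1 + e -> is_derive t 1 X (W t)) ->
  (forall t, - e < t < 1 + e -> {for t, continuous W}) ->
  (forall t, 0 <= t <= 1 -> bf (gram g i (X t)) (W t) (W t) <= B ^+ 2) ->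
  (riemannian_dist g (chart_inv i (X 0%R)) (chart_inv i (X 1%R)) <= B%:E)%E.
Proof.
move=> e0 B0 Xi Xd Wc WB; pose c t := chart_inv i (X t).
have int t : 0 <= t <= 1 -> - e < t < 1 + e.
  by move=> /andP[t0 t1]; rewrite (lt_le_trans _ t0) ?oppr_lt0// (le_lt_trans t1)// ltrDl.
apply: (@le_trans _ _ (curve_length g c)).
  apply: ereal_inf_lbound; exists c => //; split => //; exists [:: 1]; split => //=.
    by rewrite ltr01.
  case=> // _ /=; exists e, c; split => //; rewrite sub0r; exact: (chart_curve_C1 Xi Xd Wc).
rewrite -[leRHS]integral01_cst; apply: ge0_le_integral_any => t /=; first by move=> _; exact: speed_ge0.
rewrite in_itv /= => t01; have ti := int t t01.
have [ci cE] := chart_image_inv (Xi t ti).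
rewrite lee_fin /tnorm (chart_curve_velocity Xi Xd ti) metric_tvec_of// cE.
by rewrite -[leRHS]ger0_norm// -sqrtr_sqr ler_wsqrtr// WB.
Qed.
(** On a closed piece the speed of the C^1 extension is continuous. It is identified with the speed
    of c in the interior only, since at a breakpoint the derivative of c also involves the
    neighbouring piece. *)
Lemma C1_segment_speed (al be b' : R) c i : C1_segment al be c -> al < b' <= be ->
  (forall t, al <= t <= b' -> chart_dom i (c t)) ->
  exists (x p : R -> V) (s : R -> R), [/\ (forall t, al <= t <= b' -> x t = chart i (c t)),
    (forall t : R, al <= t <= b' -> is_derive t 1 x (p t)),
    (forall t, al <= t <= b' -> s t = Num.sqrt (bf (gram g i (x t)) (p t) (p t))),
    (forall t, al <= t <= b' -> {for t, continuous s}) &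
    (forall t, al < t < b' -> s t = tnorm g (c t) (velocity c t))].
Proof.
move=> [e [c' [e0 C1 cE]]] /andP[alb b'be] ci.
pose x s := chart i (c' s); pose p := derive1 x.
have tbe t : al <= t <= b' -> al <= t <= be by move=> /andP[-> /le_trans->].
have tC1 t : al <= t <= b' -> al - e < t < be + e.
  by move=> /andP[h1 h2]; apply/andP; split; lra.
have c'i t : al <= t <= b' -> chart_dom i (c' t).
  by move=> tab; rewrite -cE ?tbe//; exact: ci.
have xd t : al <= t <= b' -> derivable x t 1.
  by move=> tab; exact: ((C1 t (tC1 t tab)).2 i (c'i t tab)).1.
have pc t : al <= t <= b' -> {for t, continuous p}.
  by move=> tab; exact: ((C1 t (tC1 t tab)).2 i (c'i t tab)).2.
exists x, p, (fun t => Num.sqrt (bf (gram g i (x t)) (p t) (p t))); split.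
- by move=> t tab; rewrite /x cE ?tbe.
- by move=> t tab; rewrite /p derive1E; exact/derivableP/xd.
- by [].
- move=> t tab; have xc : {for t, continuous x}.
    by apply: differentiable_continuous; apply/derivable1_diffP; exact: xd.
  apply: (@continuous_comp _ _ _ (fun t => bf (gram g i (x t)) (p t) (p t)) Num.sqrt); last exact: sqrt_continuous.
  apply: for_continuous_sum => a; apply: for_continuous_sum => b.
  have pca k : {for t, continuous (fun t => p t 0 k)} by apply: continuous_coord; exact: pc.
  apply: (@continuousM _ _ (fun t => gram g i (x t) a b * p t 0 a) (fun t => p t 0 b)); last exact: pca.
  apply: (@continuousM _ _ (fun t => gram g i (x t) a b) (fun t => p t 0 a)); last exact: pca.
  apply: (@continuous_comp _ _ _ x (fun x => gram g i x a b)); first exact: xc.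
  by apply: (Ck_continuous (gram_Ck g i 0 a b)); apply: chart_in_image; exact: c'i.
- move=> t tab; have tab' : al <= t <= b' by case/andP: tab => /ltW -> /ltW ->.
  have [cc _] := C1 t (tC1 t tab').
  have ct : c' t = c t by rewrite cE//; exact: tbe.
  have vE : velocity c' t = velocity c t.
    apply/funext => j; rewrite /velocity /at_charts ct; case: asboolP => _; last by [].
    rewrite !derive1E; apply: near_eq_derive; near=> s.
    congr (chart j _); apply/esym/cE; near: s; apply: filterS (near_itv tab) => s /andP[h1 h2].
    by rewrite (ltW h1) (le_trans (ltW h2)).
  rewrite -ct -vE; exact: (esym (speed_chart g cc (c'i t tab') (xd t tab'))).
Unshelve. all: by end_near.
Qed.
Section LowerBound.
Variables (i : chart_index M) (f : V -> R) (df : V -> V -> R) (c : R -> M) (T : R).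
Hypotheses
  (fd : forall (x : R -> V) (s : R) u, is_derive s 1 x u -> is_derive s 1 (fun s => f (x s)) (df (x s) u))
  (ci : forall t, 0 <= t <= T -> chart_dom i (c t))
  (fg : forall t, 0 <= t <= T -> forall u,
     df (chart i (c t)) u <= Num.sqrt (bf (gram g i (chart i (c t))) u u)).
(** Freezing the curve at time T makes the increments of F over all pieces of [0, 1] add up to the
    increment of f between 0 and T. *)
Let F t := f (chart i (c (Num.min t T))).
Let sp t := ((tnorm g (c t) (velocity c t))%:E : \bar R).

(** The integral is additive on measurable functions. Each piece therefore receives a measurable
    minorant of the speed, supported in its interior; the minorants are summed, and their sum is
    compared with the speed at the end. *)
Let piece al be : 0 <= al -> al < be -> be <= 1 -> C1_segment al be c ->
  exists h : R -> \bar R, [/\ measurable_fun setT h, (forall t, (0 <= h t)%E),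
    (forall t, (h t <= sp t)%E), (forall t, ~~ (al < t < be) -> h t = 0%E) &
    ((F be - F al)%:E <= \int[mu]_(t in `[0%R, 1%R]) h t)%E].
Proof.
move=> al0 albe be1 seg; have [Tal|alT] := leP T al.
  exists (cst 0%E); split => //=; first by move=> t; exact: speed_ge0.
  by rewrite integral0 /F !min_r ?subrr//; exact: le_trans (ltW albe).
pose b' := Num.min be T.
have alb' : al < b' by rewrite lt_min albe.
have b'be : b' <= be by rewrite ge_min lexx.
have b'T : b' <= T by rewrite ge_min lexx orbT.
have ci' t : al <= t <= b' -> 0 <= t <= T.
  by move=> /andP[h1 h2]; rewrite (le_trans al0 h1) (le_trans h2).
have [||x [p [s [xE xd sE sc sS]]]] := @C1_segment_speed al be b' c i seg.
- by rewrite alb'.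
- by move=> t /ci'; exact: ci.
have le_int := @le_integral_of_derive R (fun t => f (x t)) (fun t => df (x t) (p t)) s al b' alb' sc.
have lab : al <= al <= b' by rewrite lexx ltW.
have lbb : al <= b' <= b' by rewrite lexx ltW.
have D : `]al, b'[%classic `<=` `[0, 1]%classic.
  move=> t /=; rewrite !in_itv /= => /andP[h1 h2].
  by rewrite (le_trans al0 (ltW h1)) (le_trans (ltW h2))// (le_trans b'be).
have sm : measurable_fun `]al, b'[ (fun t => (s t)%:E).
  apply/measurable_EFinP; apply: open_continuous_measurable_fun; first exact: interval_open.
  by move=> t; rewrite inE /= in_itv /= => /andP[h1 h2]; apply: sc; rewrite !ltW.
exists ((fun t => (s t)%:E) \_ `]al, b'[); split.
- exact/(measurable_restrictT _ _).1.
- move=> t; rewrite patchE; case: ifPn => // tab.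
  move: tab; rewrite inE /= in_itv /= => /sS ->; exact: speed_ge0.
- move=> t; rewrite patchE; case: ifPn => [|_]; last exact: speed_ge0.
  by rewrite inE /= in_itv /= => /sS ->.
- move=> t tab; rewrite patchE; case: ifPn => //; rewrite inE /= in_itv /= => /andP[h1 h2].
  by case/negP: tab; rewrite h1 (lt_le_trans h2).
- rewrite -integral_mkcondr (_ : _ `&` _ = `]al, b'[%classic); last exact/setIidPr.
  rewrite -(integral_itv_bndoo true false)//.
  rewrite /F (min_l (ltW alT)) -/b' -(xE _ lab) -(xE _ lbb); apply: le_int.
    by move=> t tab; apply: fd; exact: xd.
  by move=> t tab; rewrite sE// xE//; apply: fg; exact: ci'.
Qed.

Lemma curve_length_ge p q : piecewise_C1 p q c -> 0 <= T <= 1 ->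
  ((f (chart i (c T)) - f (chart i p))%:E <= curve_length g c)%E.
Proof.
move=> [c0 _ [s [sp0 s1 seg]]] /andP[T0 T1].
pose b k := nth 0 (0 :: s) k.
have bS k : (k < size s)%N -> b k < b k.+1.
  by move=> ks; exact: (((pathP 0 (x:=0) (p:=s) (e:=<%R)) sp0) k ks).
have bm k l : (k <= l <= size s)%N -> b k <= b l.
  move=> /andP[kl ls]; elim: l kl ls => [|l IH]; first by case: k.
  rewrite leq_eqVlt => /predU1P[->//|kl] ls; apply: le_trans (IH _ (ltnW ls)) (ltW (bS _ _)) => //.
have b01 k : (k <= size s)%N -> 0 <= b k <= 1.
  move=> ks; have /= -> := bm 0 k; last by rewrite ks.
  have := bm k (size s); rewrite ks leqnn => /(_ isT).
  by rewrite /b nth_last /= s1.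
have H k : (k <= size s)%N -> exists h : R -> \bar R, [/\ measurable_fun setT h,
    (forall t, (0 <= h t)%E), (forall t, (h t <= sp t)%E), (forall t, ~~ (t < b k) -> h t = 0%E) &
    ((F (b k) - F 0)%:E <= \int[mu]_(t in `[0%R, 1%R]) h t)%E].
  elim: k => [_|k IH ks].
    exists (cst 0%E); split => //=; first by move=> t; exact: speed_ge0.
    by rewrite integral0 subrr.
  have [h [hm h0 hs hb hF]] := IH (ltnW ks).
  have [||||h' [hm' h0' hs' hb' hF']] := @piece (b k) (b k.+1).
  - by case/andP: (b01 _ (ltnW ks)).
  - exact: bS.
  - by case/andP: (b01 _ ks).
  - exact: seg.
  exists (fun t => h t + h' t)%E; split.
  - exact: emeasurable_funD.
  - by move=> t; exact: adde_ge0.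
  - move=> t; have [tk|tk] := ltP t (b k).
      by rewrite hb' ?adde0 ?hs//; rewrite negb_and -leNgt ltW.
    by rewrite hb ?add0e ?hs'// -leNgt.
  - move=> t tk; rewrite hb ?hb' ?adde0//; first by rewrite negb_and tk orbT.
    by apply: contra tk => tk; exact: lt_trans tk (bS _ _).
  - rewrite ge0_integralD//; try by apply: measurable_funTS.
    apply: le_trans (leeD hF hF'); rewrite -EFinD lee_fin; lra.
have [h [hm h0 hs hb hF]] := H _ (leqnn _).
have -> : c T = c (Num.min 1 T) by rewrite min_r.
rewrite -c0 -[c 0](_ : c (Num.min 0 T) = _); last by rewrite min_l.
move: hF; rewrite /b nth_last /= s1 => /le_trans; apply.
by apply: ge0_le_integral_any.
Qed.
End LowerBound.
(** Continuity relative to [0, 1], outside which the values of c are arbitrary. Near T the closed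
    pieces containing T are continuous there, and the others are avoided. *)
Lemma piecewise_C1_continuous p q c (T : R) (O : set M) : piecewise_C1 p q c -> 0 <= T <= 1 ->
  nbhs (c T) O -> \forall t \near T, 0 <= t <= 1 -> O (c t).
Proof.
move=> [_ _ [s [_ s1 seg]]] T01 cO.
pose b k := nth 0 (0 :: s) k.
have piece k : (k < size s)%N -> \forall t \near T, b k <= t <= b k.+1 -> O (c t).
  move=> ks; have [e [c' [e0 C1 cE]]] := seg k ks.
  have [Tk|Tk] := boolP (b k <= T <= b k.+1); last first.
    have : (~` `[b k, b k.+1]%classic) T by rewrite /= in_itv /=; exact/negP.
    have : open (~` `[b k, b k.+1]%classic) by apply: closed_openC; exact: interval_closed.
    move=> o1 o2; apply: filterS (open_nbhs_nbhs (conj o1 o2)) => t /=.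
    by rewrite in_itv /= => h /h.
  have Tk' : b k - e < T < b k.+1 + e.
    by case/andP: Tk => h1 h2; apply/andP; split; move: h1 h2; rewrite /b; lra.
  have [cc _] := C1 _ Tk'.
  rewrite (cE _ Tk) in cO; have ccO : \forall t \near T, O (c' t) by exact: cc.
  apply: filterS ccO => t ct tk.
  by rewrite (cE _ tk).
have H k : (k <= size s)%N -> \forall t \near T, 0 <= t <= b k -> O (c t).
  elim: k => [_|k IH ks].
    have [T0|T0] := eqVneq T 0.
      rewrite T0 in cO; apply: filterE => t t0.
      by rewrite (le_anti (_ : t <= 0 <= t)); [exact: nbhs_singleton|rewrite andbC].
    have o1 : open (~` [set (0 : R)]) by apply: closed_openC; exact: closed_eq.
    have o2 : (~` [set (0 : R)]) T by apply/eqP.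
    apply: filterS (open_nbhs_nbhs (conj o1 o2)) => t /= h t0; case: h.
    by apply: le_anti; rewrite andbC.
  apply: filterS2 (IH (ltnW ks)) (piece k ks) => t h1 h2 /andP[t0 tk].
  by have [tb|tb] := leP t (b k); [apply: h1|apply: h2]; rewrite ?t0// (ltW tb).
have := H _ (leqnn _); rewrite /b nth_last /= s1; exact.
Qed.

(** If no time T is an exit, then at each time reached inside the ball the coordinates are at
    distance less than r, so that staying is an open condition; it is closed by
    [closed_chart_ball]. *)
Lemma exit_or_stay i z (r : R) p q c (x0 := chart i z) : (forall y, `|y| <= r -> chart_image i (x0 + y)) ->
  piecewise_C1 p q c -> chart_dom i p -> `|chart i p - x0| <= r ->
  (forall t, 0 <= t <= 1 -> chart_dom i (c t) /\ `|chart i (c t) - x0| <= r) \/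
  exists T, [/\ 0 <= T <= 1, (forall t, 0 <= t <= T -> chart_dom i (c t) /\ `|chart i (c t) - x0| <= r)
    & r <= `|chart i (c T) - x0|].
Proof.
move=> rU cpc pi pr; have [c0 _ _] := cpc.
pose K q := chart_dom i q /\ `|chart i q - x0| <= r.
have Kc : closed [set q | K q] by exact: closed_chart_ball.
have [[T [T01 KT rT]]|noexit] := pselect (exists T, [/\ 0 <= T <= 1, (forall t, 0 <= t <= T -> K (c t))
    & r <= `|chart i (c T) - x0|]); first by right; exists T.
(* The guard [0 <= t <= 1] goes under the induction, because neighbourhoods of T reach outside the
   interval where c is controlled. *)
left => t t01; suff /(_ t01) : 0 <= t <= 1 -> K (c t) by [].
move: t t01; apply: interval_induction.
- by move=> _; rewrite c0.
- move=> T /andP[T0 T1] KT.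
  have T01 : 0 <= T <= 1 by rewrite T0 ltW.
  have KT' t : 0 <= t <= T -> K (c t).
    by move=> tT; apply: KT => //; case/andP: tT => -> /le_trans -> //; exact: ltW.
  have [Ti _] : K (c T) by apply: KT'; rewrite T0 lexx.
  have Tr : `|chart i (c T) - x0| < r.
    by rewrite ltNge; apply/negP => h; apply: noexit; exists T.
  apply: (piecewise_C1_continuous cpc T01 (O := [set q | K q])).
  have di : nbhs (c T) (chart_dom i) by apply: open_nbhs_nbhs; split => //; exact: chart_dom_open.
  have nr : nbhs (c T) [set q | `|chart i q - x0| < r].
    have nb : {for c T, continuous (fun q => `|chart i q - x0|)}.
      apply: (@continuous_comp _ _ _ (chart i) (fun x => `|x - x0|)); first exact: chart_continuous.
      apply: (@continuous_comp _ _ _ (fun x => x - x0) (fun x => `|x|)); last exact: norm_continuous.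
      by apply: (@continuousB _ _ _ id (cst x0)) => //; exact: cst_continuous.
    by have := cvgr_lt _ nb _ Tr; apply.
  by apply: filterS2 di nr => q' h1 h2; split => //; exact: ltW.
- move=> T /andP[T0 T1] KT T01; apply: contrapT => nK.
  have o : nbhs (c T) (~` [set q | K q]) by apply: open_nbhs_nbhs; split => //; exact: closed_openC.
  have KT' t : 0 <= t < T -> 0 <= t <= 1 /\ K (c t).
    move=> /andP[t0 tT]; have t01 : 0 <= t <= 1.
      by apply/andP; split => //; exact: le_trans (ltW tT) T1.
    by split => //; apply: KT => //; rewrite t0.
  have [t [t0 Kt] h] := left_witness T0 KT' (piecewise_C1_continuous cpc T01 o).
  exact: (h t0).
Qed.
End Lengths.

(** * The distance estimate *)

Section VelocityContinuity.
Context {R : realType} {n : nat} (J : jet R n).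
Local Notation V := 'rV[R]_n.

Lemma is_derive_continuous (W : normedModType R) (f : R -> W) (t : R) d :
  is_derive t 1 f d -> {for t, continuous f}.
Proof. by case=> fd _; apply: differentiable_continuous; exact/derivable1_diffP. Qed.

Lemma continuous_dphi (xi u w : V) (t : R) :
  {for t, continuous (fun s : R => u + (dphi2 J (xi + s *: u) u + (dphi3 J (xi + s *: u) u + w)))}.
Proof.
have xd := is_derive_affine xi u t.
have ud : is_derive t 1 (fun _ : R => u) 0 by exact: is_derive_cst.
have wd : is_derive t 1 (fun _ : R => w) 0 by exact: is_derive_cst.
have h1 := is_derive_jGa J xd ud; have h2 := is_derive_jGa J xd h1.
have h3 := is_derive_jGa J ud (is_derive_jGa J xd xd).
have h4 := is_derive_jG J ud xd xd; have h5 := is_derive_jG J xd xd ud.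
apply: is_derive_continuous (is_deriveD ud (is_deriveD (is_deriveN h1) (is_deriveD
  (is_deriveZ 6^-1 (is_deriveB (is_deriveB (is_deriveD (is_deriveZ 4 h2) (is_deriveZ 2 h3)) h4)
     (is_deriveZ 2 h5))) wd))).
Qed.
End VelocityContinuity.

(** * Two-sided estimate of the distance *)

Section DistanceEstimate.
Context {R : realType} {n : nat} (M : manifold R n) (g : riemannian_metric M).
Local Notation V := 'rV[R]_n.
Variables (i : chart_index M) (z : M) (zi : chart_dom i z) (J : jet R n).
Let x0 := chart i z.
Let x0i : chart_image i x0 := chart_in_image zi.
Hypothesis HT : exists2 C, 0 <= C & \forall y \near (0 : V), forall u w,
  `|bf (gram g i (x0 + y)) u w - (jg J u w + jB J y u w + 2^-1 * jH J y y u w)|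
    <= C * `|y| ^+ 3 * `|u| * `|w|.

Definition phi (xi e : V) : V := xi + (phi2 J xi + (phi3 J xi + e)).

Lemma dist_upper (E : R) : 0 <= E -> exists C d, [/\ 0 < d, 0 <= C &
  forall xi eta e1 e2 m, `|xi| <= m -> `|eta| <= m -> m <= d ->
    `|e1| <= E * m ^+ 4 -> `|e2| <= E * m ^+ 4 ->
    exists B, [/\ 0 <= B,
      B ^+ 2 <= jg J (eta - xi) (eta - xi) - 3^-1 * jQ J xi eta + C * m ^+ 5 &
      (riemannian_dist g (chart_inv i (x0 + phi xi e1)) (chart_inv i (x0 + phi eta e2)) <= B%:E)%E]].
Proof.
move=> E0; have [C [d [d0 C0 H]]] := upper_estimate HT E0.
have [r r0 Hr] := near0_ball (open_near0 (@chart_image_openE _ _ M i) x0i).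
exists C, (Num.min d (r / (C + 1))); split => //.
  by rewrite lt_min d0 divr_gt0// ltr_wpDl.
move=> xi eta e1 e2 m xim etam; rewrite le_min => /andP[md mr] e1m e2m.
pose u := eta - xi; pose x (t : R) := xi + t *: u.
pose y (t : R) := x t + (phi2 J (x t) + (phi3 J (x t) + (e1 + t *: (e2 - e1)))).
pose w (t : R) := u + (dphi2 J (x t) u + (dphi3 J (x t) u + (e2 - e1))).
have m0 : 0 <= m by apply: le_trans xim.
have Ht (t : R) : -1 < t < 1 + 1 -> `|y t| <= C * m /\
    `|bf (gram g i (x0 + y t)) (w t) (w t) - (jg J u u - 3^-1 * jQ J xi eta)| <= C * m ^+ 5.
  move=> t12; apply: H => //; rewrite ler_norml; case/andP: t12 => *; apply/andP; split; lra.
pose B2 := jg J u u - 3^-1 * jQ J xi eta + C * m ^+ 5.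
have yi t : -1 < t < 1 + 1 -> chart_image i (x0 + y t).
  move=> t12; apply: Hr; apply: le_lt_trans (Ht t t12).1 _.
  have [->|mn0] := eqVneq m 0; first by rewrite mulr0.
  move: mr; rewrite ler_pdivlMr ?ltr_wpDl//; apply: lt_le_trans.
  by rewrite mulrC ltr_pM2l ?ltrDl// lt_neqAle eq_sym mn0.
have bfB t : 0 <= t <= 1 -> bf (gram g i (x0 + y t)) (w t) (w t) <= B2.
  move=> /andP[t0 t1]; have : -1 < t < 1 + 1 by apply/andP; split; lra.
  move=> /Ht[_]; rewrite ler_norml /B2 => /andP[_]; lra.
(* B2 dominates a squared speed, so that its square root is a genuine bound. *)
have B20 : 0 <= B2.
  have t0 : 0 <= (0 : R) <= 1 by rewrite lexx ler01.
  apply: le_trans (bfB 0 t0); have [->|w0] := eqVneq (w 0) 0; first by rewrite bf0l.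
  apply/ltW/gram_pos => //; apply: yi; apply/andP; split; lra.
exists (Num.sqrt B2); split; [exact: sqrtr_ge0|by rewrite sqr_sqrtr|].
have yE0 : y 0 = phi xi e1 by rewrite /y /x !scale0r !addr0.
have yE1 : y 1 = phi eta e2 by rewrite /y /x !scale1r !(addrC _ (_ - _)) !subrK.
rewrite -yE0 -yE1.
apply: (@chart_segment_dist _ _ _ g i 1 _ (fun t => x0 + y t) w).
- exact: ltr01.
- exact: sqrtr_ge0.
- exact: yi.
- move=> t t12; have := is_deriveD (is_derive_cst x0 t 1) (is_derive_phi J xi u (is_derive_affine e1 (e2 - e1) t)).
  by rewrite add0r.
- by move=> t t12; exact: continuous_dphi.
- by move=> t t01; rewrite sqr_sqrtr// bfB.
Qed.
(** Near z, by [metric_coercive], kappa times the sup norm is at most the Riemannian norm. *)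
Let kappa := Num.sqrt (2^-1 * jc J).

Let kappa_gt0 : 0 < kappa.
Proof. by rewrite sqrtr_gt0 mulr_gt0 ?jc_gt0. Qed.

(** A signed coordinate, multiplied by kappa, is 1-Lipschitz for the metric along the curve, so its
    growth bounds the length from below. *)
Lemma exit_length : exists2 r, 0 < r & forall rho delta p q c T, 0 < rho <= r ->
  chart_dom i p -> `|chart i p - x0| <= delta -> piecewise_C1 p q c -> 0 <= T <= 1 ->
  (forall t, 0 <= t <= T -> chart_dom i (c t) /\ `|chart i (c t) - x0| <= rho) ->
  rho <= `|chart i (c T) - x0| -> ((kappa * (rho / 2 - delta))%:E <= curve_length g c)%E.
Proof.
have /near0_ball[r r0 Hr] := metric_coercive HT.
exists (r / 2); first by rewrite divr_gt0.
move=> rho delta p q c T /andP[rho0 rhor] pi pd cpq T01 cK rT.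
(* The sup norm is at least rho, which exceeds rho/2; so some coordinate exceeds rho/2. *)
have [a ha] : exists a, rho / 2 < `|(chart i (c T) - x0) 0 a|.
  apply: contrapT => h; have : `|chart i (c T) - x0| <= rho / 2.
    apply: rv_norm_le => [|a]; first by rewrite divr_ge0// ltW.
    by rewrite leNgt; apply/negP => h'; apply: h; exists a.
  by move: rT; lra.
pose b := (chart i (c T) - x0) 0 a; pose sg := Num.sg b.
have sgb : sg * b = `|b| by rewrite normrEsg.
have sg1 : `|sg| <= 1 by rewrite normr_sg lern1 leq_b1.
have fd (x : R -> V) (s : R) u : is_derive s 1 x u ->
    is_derive s 1 (fun s => sg * kappa * (x s - x0) 0 a) (sg * kappa * u 0 a).
  move=> xd; apply: is_deriveMc; rewrite -[u]subr0.
  exact: (is_derive_rv _ _ _ _).2 (is_deriveB xd (is_derive_cst x0 s 1)) a.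
have dfg t : 0 <= t <= T -> forall u : V,
    sg * kappa * u 0 a <= Num.sqrt (bf (gram g i (chart i (c t))) u u).
  move=> /cK[ci cr] u.
  have -> : chart i (c t) = x0 + (chart i (c t) - x0) by rewrite addrC subrK.
  apply: (@le_trans _ _ (kappa * `|u|)).
    rewrite (mulrC sg) -mulrA ler_pM2l//; apply: le_trans (ler_norm _) _.
    rewrite normrM; apply: le_trans (rv_coord_le u a).
    by rewrite ler_piMl.
  rewrite -[`|u|]ger0_norm// -sqrtr_sqr /kappa -sqrtrM; last by rewrite mulr_ge0// ltW// jc_gt0.
  apply: ler_wsqrtr; apply: Hr; apply: le_lt_trans cr _.
  by apply: le_lt_trans rhor _; rewrite ltr_pdivrMr// ltr_pMr// ltr1n.
have ci t : 0 <= t <= T -> chart_dom i (c t) by move=> /cK[].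
have := @curve_length_ge _ _ _ g i (fun x => sg * kappa * (x - x0) 0 a)
  (fun _ u => sg * kappa * u 0 a) c T fd ci dfg _ _ cpq T01.
apply: le_trans; rewrite lee_fin.
have E1 : sg * kappa * (chart i (c T) - x0) 0 a = kappa * `|b| by rewrite -sgb /b; ring.
rewrite E1 -mulrA (mulrCA sg) -mulrBr ler_pM2l//.
have : sg * (chart i p - x0) 0 a <= delta.
  apply: le_trans (ler_norm _) _; rewrite normrM; apply: le_trans pd.
  apply: le_trans (rv_coord_le _ a); by rewrite ler_piMl.
by move: ha; rewrite -/b; lra.
Qed.

(** Divided by the square root of 1 + C m^3, the calibration has differential at most the Riemannian
    norm along the curve, and [curve_length_ge] applies. *)
Lemma stay_length (rho : R) : 0 <= rho -> exists C d, [/\ 0 < d, 0 <= C &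
  forall e m p q c, jg J e e = 1 -> 0 <= m <= d -> piecewise_C1 p q c ->
  (forall t, 0 <= t <= 1 -> chart_dom i (c t) /\ `|chart i (c t) - x0| <= rho * m) ->
  (((cal J e (chart i q - x0) - cal J e (chart i p - x0)) / Num.sqrt (1 + C * m ^+ 3))%:E
     <= curve_length g c)%E].
Proof.
move=> rho0; have [C [d [d0 C0 H]]] := lower_estimate HT rho0.
exists C, d; split => // e m p q c ee /andP[m0 md] cpq cK.
pose s := Num.sqrt (1 + C * m ^+ 3).
have s2 : 0 < 1 + C * m ^+ 3 by rewrite ltr_pwDl// mulr_ge0// exprn_ge0.
have s0 : 0 < s by rewrite sqrtr_gt0.
have fd (x : R -> V) (t : R) u : is_derive t 1 x u ->
    is_derive t 1 (fun t => s^-1 * cal J e (x t - x0)) (s^-1 * dcal J e (x t - x0) u).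
  move=> xd; apply: is_deriveMc; apply: is_derive_cal; rewrite -[u]subr0.
  exact: (is_deriveB xd (is_derive_cst x0 t 1)).
have dfg t : 0 <= t <= 1 -> forall u : V,
    s^-1 * dcal J e (chart i (c t) - x0) u <= Num.sqrt (bf (gram g i (chart i (c t))) u u).
  move=> /cK[ci cr] u.
  rewrite {2}(_ : chart i (c t) = x0 + (chart i (c t) - x0)); last by rewrite addrC subrK.
  rewrite mulrC ler_pdivrMr//; apply: le_trans (ler_norm _) _.
  rewrite -sqrtr_sqr mulrC /s -sqrtrM; last exact: ltW.
  by apply: ler_wsqrtr; apply: H.
have ci t : 0 <= t <= 1 -> chart_dom i (c t) by move=> /cK[].
have := @curve_length_ge _ _ _ g i (fun x => s^-1 * cal J e (x - x0))
  (fun x u => s^-1 * dcal J e (x - x0) u) c 1 fd ci dfg _ _ cpq; rewrite lexx ler01 => /(_ isT).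
have [_ -> _] := cpq; apply: le_trans.
by rewrite lee_fin -mulrBr mulrC.
Qed.
Lemma jQ_bound : exists2 K, 0 <= K & forall xi u, `|jQ J xi u| <= K * `|xi| ^+ 2 * jg J u u.
Proof.
have [K0 HK] := jR_le J; have c0 := jc_gt0 J.
pose K := `|jK J| * `|K0| / jc J.
exists K; first by rewrite divr_ge0 ?mulr_ge0// ltW.
move=> xi u; apply: le_trans (jg_le _ _ _) _.
have h : `|jR J xi u u| <= `|K0| * `|xi| * `|u| ^+ 2.
  apply: le_trans (HK _ _ _) _; rewrite expr2 !mulrA !ler_wpM2r//; exact: ler_norm.
apply: (@le_trans _ _ (`|jK J| * (`|K0| * `|xi| * `|u| ^+ 2) * `|xi|)).
  by rewrite ler_wpM2r//; apply: le_trans (ler_wpM2l (normr_ge0 _) h); rewrite ler_wpM2r// ler_norm.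
rewrite [leLHS](_ : _ = K * `|xi| ^+ 2 * (jc J * `|u| ^+ 2)).
  rewrite ler_wpM2l ?jg_ge// mulr_ge0 ?sqr_ge0// divr_ge0 ?mulr_ge0//; exact: ltW.
by rewrite /K; field; exact: lt0r_neq0.
Qed.

(** Put P = a (1 - q). If P >= b, then P^2 - 2 P b <= (P - b)^2 <= (D s)^2; otherwise the left-hand
    side is at most 0. The nonnegative term a^2 q^2 of P^2 is dropped. *)
Lemma square_lower (a q b D s : R) : 0 <= a -> 0 <= b -> 0 <= D -> 0 <= s -> q <= 1 ->
  a * (1 - q) - b <= D * s ->
  a ^+ 2 - 2 * (a ^+ 2 * q) - D ^+ 2 <= D ^+ 2 * (s ^+ 2 - 1) + 2 * (a * b * (1 - q)).
Proof.
move=> a0 b0 D0 s0 q1 h.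
have P0 : 0 <= a * (1 - q) by rewrite mulr_ge0// subr_ge0.
suff : (a * (1 - q)) ^+ 2 - 2 * (a * (1 - q)) * b <= (D * s) ^+ 2.
  have : 0 <= a ^+ 2 * q ^+ 2 by rewrite mulr_ge0 ?sqr_ge0.
  rewrite !exprMn; lra.
have [Pb|Pb] := leP b (a * (1 - q)).
  have : (a * (1 - q) - b) ^+ 2 <= (D * s) ^+ 2.
    by rewrite lerXn2r ?nnegrE ?subr_ge0// mulr_ge0.
  have := sqr_ge0 b; lra.
apply: le_trans (sqr_ge0 _); have : 0 <= a * (1 - q) * (b - a * (1 - q)) by rewrite mulr_ge0// subr_ge0 ltW.
have := mulr_ge0 P0 b0; lra.
Qed.

Lemma curve_length_ge0 (c : R -> M) : (0 <= curve_length g c)%E.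
Proof. by apply: integral_ge0 => t _; exact: speed_ge0. Qed.

Lemma dist_lower (E : R) : 0 <= E -> exists C1 C2 d, [/\ 0 < d, 0 <= C1, 0 <= C2 &
  forall xi eta e1 e2 m, xi != eta -> `|xi| <= m -> `|eta| <= m -> m <= d ->
    `|e1| <= E * m ^+ 4 -> `|e2| <= E * m ^+ 4 ->
    let a := Num.sqrt (jg J (eta - xi) (eta - xi)) in
    (((a * (1 - jQ J xi eta / (6 * a ^+ 2)) - C1 * m ^+ 4) / Num.sqrt (1 + C2 * m ^+ 3))%:E
    <= riemannian_dist g (chart_inv i (x0 + phi xi e1)) (chart_inv i (x0 + phi eta e2)))%E].
Proof.
move=> E0; have [C0 [d0 [d00 C00 H0]]] := upper_estimate HT E0.
have [KQ KQ0 HQ] := jQ_bound.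
have [Ce Ce0 He] := endpoint_estimate J E0.
(* Chosen so that a <= A m, from a^2 <= |jK| |u|^2 and |u| <= 2m. *)
pose A := 2 * (`|jK J| + 1).
have A0 : 0 < A by rewrite mulr_gt0// ltr_wpDl.
(* A curve that starts within C0 m and reaches distance rho m has length at least kappa (rho/2 - C0)
   m = 2 A m, which is at least a (1 - q). *)
pose rho := 2 * (C0 + 2 * A / kappa).
have rho0 : 0 < rho by rewrite mulr_gt0// ltr_wpDl// divr_gt0// mulr_gt0.
have [r r0 Hr] := exit_length.
have [Cs [ds [ds0 Cs0 Hs]]] := stay_length (ltW rho0).
have [r1 r10 Hr1] := near0_ball (open_near0 (@chart_image_openE _ _ M i) x0i).
pose d := Num.min (Num.min 1 (KQ + 1)^-1) (Num.min (Num.min d0 ds) (Num.min (r / rho) (r1 / (rho + 1)))).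
have dP m : m <= d -> [/\ m <= 1, m * (KQ + 1) <= 1, m <= d0, m <= ds & m * rho <= r /\ m * (rho + 1) <= r1].
  rewrite !le_min => /andP[/andP[-> h1] /andP[/andP[-> ->] /andP[h2 h3]]]; split => //.
    by rewrite -ler_pdivlMr ?div1r// ltr_wpDl.
  by rewrite -!ler_pdivlMr// ltr_wpDl// ltW.
exists (2 * Ce), Cs, d; split => //.
- rewrite !lt_min ltr01 invr_gt0 ltr_wpDl// d00 ds0 !divr_gt0//.
  by rewrite ltr_wpDl// ltW.
- by rewrite mulr_ge0.
move=> xi eta e1 e2 m xe xim etam /dP[m1 mK md0 mds [mr mr1]] e1m e2m.
pose u := eta - xi; pose a := Num.sqrt (jg J u u); pose Q := jQ J xi eta.
rewrite -/u -/a -/Q /=.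
have u0 : u != 0 by rewrite subr_eq0 eq_sym.
have m0 : 0 < m.
  rewrite lt_neqAle (le_trans _ xim)// andbT; apply: contraNneq xe => mE; move: xim etam; rewrite -mE.
  by rewrite !normr_le0 => /eqP -> /eqP ->.
have m0' := ltW m0.
have gu : 0 < jg J u u.
  by apply: lt_le_trans (jg_ge J u); rewrite mulr_gt0 ?jc_gt0// exprn_gt0// normr_gt0.
have a0 : 0 < a by rewrite sqrtr_gt0.
have a2 : a ^+ 2 = jg J u u by rewrite sqr_sqrtr// ltW.
have um : `|u| <= 2 * m.
  apply: le_trans (ler_normB _ _) _; lra.
have aA : a <= A * m.
  suff : a ^+ 2 <= (A * m) ^+ 2 by rewrite ler_sqr// nnegrE ?mulr_ge0// ltW.
  rewrite a2.
  apply: le_trans (ler_norm _) _; apply: le_trans (jg_le _ _ _) _.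
  have k1 : `|jK J| <= (`|jK J| + 1) ^+ 2.
    by rewrite sqrrD expr1n; have := sqr_ge0 `|jK J|; have := normr_ge0 (jK J); lra.
  rewrite -mulrA -expr2 /A exprMn (exprMn _ 2).
  apply: (@le_trans _ _ (`|jK J| * `|u| ^+ 2)); first by rewrite ler_wpM2r ?sqr_ge0// ler_norm.
  have u2 : `|u| ^+ 2 <= 2 ^+ 2 * m ^+ 2 by rewrite -exprMn lerXn2r ?nnegrE// mulr_ge0.
  apply: le_trans (ler_pM (normr_ge0 (jK J)) (sqr_ge0 _) k1 u2) _.
  by rewrite le_eqVlt; apply/orP; left; apply/eqP; ring.
have Qu : jQ J xi u = Q.
  by rewrite /u -scaleN1r jQ_sym jQ_shift jQ_sym.
have Qeta : jQ J eta u = Q.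
  by rewrite -[eta](subrK xi) -/u addrC -[in jQ J (xi + u)](scale1r u) jQ_shift.
(* The relative curvature correction. It is at most 1 in absolute value because Q = R(xi,u,u,xi) is
   at most KQ m^2 a^2, however close xi and eta are. *)
pose q := Q / (6 * a ^+ 2); rewrite -/q.
have q1 : `|q| <= 1.
  rewrite /q normrM normfV (ger0_norm (_ : 0 <= 6 * a ^+ 2)); last by rewrite mulr_ge0 ?sqr_ge0.
  rewrite ler_pdivrMr ?mulr_gt0 ?exprn_gt0// mul1r -Qu.
  apply: le_trans (HQ _ _) _; rewrite -a2 ler_wpM2r ?sqr_ge0//.
  have h1 : `|xi| ^+ 2 <= m by rewrite (le_trans (_ : _ <= m ^+ 2)) ?lerXn2r ?nnegrE// expr2 ler_piMl.
  have := ler_wpM2l KQ0 h1; move: mK; rewrite mulrDr mulr1; lra.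
have ell : a * (1 - q) - 2 * Ce * m ^+ 4 <= 2 * A * m.
  have h1 : 0 <= 2 * Ce * m ^+ 4 by rewrite !mulr_ge0// exprn_ge0.
  have h2 : a * (1 - q) <= a * 2.
    by rewrite ler_pM2l//; have := ler_norm (- q); rewrite normrN; lra.
  lra.
pose s := Num.sqrt (1 + Cs * m ^+ 3); rewrite -/s.
have s1 : 1 <= s.
  by rewrite -{1}sqrtr1 ler_wsqrtr// lerDl mulr_ge0// exprn_ge0.
have t0 : `|0 : R| <= 2 by rewrite normr0.
have t1 : `|1 : R| <= 2 by rewrite normr1 ler1n.
have [y0 _] := H0 xi eta e1 e2 m 0 xim etam md0 e1m e2m t0.
have [y1 _] := H0 xi eta e1 e2 m 1 xim etam md0 e1m e2m t1.
rewrite !scale0r !addr0 -/(phi xi e1) in y0.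
rewrite !scale1r !(addrC _ (_ - _)) !subrK (addrC _ (_ + _)) (addrC (phi2 _ _)) in y1.
have {}y1 : `|phi eta e2| <= C0 * m.
  by move: y1; rewrite /phi; congr (`|_| <= _); apply/rowP => k; rewrite !mxE; ring.
have C0rho : C0 * m <= rho * m.
  rewrite ler_pM2r// /rho; have : 0 <= 2 * A / kappa by rewrite divr_ge0 ?mulr_ge0// ltW.
  lra.
have ball y : `|y| <= rho * m -> chart_image i (x0 + y).
  move=> yr; apply: Hr1; apply: le_lt_trans yr _; apply: lt_le_trans mr1.
  by rewrite mulrC ltr_pM2l// ltrDl.
have [pi pE] := chart_image_inv (ball _ (le_trans y0 C0rho)).
have [qi qE] := chart_image_inv (ball _ (le_trans y1 C0rho)).
apply: le_ereal_inf_tmp => _ [c cpq <-].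
have pE' : chart i (chart_inv i (x0 + phi xi e1)) - x0 = phi xi e1 by rewrite pE addrC addKr.
have qE' : chart i (chart_inv i (x0 + phi eta e2)) - x0 = phi eta e2 by rewrite qE addrC addKr.
have pm : `|chart i (chart_inv i (x0 + phi xi e1)) - x0| <= rho * m.
  by rewrite pE'; exact: le_trans y0 C0rho.
have [stay|[T [T01 cT Tr]]] := exit_or_stay ball cpq pi pm; last first.
  have rm : 0 < rho * m <= r by rewrite mulr_gt0//= mulrC.
  have pm' : `|chart i (chart_inv i (x0 + phi xi e1)) - x0| <= C0 * m by rewrite pE'.
  have := Hr _ _ _ _ _ _ rm pi pm' cpq T01 cT Tr; apply: le_trans.
  rewrite lee_fin ler_pdivrMr ?(lt_le_trans ltr01)//.
  apply: le_trans ell _; rewrite (_ : kappa * _ = 2 * A * m).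
    by rewrite ler_peMr// !mulr_ge0// ltW.
  by rewrite /rho; field; exact: lt0r_neq0.
pose e := a^-1 *: u.
have ee : jg J e e = 1.
  by rewrite /e jgZ jgZr -a2; field; exact: lt0r_neq0.
have m0s : 0 <= m <= ds by rewrite m0'.
have := Hs e m _ _ c ee m0s cpq stay; apply: le_trans.
rewrite lee_fin ler_pM2r ?invr_gt0 ?(lt_le_trans ltr01)// pE' qE'.
have := He e xi e1 m ee xim m1 e1m; have := He e eta e2 m ee etam m1 e2m.
rewrite -/(phi eta e2) -/(phi xi e1) /e !(jgZ J) !jQZr Qu Qeta.
have gE : jg J u eta = jg J u xi + a ^+ 2 by rewrite a2 -jgDr /u addrCA subrr addr0.
rewrite gE !ler_norml => /andP[h1 _] /andP[_ h2].
(* The correction has the same curvature factor at both endpoints, and <e, eta> - <e, xi> = a. *)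
have -> : a * (1 - q) = a^-1 * (jg J u xi + a ^+ 2) - 6^-1 * (a^-1 * (jg J u xi + a ^+ 2) * (a^-1 ^+ 2 * Q))
   - (a^-1 * jg J u xi - 6^-1 * (a^-1 * jg J u xi * (a^-1 ^+ 2 * Q))).
  by rewrite /q; field; exact: lt0r_neq0.
lra.
Qed.
Lemma dist_estimate (E : R) : 0 <= E -> exists C d, [/\ 0 < d, 0 <= C &
  forall xi eta e1 e2 m, xi != eta -> `|xi| <= m -> `|eta| <= m -> m <= d ->
    `|e1| <= E * m ^+ 4 -> `|e2| <= E * m ^+ 4 ->
    let D := fine (riemannian_dist g (chart_inv i (x0 + phi xi e1))
                                     (chart_inv i (x0 + phi eta e2))) in
    `|jg J (eta - xi) (eta - xi) - D ^+ 2 - 3^-1 * jQ J xi eta| <= C * m ^+ 5].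
Proof.
move=> E0; have [C1 [d1 [d10 C10 H1]]] := dist_upper E0.
have [C2 [C3 [d2 [d20 C20 C30 H2]]]] := dist_lower E0.
have [KQ KQ0 HQ] := jQ_bound.
pose A := 4 * `|jK J|.
have A0 : 0 <= A by rewrite mulr_ge0.
pose L := (A + KQ * A) + C1.
pose C := C1 + (L * C3 + 4 * (A + 1) * C2).
have L0 : 0 <= L by rewrite !addr_ge0// mulr_ge0.
have C0 : 0 <= L * C3 + 4 * (A + 1) * C2 by rewrite addr_ge0 ?mulr_ge0// addr_ge0.
exists C, (Num.min (Num.min d1 d2) (Num.min 1 (KQ + 1)^-1)); split.
- by rewrite !lt_min d10 d20 ltr01 invr_gt0 ltr_wpDl.
- by rewrite addr_ge0.
move=> xi eta e1 e2 m xe xim etam; rewrite !le_min => /andP[/andP[md1 md2] /andP[m1 mK]] e1m e2m /=.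
have m0 : 0 <= m by apply: le_trans xim.
have {}mK : m * (KQ + 1) <= 1 by rewrite -ler_pdivlMr ?div1r// ltr_wpDl.
have [B [B0 B2 dB]] := H1 _ _ _ _ _ xim etam md1 e1m e2m.
have dl := H2 _ _ _ _ _ xe xim etam md2 e1m e2m.
move: dl dB; set D := fine _.
set dd := riemannian_dist _ _ _ => dl dB.
have dd0 : (0 <= dd)%E by apply: le_ereal_inf_tmp => _ [c _ <-]; exact: curve_length_ge0.
(* The upper bound puts both points at finite distance, so that [fine] loses nothing. *)
have ddE : dd = D%:E.
  by rewrite /D fineK// fin_numElt (lt_le_trans (ltNyr 0) dd0) (le_lt_trans dB (ltry _)).
have D0 : 0 <= D by rewrite -lee_fin -ddE.
rewrite ddE lee_fin in dB.
pose u := eta - xi; pose a := Num.sqrt (jg J u u); pose Q := jQ J xi eta.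
move: B2 dl; rewrite /= -/u -/Q ddE lee_fin -/a => B2 dl.
have u0 : u != 0 by rewrite subr_eq0 eq_sym.
have gu : 0 < jg J u u.
  by apply: lt_le_trans (jg_ge J u); rewrite mulr_gt0 ?jc_gt0// exprn_gt0// normr_gt0.
have a0 : 0 < a by rewrite sqrtr_gt0.
have a2 : a ^+ 2 = jg J u u by rewrite sqr_sqrtr// ltW.
have um : `|u| <= 2 * m by apply: le_trans (ler_normB _ _) _; lra.
have aA : a ^+ 2 <= A * m ^+ 2.
  rewrite a2; apply: le_trans (ler_norm _) _; apply: le_trans (jg_le _ _ _) _.
  apply: (@le_trans _ _ (`|jK J| * `|u| * `|u|)); first by rewrite !ler_wpM2r// ler_norm.
  rewrite [leRHS](_ : _ = `|jK J| * (2 * m) * (2 * m)); last by rewrite /A; ring.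
  by rewrite ler_pM ?mulr_ge0// ler_wpM2l.
have Qu : jQ J xi u = Q by rewrite /u -scaleN1r jQ_sym jQ_shift jQ_sym.
have Qb : `|Q| <= KQ * m * a ^+ 2.
  rewrite -Qu; apply: le_trans (HQ _ _) _; rewrite -a2 ler_wpM2r ?sqr_ge0// ler_wpM2l//.
  by rewrite (le_trans (_ : _ <= m ^+ 2)) ?lerXn2r ?nnegrE// expr2 ler_piMl.
have KQm : KQ * m <= 1 by move: mK; rewrite mulrDr mulr1; lra.
have Da : D ^+ 2 <= L * m ^+ 2.
  apply: le_trans (_ : B ^+ 2 <= _); first by rewrite lerXn2r ?nnegrE.
  apply: le_trans B2 _; rewrite -a2.
  have h1 : KQ * m * a ^+ 2 <= KQ * (A * m ^+ 2).
    apply: ler_pM => //; [exact: mulr_ge0|exact: sqr_ge0|exact: ler_piMr].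
  have h2 : C1 * m ^+ 5 <= C1 * m ^+ 2 by rewrite ler_wpM2l// ler_wiXn2l.
  move: Qb h1 h2; rewrite /L ler_norml => /andP[]; have := sqr_ge0 a.
  have := mulr_ge0 KQ0 (mulr_ge0 A0 (sqr_ge0 m)); lra.
rewrite ler_norml; apply/andP; split; last first.
  pose q := Q / (6 * a ^+ 2).
  have q1 : `|q| <= 1.
    rewrite /q normrM normfV (ger0_norm (_ : 0 <= 6 * a ^+ 2)); last by rewrite mulr_ge0 ?sqr_ge0.
    rewrite ler_pdivrMr ?mulr_gt0 ?exprn_gt0// mul1r; apply: le_trans Qb _.
    by rewrite ler_wpM2r ?sqr_ge0//; lra.
  have /andP[q1' q1''] : -1 <= q <= 1 by rewrite -ler_norml.
  rewrite ler_pdivrMr ?sqrtr_gt0 ?ltr_pwDl ?mulr_ge0 ?exprn_ge0// in dl.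
  have b0 : 0 <= C2 * m ^+ 4 by rewrite mulr_ge0// exprn_ge0.
  have := square_lower (ltW a0) b0 D0 (sqrtr_ge0 _) q1'' dl.
  have s2 : Num.sqrt (1 + C3 * m ^+ 3) ^+ 2 = 1 + C3 * m ^+ 3.
    by rewrite sqr_sqrtr// addr_ge0// mulr_ge0// exprn_ge0.
  have aq : a ^+ 2 * q = 6^-1 * Q by rewrite /q; field; exact: lt0r_neq0.
  rewrite s2 aq.
  have h1 : D ^+ 2 * (C3 * m ^+ 3) <= L * C3 * m ^+ 5.
    rewrite [leRHS](_ : _ = L * m ^+ 2 * (C3 * m ^+ 3)); last by ring.
    by rewrite ler_wpM2r// mulr_ge0// exprn_ge0.
  have am : a <= (A + 1) * m.
    suff : a ^+ 2 <= ((A + 1) * m) ^+ 2 by rewrite ler_sqr// nnegrE ?mulr_ge0 ?addr_ge0// ltW.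
    apply: le_trans aA _; rewrite exprMn ler_wpM2r ?sqr_ge0//.
    by rewrite sqrrD expr1n; have := sqr_ge0 A; lra.
  have h2 : a * (C2 * m ^+ 4) * (1 - q) <= 2 * (A + 1) * C2 * m ^+ 5.
    rewrite [leRHS](_ : _ = (A + 1) * m * (C2 * m ^+ 4) * 2); last by ring.
    apply: ler_pM; [exact: (mulr_ge0 (ltW a0))|by rewrite subr_ge0|by rewrite ler_wpM2r|lra].
  have h3 : 0 <= C1 * m ^+ 5 by rewrite mulr_ge0// exprn_ge0.
  rewrite -a2 /C; move: h1 h2 h3; lra.
have DB : D ^+ 2 <= B ^+ 2 by rewrite lerXn2r ?nnegrE.
have h3 : 0 <= (L * C3 + 4 * (A + 1) * C2) * m ^+ 5 by rewrite mulr_ge0// exprn_ge0.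
have CE : C * m ^+ 5 = C1 * m ^+ 5 + (L * C3 + 4 * (A + 1) * C2) * m ^+ 5 by rewrite /C mulrDl.
by rewrite CE; move: h3 DB B2; clear; lra.
Qed.
Lemma core_estimate : jg J = tg (gram g i) x0 -> jGa J = tGa (gram g i) x0 ->
  jG J = tG (gram g i) x0 ->
  exists C d, [/\ 0 < d, 0 <= C & forall v w m, tangent z v -> tangent z w ->
    v != 0 -> w != 0 -> v != w -> `|v i| <= m -> `|w i| <= m -> m <= d ->
    `|tnorm g z (v - w) ^+ 2 - fine (riemannian_dist g (exp_map g z v) (exp_map g z w)) ^+ 2
      - 3^-1 * jQ J (v i) (w i)| <= C * m ^+ 5].
Proof.
move=> gE GaE GE; have [E [d1 [d10 E0 He]]] := exp_map_chart zi GaE GE.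
have [C [d2 [d20 C0 HC]]] := dist_estimate E0.
exists C, (Num.min d1 d2); split => //; first by rewrite lt_min d10.
move=> v w m vt wt v0 w0 vw vm wm; rewrite le_min => /andP[md1 md2].
have nz (u : tvec M) : tangent z u -> u != 0 -> u i != 0.
  move=> ut; apply: contraNneq => ui; apply/eqP; apply: (tangent_eq zi ut) => //.
  exact: tangent0.
have K u : tangent z u -> u != 0 -> `|u i| <= m -> exists2 e, `|e| <= E * m ^+ 4 &
    exp_map g z u = chart_inv i (x0 + phi (u i) e).
  move=> ut u0 um; have [ei eb] := He u ut (nz u ut u0) (le_trans um md1).
  (* The remainder of the exponential map is passed as the error argument of [phi], which makes the
     endpoints exact. *)
  exists (chart i (exp_map g z u) - x0 - (u i + (phi2 J (u i) + phi3 J (u i)))).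
    by apply: le_trans eb _; rewrite ler_wpM2l// lerXn2r ?nnegrE// (le_trans _ um).
  rewrite -[LHS](chartK ei); congr chart_inv; apply/rowP => k; rewrite !mxE; ring.
have [e1 e1m vE] := K v vt v0 vm; have [e2 e2m wE] := K w wt w0 wm.
have xe : v i != w i.
  by apply: contraNneq vw => h; apply/eqP; exact: (tangent_eq zi vt wt h).
have := HC _ _ _ _ _ xe vm wm md2 e1m e2m; rewrite /= -vE -wE.
have vwt := tangentB vt wt.
have gvw : g z (v - w) (v - w) = jg J (w i - v i) (w i - v i).
  by rewrite (metric_chart g zi vwt vwt) -[(v - w) i]/(v i - w i) -(opprB (w i)) -[LHS]/(tg _ x0 _ _) -gE jgN jgNr opprK.
rewrite /tnorm sqr_sqrtr gvw//; apply: le_trans (jg_ge _ _).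
by rewrite mulr_ge0 ?sqr_ge0// ltW// jc_gt0.
Qed.
End DistanceEstimate.

(** * Curvature *)

Lemma eq0_of_small (R : realType) (x K d : R) : 0 < d ->
  (forall t, 0 < t <= d -> `|t ^+ 4 * x| <= K * t ^+ 5) -> x = 0.
Proof.
move=> d0 H; apply/eqP; rewrite -normr_le0 leNgt; apply/negP => x0.
pose K' := `|K| + 1; have K'0 : 0 < K' by rewrite ltr_wpDl.
pose t := Num.min d (`|x| / (2 * K')).
have t0 : 0 < t by rewrite lt_min d0 divr_gt0// mulr_gt0.
have := H t; rewrite t0 ge_min lexx => /(_ isT).
have t4 : 0 < t ^+ 4 by rewrite exprn_gt0.
rewrite normrM (ger0_norm (ltW t4)) (_ : K * t ^+ 5 = t ^+ 4 * (K * t)); last by ring.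
rewrite ler_pM2l// => h.
have tx : t * (2 * K') <= `|x| by rewrite -ler_pdivlMr ?mulr_gt0// ge_min lexx orbT.
have : K * t <= K' * t by rewrite ler_wpM2r ?(ltW t0)// /K' (le_trans (ler_norm _))// lerDl.
have := mulr_gt0 K'0 t0; move: tx h x0; lra.
Qed.

Section CurvatureInCharts.
Context {R : realType} {n : nat} (M : manifold R n) (g : riemannian_metric M).
Local Notation V := 'rV[R]_n.
Implicit Types (i j : chart_index M) (u v w : tvec M).
Variable z : M.

(** The jet of g at z in the chart i. The differentials of the metric are pinned down through the
    Taylor estimate, the form in which they are used. *)
Definition chart_jet i (J : jet R n) : Prop :=
  [/\ jg J = tg (gram g i) (chart i z), jGa J = tGa (gram g i) (chart i z),
      jG J = tG (gram g i) (chart i z) &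
      exists2 C, 0 <= C & \forall y \near (0 : V), forall u w : V,
        `|bf (gram g i (chart i z + y)) u w - (jg J u w + jB J y u w + 2^-1 * jH J y y u w)|
          <= C * `|y| ^+ 3 * `|u| * `|w|].

Lemma chart_jet_exists i : chart_dom i z -> exists J, chart_jet i J.
Proof.
move=> zi; have x0i := chart_in_image zi.
have [J [E1 E2 E3 E4 E5]] := local_jet (@chart_image_openE _ _ M i) (gram_sym g (i:=i))
  (gram_pos g (i:=i)) (gram_Ck g i) x0i.
exists J; split => //; rewrite E1 E2 E3.
exact: (metric_taylor (@chart_image_openE _ _ M i) (gram_Ck g i) x0i).
Qed.

Lemma bf_basis_row (A : 'I_n -> 'I_n -> R) a (w : V) : bf A (basis_vec a) w = \sum_b A a b * w 0 b.
Proof.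
rewrite /bf (bigD1 a)//= [X in _ + X]big1 ?addr0 => [|c /negbTE ca].
  by apply: eq_bigr => b _; rewrite mxE !eqxx mulr1.
by apply: big1 => b _; rewrite mxE ca andbF mulr0 mul0r.
Qed.

Lemma bf_basis (A : 'I_n -> 'I_n -> R) a b : bf A (basis_vec a) (basis_vec b) = A a b.
Proof.
rewrite bf_basis_row (bigD1 b)//= big1 ?addr0; first by rewrite mxE !eqxx mulr1.
by move=> c /negbTE cb; rewrite mxE cb andbF mulr0.
Qed.

Lemma riemann_jet i J : chart_jet i J -> forall a b c d,
  jR J (basis_vec a) (basis_vec b) (basis_vec c) 0 d = riemann g i d a b c (chart i z).
Proof.
move=> [_ GaE GE _] a b c d; rewrite /jR GaE GE !mxE !bf_basis !bf_basis_row !dir_basis /riemann.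
rewrite -addrA sumrB; congr (_ - _ + (_ - _)); apply: eq_bigr => m _; rewrite mxE bf_basis; exact: mulrC.
Qed.

Lemma curvature_chart i J u v w : chart_dom i z -> chart_jet i J ->
  curvature g z u v w i = jR J (u i) (v i) (w i).
Proof.
move=> zi JE; rewrite /curvature /at_charts; case: asboolP => // _; apply/rowP => d; rewrite mxE.
rewrite (lin_expand (f := fun x => jR J x (v i) (w i) 0 d)); last 2 first.
- by move=> *; rewrite jRDl mxE.
- by move=> *; rewrite jRZl mxE.
apply: eq_bigr => a _; rewrite (lin_expand (f := fun x => jR J _ x (w i) 0 d)); last 2 first.
- by move=> *; rewrite jRDm mxE.
- by move=> *; rewrite jRZm mxE.
rewrite mulr_sumr; apply: eq_bigr => b _.
rewrite (lin_expand (f := fun x => jR J _ _ x 0 d)); last 2 first.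
- by move=> *; rewrite jRDr mxE.
- by move=> *; rewrite jRZr mxE.
rewrite 2!mulr_sumr; apply: eq_bigr => c _.
by rewrite (riemann_jet JE); ring.
Qed.

(** Applied to tv and tw, the curvature term scales as t^4 and the error as t^5. The cases v = 0, w
    = 0 and v = w are set apart because [core_estimate] concerns distinct nonzero vectors; both
    values vanish there. *)
Lemma jQ_indep i j J J' v w : chart_dom i z -> chart_dom j z -> chart_jet i J -> chart_jet j J' ->
  tangent z v -> tangent z w -> jQ J (v i) (w i) = jQ J' (v j) (w j).
Proof.
move=> zi zj [J1 J2 J3 J4] [J1' J2' J3' J4'] vt wt.
have Q0 (J0 : jet R n) (x : V) : jQ J0 0 x = 0 by rewrite -(scale0r (0 : V)) jQZ expr0n mul0r.
have [->|v0] := eqVneq v 0; first by rewrite !Q0.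
have Q0r (J0 : jet R n) (x : V) : jQ J0 x 0 = 0 by rewrite jQ_sym.
have [->|w0] := eqVneq w 0; first by rewrite !Q0r.
have [->|vw] := eqVneq v w; first by rewrite -!jF_diag !jF_self.
have [C [d [d0 C0 H]]] := core_estimate zi J4 J1 J2 J3.
have [C' [d' [d0' C0' H']]] := core_estimate zj J4' J1' J2' J3'.
pose N := 1 + (`|v i| + `|w i| + (`|v j| + `|w j|)).
have N0 : 0 < N by rewrite ltr_pwDl// !addr_ge0.
apply/eqP; rewrite -subr_eq0; apply/eqP.
apply: (@eq0_of_small _ _ (3 * (C + C') * N ^+ 5) (Num.min d d' / N)).
  by rewrite divr_gt0// lt_min d0.
move=> t /andP[t0]; rewrite ler_pdivlMr// le_min => /andP[td td'].
have bnd (x : V) : `|x| <= N -> `|t *: x| <= t * N.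
  by move=> xN; rewrite normrZ gtr0_norm// ler_pM2l.
have tv := tangentZ t vt; have tw := tangentZ t wt.
have nz (x : tvec M) : x != 0 -> t *: x != 0.
  by move=> x0; rewrite scaler_eq0 negb_or x0 gt_eqF.
have tvw : t *: v != t *: w by rewrite -subr_eq0 -scalerBr nz// subr_eq0.
have [n1 n2 n3 n4] : [/\ `|v i| <= N, `|w i| <= N, `|v j| <= N & `|w j| <= N].
  have := normr_ge0 (v i); have := normr_ge0 (w i); have := normr_ge0 (v j); have := normr_ge0 (w j).
  by move=> *; split; rewrite /N; lra.
have h := H _ _ (t * N) tv tw (nz _ v0) (nz _ w0) tvw (bnd _ n1) (bnd _ n2) td.
have h' := H' _ _ (t * N) tv tw (nz _ v0) (nz _ w0) tvw (bnd _ n3) (bnd _ n4) td'.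
rewrite -[(t *: v) _]/(t *: v i) -[(t *: w) _]/(t *: w i) jQZ jQZr in h.
rewrite -[(t *: v) _]/(t *: v j) -[(t *: w) _]/(t *: w j) jQZ jQZr in h'.
set X := tnorm _ _ _ ^+ 2 - _ in h h'; clearbody X.
have tN : (t * N) ^+ 5 = N ^+ 5 * t ^+ 5 by rewrite exprMn mulrC.
have t4 : t ^+ 4 = t ^+ 2 * t ^+ 2 by rewrite -exprD.
rewrite t4; move: h h'; rewrite tN !ler_norml => /andP[? ?] /andP[? ?]; apply/andP; split; lra.
Qed.

Lemma metric_jR i J u v w : chart_dom i z -> chart_jet i J -> tangent z u ->
  g z (tvec_of i z (jR J (v i) (w i) (w i))) u = jF J (w i) (v i) (u i).
Proof.
move=> zi [gE _ _ _] ut; have ct := tangent_tvec_of (jR J (v i) (w i) (w i)) zi.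
by rewrite (metric_chart g zi ct ut) tvec_ofE// /jF gE.
Qed.

(* The chart components of R(v, w)w glue to a tangent vector: its pairings with
   tangent vectors are the polarization of the intrinsic form [v |-> jQ v w]. *)
Lemma curvature_tvec_of i J v w : chart_dom i z -> chart_jet i J -> tangent z v -> tangent z w ->
  curvature g z v w w = tvec_of i z (jR J (v i) (w i) (w i)).
Proof.
move=> zi JE vt wt; apply/funext => j.
have [zj|zj] := pselect (chart_dom j z); last first.
  by rewrite /curvature /tvec_of /at_charts; case: asboolP.
have [J' JE'] := chart_jet_exists zj; rewrite (curvature_chart _ _ _ zj JE').
have ci := tangent_tvec_of (jR J (v i) (w i) (w i)) zi.
have cj := tangent_tvec_of (jR J' (v j) (w j) (w j)) zj.
have polar (J0 : jet R n) (y x x' : V) :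
    jF J0 y x x' = 2^-1 * (jQ J0 (x + x') y - jQ J0 x y - jQ J0 x' y).
  by rewrite ![jQ _ _ y]jQ_sym -!jF_diag jF_D !jF_Dr (jF_sym J0 y x' x); field.
have E u : tangent z u -> g z (tvec_of i z (jR J (v i) (w i) (w i))) u =
    g z (tvec_of j z (jR J' (v j) (w j) (w j))) u.
  move=> ut; rewrite (metric_jR _ _ zi JE ut) (metric_jR _ _ zj JE' ut) !polar.
  have := jQ_indep zi zj JE JE' (tangentD vt ut) wt; have := jQ_indep zi zj JE JE' vt wt.
  by have := jQ_indep zi zj JE JE' ut wt => -> -> ->.
(* By E, the difference of the two candidates is orthogonal to every tangent vector, in particular
   to itself. *)
have dt := tangentB ci cj.
suff : tvec_of i z (jR J (v i) (w i) (w i)) - tvec_of j z (jR J' (v j) (w j) (w j)) = 0.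
  by move/subr0_eq => ->; rewrite tvec_ofE.
apply: contrapT => d0; have := Defs.metric_pos g dt d0.
have := Defs.metric_linear g (-1) cj ci dt.
rewrite (E _ dt) mulN1r addNr scaleN1r [X in g z X _](_ : _ = tvec_of i z (jR J (v i) (w i) (w i))
  - tvec_of j z (jR J' (v j) (w j) (w j))) => [->|]; last exact: addrC.
by rewrite ltxx.
Qed.

Lemma metric_curvature_jet i J v w : chart_dom i z -> chart_jet i J ->
  tangent z v -> tangent z w ->
  g z (curvature g z v w w) v = jQ J (v i) (w i).
Proof.
move=> zi JE vt wt; rewrite (curvature_tvec_of zi JE vt wt) (metric_jR _ _ zi JE vt).
by rewrite jF_diag jQ_sym.
Qed.
End CurvatureInCharts.

(** * The two limits *)

Section Asymptotics.
Context {R : realType} {n : nat} (M : manifold R n) (g : riemannian_metric M).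
Variables (z : M) (v w : tvec M).
Hypotheses (hv : tangent z v) (hw : tangent z w) (hvw : lin_indep v w).

Lemma tnorm_sq u : tangent z u -> tnorm g z u ^+ 2 = g z u u.
Proof.
move=> ut; have [i zi] := chart_cover z; rewrite /tnorm sqr_sqrtr// (metric_chart g zi ut ut).
have [->|ui] := eqVneq (u i) 0; first by rewrite bf0l.
by apply/ltW/gram_pos => //; exact: chart_in_image.
Qed.

Lemma tnorm_sqZ (a : R) u : tangent z u -> tnorm g z (a *: u) ^+ 2 = a ^+ 2 * tnorm g z u ^+ 2.
Proof.
move=> ut; have aut := tangentZ a ut; have [i zi] := chart_cover z.
rewrite !tnorm_sq// (metric_chart g zi aut aut) (metric_chart g zi ut ut).
by rewrite -[(a *: u) i]/(a *: u i) bfZ bfZr; ring.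
Qed.

Let D0 := tnorm g z v ^+ 2 * tnorm g z w ^+ 2 - g z v w ^+ 2.
Let F (s t : R) := (tnorm g z (s *: v - t *: w) ^+ 2
  - fine (riemannian_dist g (exp_map g z (s *: v)) (exp_map g z (t *: w))) ^+ 2)
  / (s ^+ 2 * t ^+ 2 * D0).

(** One estimate serves both limits: with m the larger of |s| and |t|, the quotient m^5 / (s^2 t^2)
    equals |t| on the diagonal and is O(m) when s/t and t/s stay bounded. *)
Lemma defect_estimate : exists C d, [/\ 0 < d, 0 <= C & forall s t m : R,
  s != 0 -> t != 0 -> `|s| <= m -> `|t| <= m -> m <= d ->
  `|sectional_curvature g z v w / 3 - F s t| <= C * (m ^+ 5 / (s ^+ 2 * t ^+ 2))].
Proof.
have [i zi] := chart_cover z; have [J JE] := chart_jet_exists g zi.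
rewrite /sectional_curvature (metric_curvature_jet zi JE hv hw) -/D0.
case: JE => J1 J2 J3 J4; have [C [d [d0 C0 H]]] := core_estimate zi J4 J1 J2 J3.
set Q := jQ J (v i) (w i).
pose N := 1 + (`|v i| + `|w i|).
have N0 : 0 < N by rewrite ltr_pwDl// addr_ge0.
exists (C * N ^+ 5 * `|D0^-1|), (d / N); split; first by rewrite divr_gt0.
  by rewrite mulr_ge0// mulr_ge0// exprn_ge0// ltW.
move=> s t m s0 t0 sm tm; rewrite ler_pdivlMr// => md.
have nz a b : (a != 0) || (b != 0) -> a *: v + b *: w != 0.
  by move=> ab; apply/eqP => /hvw[a0 b0]; move: ab; rewrite a0 b0 eqxx.
have v0 : s *: v != 0 by have := nz s 0; rewrite scale0r addr0; apply; rewrite s0.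
have w0 : t *: w != 0 by have := nz 0 t; rewrite scale0r add0r; apply; rewrite t0 orbT.
have vw : s *: v != t *: w.
  by rewrite -subr_eq0 -scaleNr; apply: nz; rewrite s0.
have m0 : 0 <= m by apply: le_trans sm.
have bnd (a : R) (x : 'rV[R]_n) : `|a| <= m -> `|x| <= N -> `|a *: x| <= m * N.
  by move=> am xN; rewrite normrZ ler_pM.
have [n1 n2] : `|v i| <= N /\ `|w i| <= N.
  by have := normr_ge0 (v i); have := normr_ge0 (w i); split; rewrite /N; lra.
have := H _ _ (m * N) (tangentZ s hv) (tangentZ t hw) v0 w0 vw (bnd _ _ sm n1) (bnd _ _ tm n2) md.
rewrite -[(s *: v) _]/(s *: v i) -[(t *: w) _]/(t *: w i) jQZ jQZr -/Q /F.
set X := tnorm _ _ _ ^+ 2 - _; move=> h.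
have st0 : 0 < s ^+ 2 * t ^+ 2 by rewrite mulr_gt0// exprn_even_gt0.
have -> : Q / D0 / 3 - X / (s ^+ 2 * t ^+ 2 * D0) =
    - (X - 3^-1 * (s ^+ 2 * (t ^+ 2 * Q))) * ((s ^+ 2 * t ^+ 2)^-1 * D0^-1).
  by rewrite invfM; move: D0^-1 => W; field; rewrite s0 t0.
rewrite normrM normrN normrM (gtr0_norm (_ : 0 < (s ^+ 2 * t ^+ 2)^-1)) ?invr_gt0//.
rewrite [leRHS](_ : _ = C * (m * N) ^+ 5 * ((s ^+ 2 * t ^+ 2)^-1 * `|D0^-1|)); last by ring.
by rewrite ler_wpM2r// mulr_ge0// invr_ge0 ltW.
Qed.

Lemma defect_limit : F t t @[t --> (0 : R)^'] --> sectional_curvature g z v w / 3.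
Proof.
have [C [d [d0 C0 H]]] := defect_estimate.
apply/cvgrPdist_le => e e0.
pose d' := Num.min d (e / (C + 1)).
have d'0 : 0 < d' by rewrite lt_min d0 divr_gt0// ltr_wpDl.
near=> t.
have t0 : t != 0 by near: t; exact: nbhs_dnbhs_neq.
have td : `|t| <= d' by near: t; exact: dnbhs0_le.
move: td; rewrite le_min => /andP[td te].
apply: le_trans (H t t `|t| t0 t0 (lexx _) (lexx _) td) _.
have -> : `|t| ^+ 5 / (t ^+ 2 * t ^+ 2) = `|t|.
  by rewrite (_ : t ^+ 2 = `|t| ^+ 2); [field; rewrite normr_eq0|rewrite real_normK ?num_real].
move: te; rewrite ler_pdivlMr ?ltr_wpDl// mulrDr mulr1 mulrC.
by have := normr_ge0 t; lra.
Unshelve. all: by end_near.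
Qed.

Lemma defect_lim_star : lim_star F (sectional_curvature g z v w / 3).
Proof.
have [C [d [d0 C0 H]]] := defect_estimate.
move=> s t s0 t0 sc tc [B HB].
have B0 : 0 <= B.
  have := HB _ (imageP _ (I : setT 0%N)); apply: le_trans.
  by rewrite addr_ge0// divr_ge0// ltW.
apply/cvgrPdist_le => e e0.
have K0 : 0 < C * B ^+ 2 + 1 by rewrite ltr_wpDl// mulr_ge0// exprn_ge0.
pose d' := Num.min d (e / (C * B ^+ 2 + 1)).
have d'0 : 0 < d' by rewrite lt_min d0 divr_gt0.
near=> j.
have sd : s j <= d' by near: j; exact: (cvgr_le (0 : R) sc).
have td : t j <= d' by near: j; exact: (cvgr_le (0 : R) tc).
have sj := s0 j; have tj := t0 j.
have hB : s j / t j + t j / s j <= B by apply: HB; exists j.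
have [q1 q2] : s j <= B * t j /\ t j <= B * s j.
  have : 0 <= s j / t j by rewrite divr_ge0// ltW.
  have : 0 <= t j / s j by rewrite divr_ge0// ltW.
  by move=> ? ?; split; rewrite -ler_pdivrMr//; lra.
(* Here a is the larger and b the smaller of s_j and t_j. From a <= B b follows a^5 / (a^2 b^2) <=
   B^2 a, which explains the constant C B^2 + 1 in d'. *)
have key (a b : R) : 0 < a -> 0 < b -> b <= a -> a <= B * b -> a <= d' ->
    C * (a ^+ 5 / (a ^+ 2 * b ^+ 2)) <= e.
  move=> a0 b0 ba aB; rewrite le_min => /andP[_]; rewrite ler_pdivlMr// => ae.
  have h : a ^+ 5 / (a ^+ 2 * b ^+ 2) <= B ^+ 2 * a.
    rewrite ler_pdivrMr ?mulr_gt0 ?exprn_gt0//.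
    rewrite [leRHS](_ : _ = a ^+ 3 * (B * b) ^+ 2); last by ring.
    rewrite [leLHS](_ : _ = a ^+ 3 * a ^+ 2); last by ring.
    by rewrite ler_wpM2l ?exprn_ge0 ?(ltW a0)// lerXn2r ?nnegrE ?mulr_ge0// ltW.
  by have := ler_wpM2l C0 h; move: ae; lra.
have dd : d' <= d by rewrite ge_min lexx.
have [st|ts] := leP (t j) (s j).
  apply: le_trans (H (s j) (t j) (s j) _ _ _ _ _) _; rewrite ?gt_eqF ?gtr0_norm//.
    exact: le_trans sd dd.
  exact: key.
apply: le_trans (H (s j) (t j) (t j) _ _ _ _ _) _; rewrite ?gt_eqF ?gtr0_norm//; first exact: ltW.
  exact: le_trans td dd.
rewrite [_ ^+ 2 * _]mulrC; apply: key => //; exact: ltW.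
Unshelve. all: by end_near.
Qed.
End Asymptotics.

Theorem corollary2p7 (R : realType) (n : nat) (M : manifold R n)
    (g : riemannian_metric M) (z : M) (v w : tvec M)
    (hv : tangent z v) (hw : tangent z w) (hvw : lin_indep v w) :
  exists L : R,
    [/\ sectional_curvature g z v w = 3 * L,
        (t ^+ 2 * tnorm g z (v - w) ^+ 2
           - fine (riemannian_dist g (exp_map g z (t *: v))
                                     (exp_map g z (t *: w))) ^+ 2)
          / (t ^+ 4 * (tnorm g z v ^+ 2 * tnorm g z w ^+ 2 - g z v w ^+ 2))
          @[t --> (0 : R)^'] --> L
      & lim_star (fun s t : R =>
          (tnorm g z (s *: v - t *: w) ^+ 2
             - fine (riemannian_dist g (exp_map g z (s *: v))
                                       (exp_map g z (t *: w))) ^+ 2)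
            / (s ^+ 2 * t ^+ 2
                 * (tnorm g z v ^+ 2 * tnorm g z w ^+ 2 - g z v w ^+ 2))) L].
Proof.
exists (sectional_curvature g z v w / 3); split; last exact: defect_lim_star.
- by rewrite mulrC divfK.
- apply: cvg_trans (defect_limit hv hw hvw); apply: near_eq_cvg; apply: nearW => t.
  by rewrite -scalerBr (tnorm_sqZ g t (tangentB hv hw)) -exprD.
Qed.
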